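(* Assume that there exist $p,q\in(1,\infty]$ with \[ \frac1p+\frac1q<\frac{2}{d'} \] such that $\bar\mu_p:=\sup_{x\in V}\bar\mu_p(x)<\infty$ and $\bar\nu_q:=\sup_{x\in V}\bar\nu_q(x)<\infty$. Then there exist constants $c_1,c_2,c_3,c_4\in(0,\infty)$, depending only on $d,p,q,\bar\mu_p,\bar\nu_q$ (and on the constants $d',C_{\mathrm{reg}},C_{\mathrm{S}_1}$ of the fixed graph $G$), such that for any given $t>0$ and $x\in V$ with $\sqrt t\ge N(x)\vee 2\,(N_1(x)\vee N_2(x))$ and for all $y\in V$ the following hold. (i) If $d(x,y)\le c_1 t$, then \[ q^\omega(t,x,y)\le c_2\,t^{-d/2}\exp\!\big(-c_3\,d(x,y)^2/t\big). \] (ii) If $d(x,y)\ge c_1 t$, then \[ q^\omega(t,x,y)\le c_2\,t^{-d/2}\exp\!\big(-c_4\,d(x,y)\,(1\vee\log(d(x,y)/t))\big). \]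
   Context: Graph. $G=(V,E)$ is an infinite, connected, locally finite graph with vertex set $V$ and non-oriented edge set $E$; $x\sim y$ means $\{x,y\}\in E$; $d(x,y)$ denotes the natural graph distance, $B(x,r):=\{y\in V: d(x,y)\le r\}$, and $|A|$ is the number of elements of $A\subset V$. Standing assumption on $G$: (i) there exist a number $d\ge2$ and $C_{\mathrm{reg}}\in(0,\infty)$ such that for all $x\in V$ there is $N_1(x)<\infty$ with $C_{\mathrm{reg}}^{-1}n^d\le|B(x,n)|\le C_{\mathrm{reg}}n^d$ for all $n\ge N_1(x)$; (ii) there exist $d'\ge d$ and $C_{\mathrm{S}_1}\in(0,\infty)$ such that for all $x\in V$ there is $N_2(x)<\infty$ such that for all $n\ge N_2(x)$ \[ \Big(\sum_{y\in B(x,n)}|u(y)|^{\frac{d'}{d'-1}}\Big)^{\frac{d'-1}{d'}}\le C_{\mathrm{S}_1}\,n^{1-\frac d{d'}}\sum_{\{y,z\}\in E,\ y\in B(x,n)\text{ or }z\in B(x,n)}|u(y)-u(z)| \] for all $u:V\to\mathbb R$ with $\operatorname{supp}u\subset B(x,n)$. The numbers $d,d',C_{\mathrm{reg}},C_{\mathrm{S}_1},N_1(x),N_2(x)$ are fixed. (The letter $d$ denotes both the exponent and, when written $d(x,y)$, the graph distance.) Weights. $\omega=\{\omega(e)\in(0,\infty):e\in E\}$ is a fixed family of positive weights, $\omega(x,y)=\omega(y,x)=\omega(\{x,y\})$ if $\{x,y\}\in E$ and $\omega(x,y)=0$ otherwise, $\mu^\omega(x):=\sum_{y\sim x}\omega(x,y)$,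 $\nu^\omega(x):=\sum_{y\sim x}1/\omega(x,y)$. Constant speed random walk. $Y=(Y_t)_{t\ge0}$ is the continuous-time Markov chain on $V$ with generator $(\mathcal L^\omega f)(x)=\frac1{\mu^\omega(x)}\sum_{y\sim x}\omega(x,y)(f(y)-f(x))$; $\mathrm P^\omega_x$ is its law started at $x$; its heat kernel is $q^\omega(t,x,y):=\mathrm P^\omega_x[Y_t=y]/\mu^\omega(y)$. Norms. For finite non-empty $A\subset V$: $\|f\|_{p,A}:=\big(\frac1{|A|}\sum_{x\in A}|f(x)|^p\big)^{1/p}$ for $p\in[1,\infty)$ and $\|f\|_{\infty,A}:=\max_{x\in A}|f(x)|$. Set $\bar\mu_p(x):=\limsup_{n\to\infty}\|\mu^\omega\|_{p,B(x,n)}$ and $\bar\nu_q(x):=\limsup_{n\to\infty}\|\nu^\omega\|_{q,B(x,n)}$. When these are finite, for every $x\in V$, $N(x)=N(x,\omega)<\infty$ denotes a number such that $\sup_{n\ge N(x)}\|\mu^\omega\|_{p,B(x,n)}\le2\bar\mu_p(x)$ and $\sup_{n\ge N(x)}\|\nu^\omega\|_{q,B(x,n)}\le2\bar\nu_q(x)$. Conventions: $1/\infty=0$, $a\vee b=\max\{a,b\}$. *)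

(* Defs.v *)
From HB Require Import structures.
From mathcomp Require Import all_boot all_order all_algebra.
From mathcomp Require Import finmap.
From mathcomp Require Import all_classical all_reals all_analysis.

Set Implicit Arguments.
Unset Strict Implicit.
Unset Printing Implicit Defensive.

Import Order.TTheory GRing.Theory Num.Theory.
Import numFieldNormedType.Exports.

Local Open Scope classical_set_scope.
Local Open Scope ring_scope.

Section Graph.
Variables (V : choiceType) (adj : rel V).

Definition walk (x y : V) (n : nat) : Prop :=
  exists s : seq V, [/\ size s = n, path adj x s & last x s = y].

(* In a connected graph the set below is a singleton. *)
Definition gdist (x y : V) : nat :=
  xget 0%N [set n | walk x y n /\ forall m, walk x y m -> (n <= m)%N].

Definition gball (x : V) (n : nat) : set V := [set y | (gdist x y <= n)%N].

Record infinite_graph : Prop := InfiniteGraph {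
  adj_sym : symmetric adj;
  adj_irr : irreflexive adj;
  graph_infinite : infinite_set [set: V];
  graph_connected : forall x y, exists n, walk x y n;
  graph_locally_finite : forall x, finite_set [set y | adj x y] }.

Variable R : realType.

Definition card_set (A : set V) : R := (#|` fset_set A |)%fset%:R.

Definition volume_regular (d Creg : R) (N1 : V -> nat) : Prop :=
  forall x n, (N1 x <= n)%N ->
    Creg^-1 * n%:R `^ d <= card_set (gball x n) <= Creg * n%:R `^ d.

(* Sum of |u(y) - u(z)| over the unoriented edges {y, z} with at least one
   endpoint in A: each such edge is counted as (y, z) and as (z, y). *)
Definition edge_variation (A : set V) (u : V -> R) : R :=
  2^-1 * \sum_(e \in [set e : V * V | adj e.1 e.2 /\ (A e.1 \/ A e.2)])
            `|u e.1 - u e.2|.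

Definition local_sobolev (d d' CS : R) (N2 : V -> nat) : Prop :=
  forall x n, (N2 x <= n)%N ->
  forall u : V -> R, (forall y, ~ gball x n y -> u y = 0) ->
    (\sum_(y \in gball x n) `|u y| `^ (d' / (d' - 1))) `^ ((d' - 1) / d')
    <= CS * n%:R `^ (1 - d / d') * edge_variation (gball x n) u.

(* Averaged norm, meant for p in [1, +oo] and A finite and nonempty. *)
Definition avg_norm (p : \bar R) (A : set V) (f : V -> R) : R :=
  if p is r%:E
  then ((card_set A)^-1 * \sum_(x \in A) `|f x| `^ r) `^ r^-1
  else \big[Num.max/0]_(x <- fset_set A) `|f x|.

Definition limsup_norm (p : \bar R) (f : V -> R) (x : V) : \bar R :=
  limn_esup (fun n => (avg_norm p (gball x n) f)%:E).

Definition norm_threshold (p : \bar R) (f : V -> R) (N : V -> nat) : Prop :=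
  forall x, (ereal_sup [set (avg_norm p (gball x n) f)%:E
                       | n in [set n | (N x <= n)%N]]
             <= 2%:E * limsup_norm p f x)%E.

Record conductances (omega : V -> V -> R) : Prop := Conductances {
  omega_sym : forall x y, omega x y = omega y x;
  omega_gt0 : forall x y, adj x y -> 0 < omega x y;
  omega_eq0 : forall x y, ~~ adj x y -> omega x y = 0 }.

Variable omega : V -> V -> R.

Definition mu_w (x : V) : R := \sum_(y \in [set y | adj x y]) omega x y.

Definition nu_w (x : V) : R := \sum_(y \in [set y | adj x y]) (omega x y)^-1.

Definition generator (f : V -> R) (x : V) : R :=
  (mu_w x)^-1 * \sum_(y \in [set y | adj x y]) omega x y * (f y - f x).

Section Walk.
Variables (dO : measure_display) (Omega : measurableType dO).
Variables (P : V -> probability Omega R) (Y : R -> Omega -> V).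

(* Y, indexed by times t >= 0, is under the laws P x (x the starting point) a
   time-homogeneous Markov chain with generator [generator]. In the Markov
   property, s is a finite list of constraints (time, state) up to time t. *)
Record constant_speed_walk : Prop := ConstantSpeedWalk {
  csw_measurable : forall (t : R) (y : V), 0 <= t -> measurable [set w | Y t w = y];
  csw_start : forall x, P x [set w | Y 0 w = x] = 1%E;
  csw_markov : forall (x y z : V) (t h : R) (s : seq (R * V)),
    0 <= t -> 0 <= h -> (forall c, c \in s -> 0 <= c.1 <= t) ->
    let past := [set w | (forall c, c \in s -> Y c.1 w = c.2) /\ Y t w = y] in
    P x (past `&` [set w | Y (t + h) w = z])
      = (P x past * P y [set w | Y h w = z])%E;
  csw_generator : forall f : V -> R, (exists M : R, forall x, `|f x| <= M) ->
    forall x, (fine 'E_(P x)[f \o Y h] - f x) / h @[h --> 0^'+]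
              --> generator f x }.

Definition heat_kernel (t : R) (x y : V) : R :=
  fine (P x [set w | Y t w = y]) / mu_w y.

End Walk.
End Graph.

(* Main.v *)
Require Import Defs.
From HB Require Import structures.
From mathcomp Require Import all_boot all_order all_algebra.
From mathcomp Require Import finmap.
From mathcomp Require Import all_classical all_reals all_analysis.
From mathcomp Require Import ring lra zify.

Set Implicit Arguments.
Unset Strict Implicit.
Unset Printing Implicit Defensive.

Import Order.TTheory GRing.Theory Num.Theory.
Import numFieldNormedType.Exports.

Local Open Scope classical_set_scope.
Local Open Scope ring_scope.

(** Write [q_s(z, y) = p_s(z, y) / mu y] and let [rho] be the integer part of
    [sqrt t].  Everything is reduced to [L^2]-estimates by two tools.

    Mean value inequality.  The local Sobolev inequality applied to [f ^ (2 beta)]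
    and Hoelder's inequality give, on every ball [B(x, n)] with [n >= rho], a
    Faber-Krahn inequality [sum f^2 mu <= C n^2 (mu(supp f) / n^d)^th E(f)] with
    some [th > 0]; this is where [1/p + 1/q < 2/d'] enters.  De Giorgi's iteration
    on truncations [(u - k)_+] then bounds [u_T(y)^2] for a caloric [u] by
    [rho^-d (n / rho)^J] times the supremum over a time interval of length
    [rho^2 / 4] of [sum_(B(y, rho)) u_s^2 mu], as soon as [B(y, rho)] is contained
    in [B(x, n)]: only balls centered at [x] have to be good.  Keeping a supremum
    in time (instead of an integral) turns each step into a linear differential
    inequality [F' <= b - a F].

    Davies-Gaffney.  For [f] supported in [B(x, rho)],
    [sum_(B(y, rho)) (P_s f)^2 mu <= exp (2 (cosh lam - 1) s - 2 lam (D - 2 rho)) |f|^2],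
    where [D = d(x, y)].

    The mean value inequality at [x] with [n = rho] bounds [q_t(x, y)^2] by
    [S_s = sum_(B(x, rho)) q_s(., y)^2 mu].  By symmetry [S_s = (P_s f)(y)] with
    [f = q_s(., y) 1_(B(x, rho))], so that the mean value inequality at [y] with
    [n = rho + D] followed by Davies-Gaffney bounds [S_s ^ 2] by
    [rho^-d (1 + D / rho)^J exp (...) S_s].  Hence
    [q_t(x, y) <= A rho^-d (1 + D / rho)^J exp ((cosh lam - 1) t - lam (D - 2 rho))],
    and one optimizes over [lam].  *)

(** * Real inequalities *)

Section RealInequalities.
Variable R : realType.
Implicit Types a b c s : R.

(** Three obstacles shape the development. The walk is given only through its Markov property and a
    one-sided derivative at time 0, with no regularity in time. It is therefore identified with the
    series e^(-t) sum_k t^k P^k / k!, where P is the jump operator; symmetry and smoothness in t are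
    then computations. Another obstacle is that the graph is discrete: De Giorgi's iteration has to
    stop when consecutive radii differ by about one edge. The truncation left over is evaluated at a
    single vertex, and the resulting factor 1 / mu y is controlled by nu, because mu nu >= 1. The
    third is the price of large balls around x, a power J of n / rho. It is harmless because the
    Davies-Gaffney exponential absorbs any polynomial in D / rho, so J may be as large as
    convenient: 4 / th of it makes the iteration converge, and 2 d of it pays for the powers of n in
    the single-vertex term. *)

Lemma weighted_am_gm a b s : 0 <= a -> 0 <= b -> 0 < s < 1 ->
  a `^ s * b `^ (1 - s) <= s * a + (1 - s) * b.
Proof.
move=> a0 b0 /andP[s0 s1].
have s1' : 0 < 1 - s by rewrite subr_gt0.
have := @conjugate_powR R (a `^ s) (b `^ (1 - s)) s^-1 (1 - s)^-1
  (powR_ge0 _ _) (powR_ge0 _ _).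
rewrite !invr_gt0 !invrK -!powRrM !mulfV ?gt_eqF// !powRr1//.
move=> /(_ s0 s1'); rewrite addrC subrK => /(_ erefl).
by rewrite mulrC [b * _]mulrC mulrC [a * _]mulrC mulrC.
Qed.

Lemma sum_ge0_eq0 (I : eqType) (r : seq I) (F : I -> R) :
  (forall i, 0 <= F i) -> \sum_(i <- r) F i = 0 -> {in r, forall i, F i = 0}.
Proof.
move=> F0 /eqP; rewrite psumr_eq0// => /allP h i /h /=.
by move=> /eqP.
Qed.

(** Weights [s] and [1 - s] replace conjugate exponents, since the exponents met below come as
    [q^-1] and [1 - q^-1]. After dividing by both sums it is the weighted AM-GM inequality term by
    term. *)
Lemma hoelder_sum (I : eqType) (r : seq I) (F G : I -> R) s :
  (forall i, 0 <= F i) -> (forall i, 0 <= G i) -> 0 < s < 1 ->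
  \sum_(i <- r) F i `^ s * G i `^ (1 - s)
    <= (\sum_(i <- r) F i) `^ s * (\sum_(i <- r) G i) `^ (1 - s).
Proof.
move=> F0 G0 /andP[s0 s1].
have t0 : 0 < 1 - s by rewrite subr_gt0.
set A := \sum_(i <- r) F i; set B := \sum_(i <- r) G i.
have A0 : 0 <= A by apply: sumr_ge0.
have B0 : 0 <= B by apply: sumr_ge0.
have [A00|An0] := eqVneq A 0.
  rewrite big_seq big1 ?mulr_ge0 ?powR_ge0// => i ir.
  by rewrite (sum_ge0_eq0 F0 A00 ir) powR0 ?mul0r ?gt_eqF.
have [B00|Bn0] := eqVneq B 0.
  rewrite big_seq big1 ?mulr_ge0 ?powR_ge0// => i ir.
  by rewrite (sum_ge0_eq0 G0 B00 ir) powR0 ?mulr0 ?gt_eqF.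
have Ap : 0 < A by rewrite lt_neqAle eq_sym An0.
have Bp : 0 < B by rewrite lt_neqAle eq_sym Bn0.
have : \sum_(i <- r) (F i / A) `^ s * (G i / B) `^ (1 - s) <= 1.
  apply: (@le_trans _ _ (\sum_(i <- r) (s * (F i / A) + (1 - s) * (G i / B)))).
    apply: ler_sum => i _; apply: weighted_am_gm; rewrite ?s0//.
    - by rewrite divr_ge0.
    - by rewrite divr_ge0.
  rewrite big_split -!mulr_sumr -!mulr_suml -/A -/B !divff//.
  by rewrite /= !mulr1; lra.
have -> : \sum_(i <- r) (F i / A) `^ s * (G i / B) `^ (1 - s) =
   (A `^ s * B `^ (1 - s))^-1 * \sum_(i <- r) F i `^ s * G i `^ (1 - s).
  rewrite mulr_sumr; apply: eq_bigr => i _.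
  rewrite !powRM ?invr_ge0// -[A^-1]powR_inv1// -[B^-1]powR_inv1//.
  rewrite [(A `^ -1) `^ s]powRAC [(B `^ -1) `^ _]powRAC.
  rewrite !powR_inv1 ?powR_ge0// invfM; ring.
by rewrite mulrC ler_pdivrMr ?mul1r// mulr_gt0// powR_gt0.
Qed.

Lemma hoelder_sum3 (I : eqType) (r : seq I) (F G H : I -> R) a b c :
  (forall i, 0 <= F i) -> (forall i, 0 <= G i) -> (forall i, 0 <= H i) ->
  0 < a -> 0 < b -> 0 < c -> a + b + c = 1 ->
  \sum_(i <- r) F i `^ a * G i `^ b * H i `^ c
    <= (\sum_(i <- r) F i) `^ a * (\sum_(i <- r) G i) `^ b
       * (\sum_(i <- r) H i) `^ c.
Proof.
move=> F0 G0 H0 a0 b0 c0 abc.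
have a1 : 0 < 1 - a by rewrite -abc; lra.
have an0 : 1 - a != 0 by rewrite gt_eqF.
(* The exponents are rescaled so that [GH ^ (1 - a)] is [G ^ b * H ^ c], which reduces three factors
   to two. *)
pose GH i := G i `^ (b / (1 - a)) * H i `^ (1 - b / (1 - a)).
have GHE i : GH i `^ (1 - a) = G i `^ b * H i `^ c.
  rewrite /GH powRM ?powR_ge0// -!powRrM divfK// mulrBl divfK// mul1r.
  by congr (_ * _ `^ _); rewrite -abc; ring.
have GH0 i : 0 <= GH i by rewrite mulr_ge0 ?powR_ge0.
have -> : \sum_(i <- r) F i `^ a * G i `^ b * H i `^ c =
  \sum_(i <- r) F i `^ a * GH i `^ (1 - a).
  by apply: eq_bigr => i _; rewrite GHE mulrA.
apply: (le_trans (hoelder_sum _ F0 GH0 _)); first by rewrite a0/= -subr_gt0.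
rewrite -mulrA ler_wpM2l ?powR_ge0//.
have ba : 0 < b / (1 - a) < 1.
  by rewrite divr_gt0//= ltr_pdivrMr// mul1r -abc; lra.
have hh := hoelder_sum r G0 H0 ba.
apply: (@le_trans _ _ (((\sum_(i <- r) G i) `^ (b / (1 - a))
     * (\sum_(i <- r) H i) `^ (1 - b / (1 - a))) `^ (1 - a))).
  apply: ge0_ler_powR; rewrite ?nnegrE//; first exact: ltW.
    by apply: sumr_ge0.
  by rewrite mulr_ge0 ?powR_ge0.
rewrite powRM ?powR_ge0// -!powRrM divfK// mulrBl divfK// mul1r.
by rewrite (_ : 1 - a - b = c)// -abc; ring.
Qed.

(** Discrete substitute for the chain rule: it bounds the differences of a power of [f] along edges
    when the Sobolev inequality is applied to that power. *)
Lemma powR_sub_le a b s : 0 <= a -> 0 <= b -> 1 < s ->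
  `|a `^ s - b `^ s| <= s * `|a - b| * (a `^ (s - 1) + b `^ (s - 1)).
Proof.
wlog ba : a b / b <= a.
  move=> h a0 b0 s1; have [ba|ab] := leP b a; first exact: h.
  rewrite distrC [X in s * X * _]distrC [a `^ _ + _]addrC.
  by apply: h => //; apply: ltW.
move=> a0 b0 s1.
have s0 : 0 < s by lra.
have [a00|an0] := eqVneq a 0.
  have b00 : b = 0 by apply/eqP; rewrite eq_le b0 -[leRHS]a00 ba.
  by rewrite a00 b00 !subrr !normr0 mulr0 mul0r.
have ap : 0 < a by rewrite lt_neqAle eq_sym an0.
rewrite !ger0_norm ?subr_ge0//; last first.
  by apply: ge0_ler_powR; rewrite ?nnegrE// ltW.
have s1i : 0 < s^-1 < 1 by rewrite invr_gt0 s0/= invf_lt1.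
(* Bernoulli's inequality for [(b / a) ^ s]. *)
have := weighted_am_gm (powR_ge0 b s) (powR_ge0 a s) s1i.
rewrite -!powRrM divff ?gt_eqF// powRr1// mulrBr mulr1 mulfV ?gt_eqF// => h.
have : s * b * a `^ (s - 1) <= b `^ s + (s - 1) * a `^ s.
  rewrite -(ler_pM2l (x:=s^-1)) ?invr_gt0// mulrDr !mulrA mulVf ?gt_eqF//.
  by rewrite mul1r mulrBr mulVf ?gt_eqF// mulr1.
have aE : a * a `^ (s - 1) = a `^ s by apply: mulr_powRB1.
have : 0 <= s * (a - b) * b `^ (s - 1).
  by rewrite !mulr_ge0 ?powR_ge0 ?subr_ge0// ltW.
rewrite -aE; lra.
Qed.

(** The function e^(al (s - a)) (F s - be / al) is nonincreasing. The sign of [al] is left free: the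
    De Giorgi step uses a positive rate, the Davies-Gaffney estimate a negative one. *)
Lemma linear_gronwall (F dF : R -> R) (al be a b : R) : a <= b -> al != 0 ->
  (forall s, a <= s <= b -> is_derive s 1 F (dF s)) ->
  (forall s, a <= s <= b -> dF s <= be - al * F s) ->
  F b - be / al <= expR (- al * (b - a)) * (F a - be / al).
Proof.
move=> ab al0 dFE dFle.
pose G s := expR (al * (s - a)) * (F s - be / al).
have dG s : a <= s <= b ->
    is_derive s 1 G (expR (al * (s - a)) * (dF s + al * F s - be)).
  move=> hs; have := dFE _ hs => ?.
  rewrite /G; apply: is_derive_eq.
  rewrite /GRing.scale/=; field.
  by rewrite al0.
have : G b <= G a.
  have ab' : `[a, b] `<=` [set s | a <= s <= b].
    by move=> s /=; rewrite in_itv.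
  apply: (@ler0_derive1_le_cc R G a b).
  - move=> s; rewrite in_itv/= => /andP[sa sb].
    have hs : a <= s <= b by rewrite !ltW.
    by have [] := dG s hs.
  - move=> s; rewrite in_itv/= => /andP[sa sb].
    have hs : a <= s <= b by rewrite !ltW.
    rewrite derive1E; have [_ ->] := dG s hs.
    by rewrite pmulr_rle0 ?expR_gt0// subr_le0 -lerBrDr dFle.
  - apply: derivable_within_continuous => s /ab'/= hs.
    by have [] := dG s hs.
  - by rewrite in_itv/= ab lexx.
  - by rewrite in_itv/= ab lexx.
  - exact: ab.
rewrite /G subrr mulr0 expR0 mul1r => h.
rewrite -(ler_pM2l (expR_gt0 (al * (b - a)))) mulrA -expRD.
by rewrite mulNr subrr expR0 mul1r.
Qed.

Lemma expRN_le_inv (x : R) : 0 < x -> expR (- x) <= x^-1.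
Proof.
move=> x0; rewrite expRN lef_pV2 ?posrE ?expR_gt0//.
by apply: le_trans (expR_ge1Dx x); lra.
Qed.

End RealInequalities.

(** * Graph distance and weights *)

Section GraphDistance.
Variables (V : choiceType) (adj : rel V).
Hypothesis Gadj : infinite_graph adj.
Implicit Types x y z : V.
Local Notation dist := (gdist adj).

(** Connectedness makes the set in [gdist] nonempty, so the default value 0 of [xget] is never
    returned. *)
Lemma gdist_spec x y :
  walk adj x y (dist x y) /\ forall m, walk adj x y m -> (dist x y <= m)%N.
Proof.
rewrite /gdist; set A := [set n | _]; suff : A (xget 0%N A) by [].
apply: xgetPex.
have ex : exists n, `[< walk adj x y n >].
  by have [n wn] := graph_connected Gadj x y; exists n; apply/asboolP.
exists (ex_minn ex) => /=; case: ex_minnP => n /asboolP wn nmin; split => // m wm.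
by apply: nmin; apply/asboolP.
Qed.

Lemma gdist_walk x y : walk adj x y (dist x y).
Proof. by case: (gdist_spec x y). Qed.

Lemma gdist_min x y m : walk adj x y m -> (dist x y <= m)%N.
Proof. by case: (gdist_spec x y) => _; apply. Qed.

Lemma gdistxx x : dist x x = 0%N.
Proof. by apply/eqP; rewrite -leqn0; apply: gdist_min; exists [::]. Qed.

Lemma walk_cat x y z m n :
  walk adj x y m -> walk adj y z n -> walk adj x z (m + n).
Proof.
move=> [s [sm ps ls]] [t [tn pt lt]]; exists (s ++ t).
by rewrite size_cat sm tn cat_path ps ls pt last_cat ls lt.
Qed.

Lemma walk_rev x y n : walk adj x y n -> walk adj y x n.
Proof.
elim: n x y => [|n IH] x y [s [sn ps ls]].
  by move/size0nil: sn ls => -> /= ->; exists [::].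
case: s sn ps ls => // a s /= [sn] /andP[xa ps] ls.
have wax : walk adj a x 1 by exists [:: x]; rewrite /= (adj_sym Gadj) xa.
by rewrite -addn1; apply: walk_cat wax; apply: IH; exists s.
Qed.

Lemma gdistC x y : dist x y = dist y x.
Proof.
by apply/eqP; rewrite eqn_leq !gdist_min//; apply: walk_rev; apply: gdist_walk.
Qed.

Lemma gdist_triangle y x z : (dist x z <= dist x y + dist y z)%N.
Proof. by apply: gdist_min; apply: walk_cat; exact: gdist_walk. Qed.

Lemma gdist_adj x y z : adj y z -> (dist x z <= (dist x y).+1)%N.
Proof.
move=> yz; rewrite -addn1; apply: gdist_min; apply: walk_cat.
  exact: gdist_walk.
by exists [:: z]; rewrite /= yz.
Qed.

Lemma exists_adj x : exists y, adj x y.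
Proof.
apply: contrapT => nadj; apply: (graph_infinite Gadj).
apply: (@sub_finite_set _ _ [set x]) => // y _ /=.
have [s [_ ps ls]] := gdist_walk x y.
by case: s ps ls => //= a s /andP[xa _] _; case: nadj; exists a.
Qed.

Lemma finite_gball x n : finite_set (gball adj x n).
Proof.
elim: n => [|n IH].
  apply: (@sub_finite_set _ _ [set x]) => // y; rewrite /gball/= leqn0 => /eqP d0.
  by have [s [+ _ <-]] := gdist_walk x y; rewrite d0 => /size0nil ->.
apply: (@sub_finite_set _ _ (gball adj x n `|`
    \bigcup_(y in gball adj x n) [set z | adj y z])); last first.
  rewrite finite_setU; split => //; apply: bigcup_finite => // y _.
  exact: graph_locally_finite.
move=> y; rewrite /gball/= leq_eqVlt => /orP[/eqP dE|]; last by rewrite ltnS; left.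
right; have := gdist_walk x y; rewrite dE => -[s [sn ps ls]].
case/lastP: s sn ps ls => // s a; rewrite size_rcons => -[sn].
rewrite rcons_path last_rcons => /andP[ps la] ay; subst a.
exists (last x s) => //=; rewrite -sn; apply: gdist_min.
by exists s.
Qed.

(** Balls as duplicate-free sequences turn finitely supported sums into ordinary big sums. *)
Definition ball_seq x n : seq V := enum_fset (fset_set (gball adj x n)).

Lemma mem_ball_seq x n y : (y \in ball_seq x n) = (dist x y <= n)%N.
Proof.
rewrite /ball_seq; apply/idP/idP.
  by rewrite in_fset_set ?inE//; exact: finite_gball.
by move=> h; rewrite in_fset_set ?inE//; exact: finite_gball.
Qed.

Lemma ball_seq_uniq x n : uniq (ball_seq x n).
Proof. exact: fset_uniq. Qed.

Lemma sum_ball_seq (R : idomainType) x n (F : V -> R) :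
  \sum_(y \in gball adj x n) F y = \sum_(y <- ball_seq x n) F y.
Proof. by rewrite fsbig_finite//; exact: finite_gball. Qed.

Lemma card_ball_seq (R : realType) x n :
  card_set R (gball adj x n) = (size (ball_seq x n))%:R.
Proof. by rewrite /card_set cardfE -cardfE. Qed.

End GraphDistance.

Lemma ler_sum_sub_uniq (R : numDomainType) (I : eqType) (r s : seq I) (F : I -> R) :
  uniq r -> {subset r <= s} -> (forall i, i \in s -> 0 <= F i) ->
  \sum_(i <- r) F i <= \sum_(i <- s) F i.
Proof.
move=> ur rs F0; have rs' : subseq (undup s) s by apply: undup_subseq.
have /permPl pE := perm_filterC (fun i => i \in r) s.
rewrite -(perm_big _ pE) big_cat/= (@le_trans _ _ (\sum_(i <- [seq i <- s | i \in r]) F i))//; last first.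
  by rewrite lerDl big_seq sumr_ge0// => i; rewrite mem_filter => /andP[_ /F0].
have sub : perm_eq r ([seq i <- undup s | i \in r]).
  apply: uniq_perm => //; first by rewrite filter_uniq ?undup_uniq.
  by move=> i; rewrite mem_filter mem_undup; case: (boolP (i \in r)) => //= /rs ->.
rewrite (perm_big _ sub)/= !big_filter.
elim: s F0 {rs rs' sub pE} => [|a s IH] F0 /=; first by rewrite !big_nil.
have F0' i : i \in s -> 0 <= F i by move=> ?; rewrite F0// inE orbC; apply/orP; left.
have Fa : 0 <= F a by rewrite F0// inE eqxx.
case: ifP => _; rewrite !big_cons; case: ifP => _; rewrite ?IH//.
- by rewrite ler_wpDl// IH.
- by rewrite lerD2l IH.
Qed.

Lemma sum_uniq_supp (R : nmodType) (I : eqType) (r s : seq I) (F : I -> R) :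
  uniq r -> uniq s -> (forall i, F i != 0 -> (i \in r) = (i \in s)) ->
  \sum_(i <- r) F i = \sum_(i <- s) F i.
Proof.
move=> ur us rs; rewrite (bigID (fun i => F i == 0))/= big1 ?add0r; last first.
  by move=> i /eqP.
rewrite [RHS](bigID (fun i => F i == 0))/= [X in X + _]big1 ?add0r; last first.
  by move=> i /eqP.
rewrite -!(big_filter _ (fun i => F i != 0)); apply: perm_big.
apply: uniq_perm; rewrite ?filter_uniq// => i; rewrite !mem_filter.
by case: eqVneq => //= Fi; rewrite rs.
Qed.

Section Weights.
Variables (V : choiceType) (adj : rel V) (R : realType) (omega : V -> V -> R).
Hypotheses (Gadj : infinite_graph adj) (Comega : conductances adj omega).
Local Notation mu := (mu_w adj omega).
Local Notation nu := (nu_w adj omega).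
Local Notation L := (generator adj omega).

Lemma omega_ge0 x y : 0 <= omega x y.
Proof.
have [/(omega_gt0 Comega)/ltW//|/(omega_eq0 Comega) ->//] := boolP (adj x y).
Qed.

(** Sums over neighbours are moved to a common finite window [W], so that double sums over edges can
    be exchanged and symmetrised. *)
Lemma sum_adj (F : V -> V -> R) (W : seq V) x : uniq W ->
  (forall y, adj x y -> y \in W) -> (forall y, ~~ adj x y -> F x y = 0) ->
  \sum_(y \in [set y | adj x y]) F x y = \sum_(y <- W) F x y.
Proof.
move=> uW xW F0; apply: fsbig_fwiden => // y [/= _] /negP; exact: F0.
Qed.

Lemma mu_sum (W : seq V) x : uniq W -> (forall y, adj x y -> y \in W) ->
  mu x = \sum_(y <- W) omega x y.
Proof. by move=> uW xW; apply: sum_adj => // y; exact: (omega_eq0 Comega). Qed.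

(* Off the edges [omega] vanishes and MathComp's [0^-1 = 0] makes the extra terms
   disappear. *)
Lemma nu_sum (W : seq V) x : uniq W -> (forall y, adj x y -> y \in W) ->
  nu x = \sum_(y <- W) (omega x y)^-1.
Proof.
move=> uW xW; apply: (@sum_adj (fun x y => (omega x y)^-1)) => // y.
by move/(omega_eq0 Comega) ->; rewrite invr0.
Qed.

Lemma generator_sum (f : V -> R) (W : seq V) x : uniq W ->
  (forall y, adj x y -> y \in W) ->
  L f x = (mu x)^-1 * \sum_(y <- W) omega x y * (f y - f x).
Proof.
move=> uW xW; rewrite /generator.
rewrite (@sum_adj (fun x y => omega x y * (f y - f x)) W)// => y.
by move/(omega_eq0 Comega) ->; rewrite mul0r.
Qed.

Lemma adj_in_ball x y : adj x y -> y \in ball_seq adj x 1.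
Proof. by move=> xy; rewrite mem_ball_seq// -(gdistxx Gadj x) gdist_adj. Qed.

Lemma mu_ge (W : seq V) x : uniq W -> \sum_(y <- W) omega x y <= mu x.
Proof.
move=> uW; have uU : uniq (undup (W ++ ball_seq adj x 1)) by apply: undup_uniq.
rewrite (@mu_sum _ x uU); last first.
  by move=> y xy; rewrite mem_undup mem_cat adj_in_ball ?orbT.
apply: ler_sum_sub_uniq => //.
- by move=> y yW; rewrite mem_undup mem_cat yW.
- by move=> y _; exact: omega_ge0.
Qed.

Lemma mu_gt0 x : 0 < mu x.
Proof.
have [y xy] := exists_adj Gadj x.
apply: (lt_le_trans (omega_gt0 Comega xy)).
by have := @mu_ge [:: y] x erefl; rewrite big_seq1.
Qed.

Lemma mu_ge0 x : 0 <= mu x. Proof. exact/ltW/mu_gt0. Qed.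

Lemma nu_ge0 x : 0 <= nu x.
Proof.
rewrite (@nu_sum (ball_seq adj x 1))//; [|exact: ball_seq_uniq|exact: adj_in_ball].
by apply: sumr_ge0 => y _; rewrite invr_ge0 omega_ge0.
Qed.

(** A single edge at [x] contributes its weight to [mu] and the inverse weight to [nu]. This is how
    1 / mu is bounded in the mean value inequality. *)
Lemma mu_nu_ge1 x : 1 <= mu x * nu x.
Proof.
have [y xy] := exists_adj Gadj x; have o0 := omega_gt0 Comega xy.
apply: (@le_trans _ _ (omega x y * (omega x y)^-1)).
  by rewrite divff// gt_eqF.
have uB := ball_seq_uniq adj x 1; have yB := adj_in_ball xy.
apply: ler_pM; [exact: ltW|by rewrite invr_ge0 ltW| |].
  by have := @mu_ge [:: y] x erefl; rewrite big_seq1.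
rewrite (@nu_sum (ball_seq adj x 1))//; last exact: adj_in_ball.
rewrite (bigD1_seq y)//= lerDl sumr_ge0// => z _.
by rewrite invr_ge0 omega_ge0.
Qed.

End Weights.

(** * Faber-Krahn inequality on balls *)

Section FaberKrahn.
Variables (V : choiceType) (adj : rel V) (R : realType) (omega : V -> V -> R).
Hypotheses (Gadj : infinite_graph adj) (Comega : conductances adj omega).
Local Notation mu := (mu_w adj omega).
Local Notation nu := (nu_w adj omega).

(** An edge along which [g] varies has an endpoint in the support of [g], hence both endpoints in
    [W]. *)
Lemma edge_variation_seq (A : set V) (W : seq V) (g : V -> R) :
  uniq W -> (forall a, g a != 0 -> [/\ A a, a \in W & forall b, adj a b -> b \in W]) ->
  edge_variation adj A g =
  2^-1 * \sum_(a <- W) \sum_(b <- W) (if adj a b then `|g a - g b| else 0).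
Proof.
move=> uW gW; congr (_ * _).
have gW' a b : adj a b -> g a != g b -> [/\ A a \/ A b, a \in W & b \in W].
  move=> ab gab; have [ga0|ga0] := eqVneq (g a) 0.
    have gb0 : g b != 0 by rewrite -ga0 eq_sym.
    have [Ab bW nb] := gW b gb0; split => //; first by right.
    by apply: nb; rewrite (adj_sym Gadj).
  by have [Aa aW na] := gW a ga0; split => //; [left|exact: na].
rewrite fsbig_supp (fsbig_fwiden [seq e <- [seq (a, b) | a <- W, b <- W] | adj e.1 e.2]).
- rewrite big_filter big_mkcond big_allpairs/=.
  by apply: eq_bigr.
- move=> [a b] /= [[/= ab _]] /eqP; rewrite normr_eq0 subr_eq0 => gab.
  have [_ aW bW] := gW' a b ab gab.
  by rewrite mem_filter/= ab; apply/allpairsP; exists (a, b).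
- rewrite filter_uniq// allpairs_uniq// => -[a b] [c e] /=; by move=> _ _ [-> ->].
- move=> [a b] [/=]; rewrite mem_filter/= => /andP[ab _] h.
  apply: contrapT => /eqP g0; apply: h; split; last by apply/eqP.
  split => //; move: g0; rewrite normr_eq0 subr_eq0 => g0.
  by have [] := gW' a b ab g0.
Qed.

(* Each edge is counted twice, so this is twice the Dirichlet form. *)
Definition energy (W : seq V) (f : V -> R) : R :=
  \sum_(a <- W) \sum_(b <- W) omega a b * (f a - f b) ^+ 2.

Lemma energy_ge0 W f : 0 <= energy W f.
Proof.
apply: sumr_ge0 => a _; apply: sumr_ge0 => b _.
by rewrite mulr_ge0 ?sqr_ge0 ?(omega_ge0 Comega).
Qed.

(** Each term is split as (omega^(1/2) |f a - f b|) (omega^(-1/2) h a); summing the square of the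
    second factor over [b] produces [nu a]. *)
Lemma cauchy_schwarz_edges (W : seq V) (f h : V -> R) :
  uniq W -> (forall a, 0 <= h a) ->
  (forall a, h a != 0 -> forall b, adj a b -> b \in W) ->
  \sum_(a <- W) \sum_(b <- W) (if adj a b then `|f a - f b| * h a else 0)
  <= (energy W f * \sum_(a <- W) h a ^+ 2 * nu a) `^ 2^-1.
Proof.
move=> uW h0 hW.
pose F (e : V * V) := omega e.1 e.2 * (f e.1 - f e.2) ^+ 2.
pose G (e : V * V) := (omega e.1 e.2)^-1 * h e.1 ^+ 2.
have F0 e : 0 <= F e by rewrite mulr_ge0 ?sqr_ge0 ?(omega_ge0 Comega).
have G0 e : 0 <= G e by rewrite mulr_ge0 ?invr_ge0 ?sqr_ge0 ?(omega_ge0 Comega).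
have half : 0 < (2^-1 : R) < 1 by lra.
have := hoelder_sum [seq (a, b) | a <- W, b <- W] F0 G0 half.
have -> : 1 - 2^-1 = 2^-1 :> R by lra.
rewrite !big_allpairs/= => H.
rewrite powRM ?energy_ge0//; last first.
  apply: sumr_ge0 => a _. by apply: mulr_ge0; [exact: sqr_ge0|exact: nu_ge0 Gadj Comega _].
have -> : \sum_(a <- W) h a ^+ 2 * nu a = \sum_(i <- W) \sum_(j <- W) G (i, j).
  apply: eq_bigr => a _; rewrite /G/= -mulr_suml.
  have [->|ha] := eqVneq (h a) 0; first by rewrite expr0n/= mul0r mulr0.
  by rewrite mulrC (nu_sum Comega uW)//; exact: hW.
apply: le_trans H; apply: ler_sum => a _; apply: ler_sum => b _.
rewrite /F /G/=; case: ifPn => [ab|nab]; last by rewrite mulr_ge0 ?powR_ge0.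
have o0 := omega_gt0 Comega ab.
rewrite -powRM ?(F0 (a, b)) ?(G0 (a, b))//.
rewrite (_ : _ * _ * (_ * _) = (`|f a - f b| * h a) ^+ 2); last first.
  by rewrite exprMn -normrX ger0_norm ?sqr_ge0//; field; rewrite gt_eqF.
by rewrite powR12_sqrt ?sqr_ge0// sqrtr_sqr normrM normr_id (ger0_norm (h0 a)).
Qed.

Variables (d d' CS p q Km Kn : R).
Hypotheses (d'2 : 2 <= d') (CS0 : 0 < CS) (p1 : 1 < p) (q1 : 1 < q)
  (pq : p^-1 + q^-1 < 2 / d') (Km0 : 0 <= Km) (Kn0 : 0 <= Kn).

(* [f ^ (2 beta)] is the power of [f] for which both sides of the Sobolev inequality
   are powers of the same sum of [f ^ (2 rho)]. *)
Let rho := (1 - 2 / d' + q^-1)^-1.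
Let beta := rho * (1 - d'^-1).

(** The solution of rho^-1 + theta + (1 - theta) / p = 1, the weight left for the measure of the
    support in the three-factor Hoelder inequality. It is positive exactly when 1/p + 1/q < 2/d'. *)
Definition fk_exponent : R := (2 / d' - q^-1 - p^-1) / (1 - p^-1).
Local Notation theta := fk_exponent.
(** The factor [4 * beta ^+ 2] is the square of the chain rule constant [2 * beta]; the powers of
    [Kn] and [Km] come from the two Hoelder inequalities. *)
Definition fk_const : R :=
  4 * beta ^+ 2 * CS ^+ 2 * Kn `^ q^-1 * Km `^ ((1 - theta) / p).

Let d'0 : 0 < d'. Proof. by move: d'2; lra. Qed.
Let p0 : 0 < p^-1 < 1.
Proof. by rewrite invr_gt0 invf_lt1 ?p1 (lt_trans ltr01 p1). Qed.
Let q0 : 0 < q^-1 < 1.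
Proof. by rewrite invr_gt0 invf_lt1 ?q1 (lt_trans ltr01 q1). Qed.
Let d'i : 0 < d'^-1 <= 2^-1.
Proof. by rewrite invr_gt0 d'0/= lef_pV2 ?posrE. Qed.
Let rhoi : 0 < 1 - 2 / d' + q^-1 < 1.
Proof. by move: p0 q0 d'i pq => /andP[? ?] /andP[? ?] /andP[? ?] ?; lra. Qed.

Lemma fk_exponent_bounds : 0 < theta < 1.
Proof.
have [/andP[? ?] /andP[? ?] /andP[? ?]] := And3 p0 q0 d'i.
have den : 0 < 1 - p^-1 by lra.
apply/andP; split; first by rewrite divr_gt0//; move: pq; lra.
by rewrite ltr_pdivrMr// mul1r; lra.
Qed.

Let rho_gt0 : 0 < rho. Proof. by rewrite invr_gt0; case/andP: rhoi. Qed.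
Let rhoV : rho^-1 = 1 - 2 / d' + q^-1. Proof. by rewrite invrK. Qed.
Let rhoE : rho * (1 - 2 / d' + q^-1) = 1.
Proof. by rewrite mulVf// gt_eqF//; case/andP: rhoi. Qed.

Let beta_split : 2 * beta - 1 = rho * (1 - q^-1).
Proof. by rewrite /beta; move: rhoE; set z := 2 / d'; rewrite (_ : d'^-1 = z / 2) /z; nra. Qed.

Let theta_split : rho^-1 + theta + (1 - theta) / p = 1.
Proof.
rewrite rhoV /theta; have : 1 - p^-1 != 0 by rewrite gt_eqF//; move: p0 => /andP[? ?]; lra.
set P := p^-1; set z := 2 / d' => P1; field.
by rewrite P1/= gt_eqF// (lt_trans ltr01 q1).
Qed.

Lemma fk_const_gt0 : 0 < Km -> 0 < Kn -> 0 < fk_const.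
Proof.
move=> Kmp Knp; have b0 : 0 < beta.
  rewrite /beta mulr_gt0// subr_gt0; case/andP: d'i => _ h.
  by apply: le_lt_trans h _; rewrite invf_lt1// ltr1n.
rewrite /fk_const; apply: mulr_gt0; last exact: powR_gt0.
apply: mulr_gt0; last exact: powR_gt0.
by apply: mulr_gt0; [apply: mulr_gt0 => //|]; exact: exprn_gt0.
Qed.

Variables (n : nat) (x : V) (W : seq V) (f : V -> R).
Hypotheses (n1 : (1 <= n)%N)
  (sobolev : forall u : V -> R, (forall y, ~ gball adj x n y -> u y = 0) ->
    (\sum_(y \in gball adj x n) `|u y| `^ (d' / (d' - 1))) `^ ((d' - 1) / d')
    <= CS * n%:R `^ (1 - d / d') * edge_variation adj (gball adj x n) u)
  (mu_p : \sum_(y <- ball_seq adj x n) mu y `^ p <= Km * n%:R `^ d)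
  (nu_q : \sum_(y <- ball_seq adj x n) nu y `^ q <= Kn * n%:R `^ d)
  (uW : uniq W) (f0 : forall a, 0 <= f a)
  (fW : forall a, f a != 0 ->
    [/\ gball adj x n a, a \in W & forall b, adj a b -> b \in W]).

Let X := \sum_(a <- W) f a `^ (2 * rho).
Let N : R := n%:R `^ d.

Let nR0 : 0 < n%:R :> R. Proof. by rewrite ltr0n. Qed.
Let N0 : 0 < N. Proof. exact: powR_gt0. Qed.
Let X0 : 0 <= X. Proof. by apply: sumr_ge0 => a _; exact: powR_ge0. Qed.

Let fW_ball (F : V -> R) : (forall a, f a = 0 -> F a = 0) ->
  \sum_(a <- W) F a = \sum_(a <- ball_seq adj x n) F a.
Proof.
move=> F0; apply: sum_uniq_supp => //; first exact: ball_seq_uniq.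
move=> a Fa; have fa : f a != 0 by apply: contra_neq Fa; exact: F0.
by have [ga aW _] := fW fa; rewrite aW mem_ball_seq.
Qed.

Let beta2 : 1 < 2 * beta.
Proof.
rewrite -subr_gt0 beta_split mulr_gt0// subr_gt0.
by case/andP: q0.
Qed.

Let sum_nu : \sum_(a <- W) (f a `^ (2 * beta - 1)) ^+ 2 * nu a
  <= X `^ (1 - q^-1) * (Kn * N) `^ q^-1.
Proof.
have q00 : 0 < q by apply: lt_trans q1.
have q'0 : 0 < 1 - q^-1 by rewrite subr_gt0; case/andP: q0.
have e0 : 2 * rho * (1 - q^-1) != 0 by rewrite gt_eqF// !mulr_gt0.
rewrite fW_ball; last first.
  move=> a fa /=; rewrite fa powR0 ?expr0n ?mul0r//.
  by rewrite beta_split gt_eqF// mulr_gt0.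
rewrite (eq_bigr (fun a => (nu a `^ q) `^ q^-1
  * (f a `^ (2 * rho)) `^ (1 - q^-1))); last first.
  move=> a _; rewrite -!powRrM mulfV ?gt_eqF// powRr1 ?(nu_ge0 Gadj Comega)//.
  rewrite mulrC beta_split -powR_mulrn ?powR_ge0// -powRrM.
  by congr (_ * _ `^ _); ring.
apply: (le_trans (hoelder_sum _ _ _ q0)) => [a|a|]; try exact: powR_ge0.
rewrite -(@fW_ball (fun a => f a `^ (2 * rho))) => [|a /= ->]; last by rewrite powR0// gt_eqF// mulr_gt0.
rewrite mulrC ler_wpM2l ?powR_ge0//.
apply: ge0_ler_powR => //; rewrite ?nnegrE.
- by rewrite invr_ge0 ltW.
- by apply: sumr_ge0 => a _; exact: powR_ge0.
- by rewrite mulr_ge0// ltW.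
Qed.

(** The Sobolev inequality for f^(2 beta), whose exponent 2 beta d' / (d' - 1) equals 2 rho,
    followed by the chain rule, Cauchy-Schwarz and [sum_nu]. *)
Let sobolev_X : X `^ (1 - d'^-1) <=
  CS * n%:R `^ (1 - d / d') * (2 * beta)
  * (energy W f * (X `^ (1 - q^-1) * (Kn * N) `^ q^-1)) `^ 2^-1.
Proof.
have b0 : 0 < 2 * beta by apply: lt_trans beta2.
pose g a := f a `^ (2 * beta).
have g0 a : f a = 0 -> g a = 0 by rewrite /g => ->; rewrite powR0// gt_eqF.
have gW a : g a != 0 -> [/\ gball adj x n a, a \in W & forall b, adj a b -> b \in W].
  by move=> ga; apply: fW; apply: contra_neq ga; exact: g0.
have d'1 : d' - 1 != 0 by rewrite gt_eqF// subr_gt0; move: d'2; lra.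
have gsupp y : ~ gball adj x n y -> g y = 0.
  by move=> nb; have [//|/gW[]] := eqVneq (g y) 0.
have := sobolev gsupp.
rewrite (edge_variation_seq uW gW) sum_ball_seq//.
have -> : \sum_(y <- ball_seq adj x n) `|g y| `^ (d' / (d' - 1)) = X.
  rewrite -fW_ball; last first.
    move=> a fa; rewrite g0// normr0 powR0// gt_eqF// divr_gt0// subr_gt0.
    by move: d'2; lra.
  apply: eq_bigr => a _; rewrite ger0_norm ?powR_ge0// -powRrM; congr powR.
  by rewrite /beta; field; rewrite d'1 gt_eqF.
have -> : (d' - 1) / d' = 1 - d'^-1 by field; rewrite gt_eqF.
move=> h; apply: (le_trans h); rewrite -[leRHS]mulrA ler_wpM2l//.
  by rewrite mulr_ge0 ?powR_ge0// ltW.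
pose h1 a := f a `^ (2 * beta - 1).
apply: (@le_trans _ _ (2 * beta * \sum_(a <- W) \sum_(b <- W)
    (if adj a b then `|f a - f b| * h1 a else 0))).
  set S := (X in _ <= 2 * beta * X).
  (* [S] is unchanged when the endpoints are exchanged, so its two orientations supply the two terms
     of [powR_sub_le]. *)
  have -> : S = 2^-1 * (S + \sum_(a <- W) \sum_(b <- W)
    (if adj a b then `|f a - f b| * h1 b else 0)).
    have -> : \sum_(a <- W) \sum_(b <- W)
      (if adj a b then `|f a - f b| * h1 b else 0) = S; last by field.
    rewrite exchange_big /S /=; apply: eq_bigr => a _; apply: eq_bigr => b _ /=.
    by rewrite (adj_sym Gadj) distrC.
  rewrite mulrCA ler_wpM2l ?invr_ge0// /S -big_split mulr_sumr; apply: ler_sum => a _.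
  rewrite -big_split mulr_sumr; apply: ler_sum => b _ /=.
  case: ifP => _; last by rewrite addr0 mulr0.
  by rewrite -mulrDr mulrA powR_sub_le.
rewrite ler_wpM2l ?(ltW b0)//.
have h10 a : 0 <= h1 a by exact: powR_ge0.
have h1W a : h1 a != 0 -> forall b, adj a b -> b \in W.
  move=> ha b; have fa : f a != 0.
    apply: contra_neq ha => fa; rewrite /h1 fa powR0// gt_eqF// subr_gt0//.
  by have [_ _ /(_ b)] := fW fa.
apply: (le_trans (cauchy_schwarz_edges f uW h10 h1W)).
apply: ge0_ler_powR; rewrite ?nnegrE ?invr_ge0//.
- rewrite mulr_ge0 ?energy_ge0// sumr_ge0// => a _.
  by apply: mulr_ge0; [exact: sqr_ge0|exact: nu_ge0 Gadj Comega _].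
- by rewrite mulr_ge0 ?energy_ge0// mulr_ge0 ?powR_ge0.
- by rewrite ler_wpM2l ?energy_ge0// sum_nu.
Qed.

Lemma faber_krahn :
  \sum_(a <- W) f a ^+ 2 * mu a <=
  fk_const * n%:R ^+ 2
  * ((\sum_(a <- W) (if f a != 0 then mu a else 0)) / N) `^ theta * energy W f.
Proof.
have /andP[th0 th1] := fk_exponent_bounds.
have q00 : 0 < q by apply: lt_trans q1.
have p00 : 0 < p by apply: lt_trans p1.
set G := fun a => if f a != 0 then mu a else 0; set A := \sum_(a <- W) (if f a != 0 then mu a else 0).
have G0 a : 0 <= G a by rewrite /G; case: ifP => // _; exact: mu_ge0 Gadj Comega a.
have A0 : 0 <= A by apply: sumr_ge0 => a _; exact: G0.
have En0 := energy_ge0 W f.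
(* Square [sobolev_X] and divide by X^(1 - 1/q): the exponents satisfy 2 (1 - 1/d') = rho^-1 + (1 -
   1/q). *)
have EX : X `^ rho^-1 <= (CS * n%:R `^ (1 - d / d') * (2 * beta)) ^+ 2
    * (Kn * N) `^ q^-1 * energy W f.
  have [X00|Xn0] := eqVneq X 0.
    have r0 : rho^-1 != 0 by rewrite invr_eq0 gt_eqF.
    by rewrite X00 powR0// mulr_ge0// mulr_ge0 ?sqr_ge0 ?powR_ge0.
  have Xp : 0 < X by rewrite lt_neqAle eq_sym Xn0.
  have Xq : 0 < X `^ (1 - q^-1) by exact: powR_gt0.
  have := sobolev_X; set C1 := CS * _ * _; set E := energy _ _ * _ => h.
  have C10 : 0 <= C1.
    have b0 : 0 < 2 * beta by exact: lt_trans beta2.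
    by rewrite mulr_ge0 ?(ltW b0)// mulr_ge0 ?powR_ge0 ?(ltW CS0).
  have E0 : 0 <= E by rewrite mulr_ge0// mulr_ge0 ?powR_ge0.
  have : (X `^ (1 - d'^-1)) ^+ 2 <= C1 ^+ 2 * E.
    have -> : E = (E `^ 2^-1) ^+ 2.
      by rewrite -powR_mulrn ?powR_ge0// -powRrM mulVf// powRr1.
    rewrite -exprMn lerXn2r ?nnegrE ?powR_ge0//.
    by apply: mulr_ge0 => //; exact: powR_ge0.
  rewrite -[(X `^ _) ^+ 2]powR_mulrn ?powR_ge0// -powRrM.
  rewrite (_ : (1 - d'^-1) * 2 = rho^-1 + (1 - q^-1)); last by rewrite rhoV; lra.
  rewrite powRD ?Xn0 ?implybT// -ler_pdivlMr// => /le_trans; apply.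
  rewrite ler_pdivrMr// /E; by rewrite le_eqVlt; apply/orP; left; apply/eqP; ring.
(* On the support of [f], [mu] is split as mu^theta (mu^p)^((1 - theta) / p); off the support both
   sides vanish. *)
have : \sum_(a <- W) f a ^+ 2 * mu a <=
    X `^ rho^-1 * A `^ theta * (Km * N) `^ ((1 - theta) / p).
  rewrite fW_ball => [|a /= ->]; last by rewrite expr0n mul0r.
  rewrite (eq_bigr (fun a => (f a `^ (2 * rho)) `^ rho^-1 * G a `^ theta
    * (mu a `^ p) `^ ((1 - theta) / p))); last first.
    move=> a _; rewrite -!powRrM mulfK ?(gt_eqF rho_gt0)// powR_mulrn// /G.
    rewrite [p * _]mulrC divfK ?(gt_eqF p00)//.
    case: (eqVneq (f a) 0) => [->|fa] /=; first by rewrite expr0n !mul0r.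
    rewrite -mulrA -powRD; last by rewrite (gt_eqF (mu_gt0 Gadj Comega a)) implybT.
    by rewrite addrC subrK powRr1 ?(mu_ge0 Gadj Comega).
  have e3 : 0 < (1 - theta) / p by rewrite divr_gt0// subr_gt0.
  have e1 : 0 < rho^-1 by rewrite invr_gt0.
  have F0 a : 0 <= f a `^ (2 * rho) by exact: powR_ge0.
  have H0 a : 0 <= mu a `^ p by exact: powR_ge0.
  apply: (le_trans (hoelder_sum3 _ F0 G0 H0 e1 th0 e3 theta_split)).
  rewrite -(@fW_ball (fun a => f a `^ (2 * rho))) => [|a /= ->]; last first.
    by rewrite powR0// gt_eqF// mulr_gt0.
  rewrite -(@fW_ball G) => [|a fa]; last by rewrite /G fa eqxx.
  rewrite ler_wpM2l ?mulr_ge0 ?powR_ge0//.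
  apply: ge0_ler_powR; rewrite ?nnegrE//; first exact: ltW.
  - by apply: sumr_ge0 => a _; exact: powR_ge0.
  - by rewrite mulr_ge0// ltW.
move=> /le_trans; apply.
apply: (@le_trans _ _ ((CS * n%:R `^ (1 - d / d') * (2 * beta)) ^+ 2
    * (Kn * N) `^ q^-1 * energy W f * A `^ theta * (Km * N) `^ ((1 - theta) / p))).
  by rewrite ler_wpM2r ?powR_ge0// ler_wpM2r ?powR_ge0.
(* Scaling count: the Sobolev factor is n / N^(1/d'), and the other powers of [N] add up to 2/d' by
   [theta_split], so that n^2 / N^theta remains. *)
have -> : n%:R `^ (1 - d / d') = n%:R / N `^ d'^-1.
  by rewrite powRB ?powRr1 ?(gt_eqF nR0) ?implybT// /N -powRrM.
have NV0 : 0 < N `^ d'^-1 by exact: powR_gt0.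
have NE : N `^ q^-1 * N `^ ((1 - theta) / p) * N `^ theta = (N `^ d'^-1) ^+ 2.
  rewrite -powR_mulrn ?powR_ge0// -powRrM -!powRD ?(gt_eqF N0) ?implybT//.
  by congr powR; move: theta_split; rewrite rhoV; lra.
have Nt0 : N `^ theta != 0 by rewrite gt_eqF// powR_gt0.
rewrite !(powRM _ Kn0 (ltW N0)) !(powRM _ Km0 (ltW N0)) (powRM _ A0) ?invr_ge0 ?(ltW N0)//.
rewrite -[N^-1]powR_inv1 ?(ltW N0)// powRAC powR_inv1 ?powR_ge0//.
rewrite /fk_const le_eqVlt; apply/orP; left; apply/eqP.
rewrite -/theta; set KK := Kn `^ _; set KM := Km `^ _.
have -> : (CS * (n%:R / N `^ d'^-1) * (2 * beta)) ^+ 2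
  = CS ^+ 2 * n%:R ^+ 2 * (4 * beta ^+ 2) / (N `^ d'^-1) ^+ 2.
  by field; rewrite gt_eqF.
rewrite -NE; field.
by rewrite Nt0 !gt_eqF// powR_gt0.
Qed.

End FaberKrahn.

(** * De Giorgi iteration for caloric functions *)

Section Derivatives.
Variable R : realType.

(** A quadratic remainder is enough; this covers the square of the positive part, which is
    differentiable at the kink although the positive part is not. *)
Lemma is_derive_quadratic (f : R -> R) (x l C : R) :
  (forall h, `|f (x + h) - f x - h * l| <= C * h ^+ 2) -> is_derive x 1 f l.
Proof.
move=> fC.
have C0 : 0 <= C.
  by have := fC 1; rewrite expr1n mulr1; apply: le_trans.
have cv : h^-1 *: (f (h *: 1 + x) - f x) @[h --> 0^'] --> l.
  apply/cvgrPdist_le => e e0; near=> h.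
  have h0 : h != 0 by near: h; exact: nbhs_dnbhs_neq.
  rewrite distrC [h *: 1]mulr1 [h + x]addrC.
  have -> : h^-1 *: (f (x + h) - f x) - l = h^-1 * (f (x + h) - f x - h * l).
    by rewrite /GRing.scale/=; field.
  rewrite normrM normfV ler_pdivrMl ?normr_gt0// (le_trans (fC h))//.
  rewrite -real_normK ?num_real// expr2 mulrCA ler_wpM2l//.
  have : `|h| <= e / (C + 1).
    near: h; apply: dnbhs0_le; rewrite divr_gt0//; lra.
  rewrite ler_pdivlMr; last lra.
  have := normr_ge0 h; nra.
apply: DeriveDef; first by apply/cvg_ex; exists l.
exact: cvg_lim cv.
Unshelve. all: by end_near. Qed.

Lemma pos_sqr_taylor (z h : R) :
  `|Num.max (z + h) 0 ^+ 2 - Num.max z 0 ^+ 2 - h * (2 * Num.max z 0)| <= h ^+ 2.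
Proof.
rewrite ler_norml.
have [z0|z0] := leP z 0; have [zh|zh] := leP (z + h) 0;
  apply/andP; split; nra.
Qed.

Lemma is_derive_pos_sqr (f : R -> R) (x df : R) : is_derive x 1 f df ->
  is_derive x 1 (fun s => Num.max (f s) 0 ^+ 2) (2 * Num.max (f x) 0 * df).
Proof.
move=> dfx.
have H : is_derive (f x) 1 (fun z : R => Num.max z 0 ^+ 2) (2 * Num.max (f x) 0).
  apply: (@is_derive_quadratic _ _ _ 1) => h; rewrite mul1r.
  exact: pos_sqr_taylor.
have := @is_derive1_comp R (fun z : R => Num.max z 0 ^+ 2) f x _ _ H dfx.
by rewrite mulrC => h; apply: is_derive_eq h _; rewrite /= mulrC.
Qed.

Lemma is_derive_seq_sum (I : eqType) (r : seq I) (F : I -> R -> R) (dF : I -> R) (x : R) :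
  (forall i, i \in r -> is_derive x 1 (F i) (dF i)) ->
  is_derive x 1 (fun s => \sum_(i <- r) F i s) (\sum_(i <- r) dF i).
Proof.
elim: r => [|i r IH] h.
  rewrite big_nil (_ : (fun s => _) = cst 0); first exact: is_derive_cst.
  by apply/funext => s; rewrite big_nil.
rewrite big_cons (_ : (fun s => _) = F i \+ (fun s => \sum_(j <- r) F j s)).
  apply: is_deriveD; first by apply: h; rewrite inE eqxx.
  by apply: IH => j jr; apply: h; rewrite inE jr orbT.
by apply/funext => s; rewrite big_cons.
Qed.

End Derivatives.

(** * Caccioppoli inequality for truncations *)

Section Caccioppoli.
Variables (V : choiceType) (adj : rel V) (R : realType) (omega : V -> V -> R).
Hypotheses (Gadj : infinite_graph adj) (Comega : conductances adj omega).
Local Notation mu := (mu_w adj omega).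
Local Notation L := (generator adj omega).

Definition excess (u : V -> R) (k : R) (a : V) : R := Num.max (u a - k) 0.

Lemma excess_ge0 u k a : 0 <= excess u k a.
Proof. by rewrite /excess le_max lexx orbT. Qed.

(** Replacing [u b - u a] by the difference of the truncations only increases the left side. For the
    truncated values A and B the bound is the identity (A x1^2 - B x2^2) (B - A) = - (A x1 - B x2)^2
    + A B (x1 - x2)^2. *)
Lemma excess_edge u k (x1 x2 : R) a b : 
  (excess u k a * x1 ^+ 2 - excess u k b * x2 ^+ 2) * (u b - u a)
  <= - (excess u k a * x1 - excess u k b * x2) ^+ 2
     + excess u k a * excess u k b * (x1 - x2) ^+ 2.
Proof.
rewrite /excess.
suff : (Num.max (u a - k) 0 * x1 ^+ 2 - Num.max (u b - k) 0 * x2 ^+ 2) * (u b - u a) <=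
  (Num.max (u a - k) 0 * x1 ^+ 2 - Num.max (u b - k) 0 * x2 ^+ 2) *
  (Num.max (u b - k) 0 - Num.max (u a - k) 0).
  by move=> h; apply: (le_trans h); rewrite le_eqVlt; apply/orP; left; apply/eqP; ring.
have := sqr_ge0 x1; have := sqr_ge0 x2; move: (x1 ^+ 2) (x2 ^+ 2) => {x1 x2} X1 X2 h1 h2.
have [z0|z0] := leP (u a - k) 0; have [zh|zh] := leP (u b - k) 0.
- by rewrite !mul0r subrr !mul0r.
- have : 0 <= (u b - k) * X2 * (k - u a).
    by rewrite !mulr_ge0//; [exact: ltW | lra].
  by rewrite mul0r !sub0r; lra.
- have : 0 <= (u a - k) * X1 * (k - u b).
    by rewrite !mulr_ge0//; [exact: ltW | lra].
  by rewrite mul0r !subr0 sub0r; lra.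
- by rewrite (_ : u b - k - (u a - k) = u b - u a)//; ring.
Qed.

Section OneTime.
Variables (W : seq V) (xi : V -> R).
Hypotheses (uW : uniq W)
  (xiW : forall a, xi a != 0 -> forall b, adj a b -> b \in W).

(** For caloric [u] the left side is a time derivative. Symmetrising over edges reduces the claim to
    [excess_edge]. The error keeps the product of both truncations, so that the same inequality
    serves for De Giorgi cutoffs and for exponential weights. *)
Lemma caccioppoli (u : V -> R) (k : R) :
  \sum_(a <- W) 2 * excess u k a * L u a * (xi a ^+ 2 * mu a)
  <= - energy omega W (fun a => excess u k a * xi a)
     + \sum_(a <- W) \sum_(b <- W)
         omega a b * (excess u k a * excess u k b * (xi a - xi b) ^+ 2).
Proof.
pose T a b := omega a b * (excess u k a * xi a ^+ 2 * (u b - u a)).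
have -> : \sum_(a <- W) 2 * excess u k a * L u a * (xi a ^+ 2 * mu a) =
   2 * \sum_(a <- W) \sum_(b <- W) T a b.
  rewrite mulr_sumr; apply: eq_bigr => a _.
  have [xa|xa] := eqVneq (xi a) 0.
    rewrite xa expr0n/= mul0r mulr0 big1 ?mulr0// => b _.
    by rewrite /T xa expr0n/= mulr0 mul0r mulr0.
  rewrite (generator_sum Comega _ uW (xiW xa)).
  have -> : \sum_(b <- W) T a b = excess u k a * xi a ^+ 2
     * \sum_(b <- W) omega a b * (u b - u a).
    by rewrite mulr_sumr; apply: eq_bigr => b _; rewrite /T; ring.
  by field; rewrite (gt_eqF (mu_gt0 Gadj Comega a)).
have -> : 2 * \sum_(a <- W) \sum_(b <- W) T a b =
   \sum_(a <- W) \sum_(b <- W) (T a b + T b a).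
  rewrite mulr_natl mulr2n [X in _ + X]exchange_big -big_split.
  by apply: eq_bigr => a _; rewrite -big_split.
rewrite /energy -sumrN -big_split; apply: ler_sum => a _ /=.
rewrite -sumrN -big_split; apply: ler_sum => b _ /=.
rewrite /T -(omega_sym Comega a b) -mulrN -!mulrDr ler_wpM2l ?(omega_ge0 Comega)//.
apply: le_trans (excess_edge u k (xi a) (xi b) a b).
by rewrite le_eqVlt; apply/orP; left; apply/eqP; ring.
Qed.

End OneTime.

Lemma sum_omega_mul_le (W : seq V) (w : V -> R) : uniq W -> (forall a, 0 <= w a) ->
  \sum_(a <- W) \sum_(b <- W) omega a b * (w a * w b)
   <= \sum_(a <- W) w a ^+ 2 * mu a.
Proof.
move=> uW w0.
apply: (@le_trans _ _ (\sum_(a <- W) \sum_(b <- W)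
   (2^-1 * (omega a b * w a ^+ 2) + 2^-1 * (omega b a * w b ^+ 2)))).
  apply: ler_sum => a _; apply: ler_sum => b _.
  rewrite -(omega_sym Comega a b).
  rewrite (_ : _ + _ = omega a b * (2^-1 * (w a ^+ 2 + w b ^+ 2))); last by ring.
  rewrite ler_wpM2l ?(omega_ge0 Comega)//.
  have := sqr_ge0 (w a - w b); nra.
have -> : \sum_(a <- W) \sum_(b <- W)
   (2^-1 * (omega a b * w a ^+ 2) + 2^-1 * (omega b a * w b ^+ 2)) =
   \sum_(a <- W) \sum_(b <- W) omega a b * w a ^+ 2.
  have E1 : \sum_(a <- W) \sum_(b <- W)
     (2^-1 * (omega a b * w a ^+ 2) + 2^-1 * (omega b a * w b ^+ 2)) =
    2^-1 * (\sum_(a <- W) \sum_(b <- W) omega a b * w a ^+ 2 +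
            \sum_(a <- W) \sum_(b <- W) omega b a * w b ^+ 2).
    rewrite -big_split mulr_sumr; apply: eq_bigr => a _.
    by rewrite -big_split mulr_sumr; apply: eq_bigr => b _ /=; ring.
  by rewrite E1 [X in _ + X]exchange_big/=; field.
apply: ler_sum => a _; rewrite -mulr_suml mulrC ler_wpM2l ?sqr_ge0//.
exact: (mu_ge Gadj Comega).
Qed.

End Caccioppoli.

(** * One De Giorgi step and its iteration *)

Section MeanValue.
Variables (V : choiceType) (adj : rel V) (R : realType) (omega : V -> V -> R).
Hypotheses (Gadj : infinite_graph adj) (Comega : conductances adj omega).
Local Notation mu := (mu_w adj omega).
Local Notation L := (generator adj omega).
Local Notation dist := (gdist adj).

(** The derivative is two-sided even at the end points; the functions to which this is applied are
    power series in time, defined on the whole line. *)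
Definition caloric (u : R -> V -> R) (t0 t1 : R) : Prop :=
  forall s a, t0 <= s <= t1 -> is_derive s 1 (fun s => u s a) (L (u s) a).

Lemma is_derive_weighted_excess (u : R -> V -> R) t0 t1 s (W : seq V) (xi : V -> R) k :
  caloric u t0 t1 -> t0 <= s <= t1 ->
  is_derive s 1 (fun s => \sum_(a <- W) excess (u s) k a ^+ 2 * (xi a ^+ 2 * mu a))
    (\sum_(a <- W) 2 * excess (u s) k a * L (u s) a * (xi a ^+ 2 * mu a)).
Proof.
move=> cu hs; apply: is_derive_seq_sum => a _.
have D : is_derive s 1 (fun s => u s a - k) (L (u s) a).
  have := cu s a hs => ?; apply: is_derive_eq; exact: subr0.
have := is_derive_pos_sqr D => ?.
by apply: is_derive_eq; rewrite /excess /GRing.scale/=; ring.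
Qed.

(** The window [W] contains the support of [f] and all its neighbours, so the energy over [W] misses
    no edge along which [f] varies. *)
Definition faber_krahn_on (B : set V) (Q N th : R) : Prop :=
  forall (W : seq V) (f : V -> R), uniq W -> (forall a, 0 <= f a) ->
  (forall a, f a != 0 -> [/\ B a, a \in W & forall b, adj a b -> b \in W]) ->
  \sum_(a <- W) f a ^+ 2 * mu a <=
  Q * ((\sum_(a <- W) (if f a != 0 then mu a else 0)) / N) `^ th
    * energy omega W f.

Section Step.
Variables (B : set V) (Q N th : R).
Hypotheses (FK : faber_krahn_on B Q N th) (Q0 : 0 < Q) (N0 : 0 < N) (th0 : 0 < th).

(* The Faber-Krahn constant of the superlevel set [{u > k'}] is controlled by [sigma]
   through Chebyshev's inequality. *)
Lemma de_giorgi_step (u : R -> V -> R) (t0 t1 t2 : R) (W W' : seq V)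
    (eta : V -> R) (l2 k k' sigma : R) :
  caloric u t0 t2 -> t0 < t1 -> t1 <= t2 -> uniq W -> uniq W' ->
  {subset W' <= W} ->
  (forall a, 0 <= eta a <= 1) -> (forall a, a \in W' -> eta a = 1) ->
  (forall a, eta a != 0 -> [/\ B a, a \in W & forall b, adj a b -> b \in W]) ->
  (forall a b, adj a b -> (eta a - eta b) ^+ 2 <= l2) ->
  0 <= l2 -> k < k' -> 0 < sigma ->
  (forall s, t0 <= s <= t2 -> \sum_(a <- W) excess (u s) k a ^+ 2 * mu a <= sigma) ->
  forall s, t1 <= s <= t2 ->
  \sum_(a <- W') excess (u s) k' a ^+ 2 * mu a <=
   sigma * (Q * (sigma / ((k' - k) ^+ 2 * N)) `^ th) * ((t1 - t0)^-1 + l2).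
Proof.
move=> cu t01 t12 uW uW' W'W eta01 eta1 etaW etaL l20 kk' s0 hsig s /andP[t1s st2].
have mu0 a : 0 <= mu a := mu_ge0 Gadj Comega a.
have eta0 a : 0 <= eta a by case/andP: (eta01 a).
have ex0 r j a : 0 <= excess (u r) j a := excess_ge0 (u r) j a.
have dk0 : 0 < (k' - k) ^+ 2 by rewrite exprn_gt0// subr_gt0.
set Lam := Q * _ `^ th.
have Lam0 : 0 < Lam by rewrite mulr_gt0// powR_gt0// divr_gt0// mulr_gt0.
pose F r := \sum_(a <- W) excess (u r) k' a ^+ 2 * (eta a ^+ 2 * mu a).
have exle r a : excess (u r) k' a <= excess (u r) k a.
  by rewrite /excess ge_max !le_max lexx orbT andbT lerB ?(ltW kk').
have ex2le r a : excess (u r) k' a ^+ 2 <= excess (u r) k a ^+ 2.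
  by rewrite lerXn2r ?nnegrE.
have big_le r : t0 <= r <= t2 -> \sum_(a <- W) excess (u r) k' a ^+ 2 * mu a <= sigma.
  move=> /hsig; apply: le_trans; apply: ler_sum => a _.
  by rewrite ler_wpM2r.
have Fle r : t0 <= r <= t2 -> F r <= sigma.
  move=> /big_le; apply: le_trans; apply: ler_sum => a _.
  rewrite ler_wpM2l ?sqr_ge0// -[leRHS]mul1r ler_wpM2r//.
  by rewrite exprn_ile1//; case/andP: (eta01 a).
have dF r : t0 <= r <= t2 -> is_derive r 1 F
    (\sum_(a <- W) 2 * excess (u r) k' a * L (u r) a * (eta a ^+ 2 * mu a)).
  exact: is_derive_weighted_excess.
have etaW' a : eta a != 0 -> forall b, adj a b -> b \in W by move=> /etaW[].
(* The cutoff error is at most [l2 * sigma], and Faber-Krahn bounds the energy below by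
   [F r / Lam]. *)
have dFle r : t0 <= r <= t2 ->
    \sum_(a <- W) 2 * excess (u r) k' a * L (u r) a * (eta a ^+ 2 * mu a)
    <= l2 * sigma - Lam^-1 * F r.
  move=> hr; apply: (le_trans (caccioppoli Gadj Comega uW etaW' (u r) k')).
  set w := fun a => excess (u r) k' a * eta a.
  rewrite addrC; apply: lerB.
    apply: (@le_trans _ _ (l2 * \sum_(a <- W) \sum_(b <- W)
        omega a b * (excess (u r) k' a * excess (u r) k' b))).
      rewrite mulr_sumr; apply: ler_sum => a _; rewrite mulr_sumr.
      apply: ler_sum => b _; have [ab|nab] := boolP (adj a b); last first.
        by rewrite (omega_eq0 Comega nab) !mul0r mulr0.
      rewrite [leRHS]mulrCA ler_wpM2l ?(omega_ge0 Comega)//.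
      by rewrite mulrC ler_wpM2r ?mulr_ge0// etaL.
    rewrite ler_wpM2l//; apply: le_trans (big_le r hr).
    exact: sum_omega_mul_le.
  have w0 a : 0 <= w a by exact: mulr_ge0.
  have wW a : w a != 0 -> [/\ B a, a \in W & forall b, adj a b -> b \in W].
    by move=> wa; apply: etaW; apply: contra_neq wa => ea; rewrite /w ea mulr0.
  have := FK uW w0 wW; set S := \sum_(a <- W) (if _ then _ else _) => FKw.
  have S0 : 0 <= S by apply: sumr_ge0 => a _; case: ifP.
  have Sle : S <= sigma / (k' - k) ^+ 2.
    rewrite ler_pdivlMr//; apply: le_trans (hsig r hr).
    rewrite mulr_suml; apply: ler_sum => a _; case: ifPn => [wa|_]; last first.
      by rewrite mul0r mulr_ge0// sqr_ge0.
    rewrite mulrC ler_wpM2r// lerXn2r ?nnegrE ?subr_ge0 ?(ltW kk')//.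
    have : 0 < excess (u r) k' a.
      rewrite lt_neqAle ex0 andbT eq_sym; apply: contra_neq wa => ea.
      by rewrite /w ea mul0r.
    rewrite /excess lt_max ltxx orbF subr_gt0 => uk.
    by rewrite le_max lerB ?(ltW uk).
  rewrite ler_pdivrMl// (_ : F r = \sum_(a <- W) w a ^+ 2 * mu a); last first.
    by apply: eq_bigr => a _; rewrite /w exprMn mulrA.
  apply: (le_trans FKw); rewrite ler_wpM2r ?(energy_ge0 Comega)//.
  rewrite ler_wpM2l ?(ltW Q0)//; apply: ge0_ler_powR; rewrite ?nnegrE ?(ltW th0)//.
  - by rewrite divr_ge0// ltW.
  - by rewrite divr_ge0 ?(ltW s0)// mulr_ge0 ?sqr_ge0 ?(ltW N0).
  - by rewrite invfM mulrA ler_wpM2r ?invr_ge0 ?(ltW N0).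
have t0s : t0 < s by apply: lt_le_trans t1s.
have Ln0 : Lam^-1 != 0 by rewrite invr_eq0 gt_eqF.
have I r : t0 <= r <= s -> t0 <= r <= t2.
  by move=> /andP[-> /le_trans]; apply.
have := linear_gronwall (ltW t0s) Ln0 (fun r hr => dF r (I r hr))
  (fun r hr => dFle r (I r hr)).
rewrite invrK => G.
apply: (@le_trans _ _ (F s)).
  rewrite (eq_big_seq (fun a => excess (u s) k' a ^+ 2 * (eta a ^+ 2 * mu a))).
    apply: ler_sum_sub_uniq => // a _.
    by rewrite mulr_ge0 ?sqr_ge0// mulr_ge0 ?sqr_ge0.
  by move=> a aW'; rewrite eta1// expr1n mul1r.
(* The initial value is forgotten at rate 1 / Lam; e^(-x) <= 1/x turns this into the factor Lam /
   (t1 - t0). *)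
have e1 : expR (- Lam^-1 * (s - t0)) <= Lam / (t1 - t0).
  have p0 : 0 < Lam^-1 * (s - t0) by rewrite mulr_gt0 ?invr_gt0// subr_gt0.
  rewrite mulNr; apply: (le_trans (expRN_le_inv p0)).
  rewrite invfM invrK ler_wpM2l ?(ltW Lam0)//.
  by rewrite lef_pV2 ?posrE ?subr_gt0// lerB.
have F0s : F t0 <= sigma by apply: Fle; rewrite lexx (le_trans (ltW t01)).
have e0 := expR_ge0 (- Lam^-1 * (s - t0)).
have : expR (- Lam^-1 * (s - t0)) * (F t0 - l2 * sigma * Lam) <= Lam / (t1 - t0) * sigma.
  apply: (@le_trans _ _ (expR (- Lam^-1 * (s - t0)) * sigma)).
    rewrite ler_wpM2l// lerBlDr ler_wpDr// mulr_ge0 ?(ltW Lam0)//.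
    by rewrite mulr_ge0 ?(ltW s0).
  by rewrite ler_wpM2r ?(ltW s0).
lra.
Qed.
End Step.

Lemma clamp_lip (a b : R) :
  `|Num.max 0 (Num.min 1 a) - Num.max 0 (Num.min 1 b)| <= `|a - b|.
Proof.
wlog ab : a b / a <= b.
  move=> h; have [ab|/ltW ba] := leP a b; first exact: h.
  by rewrite distrC [leRHS]distrC h.
rewrite (ler0_norm (x:=a - b)) ?subr_le0// ler0_norm ?subr_le0; last first.
  by rewrite ge_max !le_max lexx/= le_min !ge_min lexx ab /= !orbT.
have [a1|a1] := leP 1 a; have [b1|b1] := leP 1 b; have [a0|a0] := leP 0 a;
  have [b0|b0] := leP 0 b; rewrite ?(max_r ler01) ?(max_r a0) ?(max_r b0); lra.
Qed.

Lemma cutoff_lip (l r : R) (a b : nat) : 0 <= l -> (a <= b.+1)%N -> (b <= a.+1)%N ->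
  (Num.max 0 (Num.min 1 ((r - a%:R) * l)) - Num.max 0 (Num.min 1 ((r - b%:R) * l))) ^+ 2
  <= l ^+ 2.
Proof.
move=> l0; rewrite -(ler_nat R) -(ler_nat R b) -!natr1 => ab ba.
have h : `|(r - a%:R) * l - (r - b%:R) * l| <= l.
  rewrite -mulrBl normrM (ger0_norm l0) -[leRHS]mul1r ler_wpM2r// ler_norml.
  by apply/andP; split; lra.
rewrite -real_normK ?num_real// lerXn2r ?nnegrE//.
exact: le_trans (clamp_lip _ _) h.
Qed.

Lemma sqr_le_of_parts (w e l s X Z : R) : w ^+ 2 <= (e + l) ^+ 2 ->
  e ^+ 2 <= s * Z -> l ^+ 2 <= s * X -> w ^+ 2 <= 2 * s * (X + Z).
Proof. by have := sqr_ge0 (e - l); lra. Qed.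

Section Iteration.
Variables (B : set V) (C nr N th : R) (J : nat) (y : V) (rho : nat).
Hypotheses (FK : faber_krahn_on B (C * nr ^+ 2) N th) (C0 : 0 < C) (N0 : 0 < N)
  (th0 : 0 < th) (th1 : th <= 1) (Jth : 4 <= J%:R * th) (rho1 : (1 <= rho)%N)
  (nr0 : 0 < nr) (yB : forall z, (dist y z <= rho)%N -> B z).

Let H : R := (288 * C * (nr / rho%:R) ^+ 2 * 2 ^+ J) `^ th^-1.

Let rho0 : 0 < rho%:R :> R. Proof. by rewrite ltr0n. Qed.
Let base0 : 0 < 288 * C * (nr / rho%:R) ^+ 2 * 2 ^+ J.
Proof.
have c288 : 0 < 288 :> R by rewrite ltr0n.
apply: mulr_gt0; last exact: exprn_gt0.
by apply: mulr_gt0; [exact: mulr_gt0|apply: exprn_gt0; exact: divr_gt0].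
Qed.
Let H0 : 0 < H. Proof. exact: powR_gt0. Qed.

(* [H] is chosen so that one De Giorgi step at the levels, times and radii of
   [iterate] divides the bound [sigma] by [2 ^ J]. *)
Let decay (k : nat) (sigma : R) : 0 < sigma ->
  let sk := sigma / 2 ^+ J ^+ k in
  sk * (C * nr ^+ 2 * (sk / ((sigma * H / N / (4 * 4 ^+ k)) * N)) `^ th)
    * ((rho%:R ^+ 2 / 8 / 2 ^+ k)^-1 + (8 * 2 ^+ k / rho%:R) ^+ 2)
  <= sigma / 2 ^+ J ^+ k.+1.
Proof.
move=> s0 /=.
have z0 : 0 < (2 : R) ^+ k by rewrite exprn_gt0.
have z1 : 1 <= (2 : R) ^+ k by rewrite exprn_ege1// ler1n.
have E4 : (4 : R) ^+ k = (2 ^+ k) ^+ 2 by rewrite exprAC; congr (_ ^+ _); rewrite expr2; lra.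
have J0 : 0 < (2 : R) ^+ J by rewrite exprn_gt0.
have Jk0 : 0 < (2 : R) ^+ J ^+ k by rewrite exprn_gt0.
set sk := sigma / _; have sk0 : 0 < sk by rewrite divr_gt0.
have -> : sk / (sigma * H / N / (4 * 4 ^+ k) * N) = (2 ^+ J ^+ k)^-1 * (4 * 4 ^+ k) * H^-1.
  by rewrite /sk; field; rewrite !gt_eqF// exprn_gt0.
have HV : H `^ th = 288 * C * (nr / rho%:R) ^+ 2 * 2 ^+ J.
  by rewrite /H -powRrM mulVf ?(gt_eqF th0)// powRr1 ?(ltW base0).
(* Here [4 <= J * th] enters: the power [th] of 2^(-J k) is at most 2^(-4 k). The factor 4 * 4^k is
   at least 1, so its power [th <= 1] is at most itself. *)
have P1 : ((2 ^+ J ^+ k)^-1 * (4 * 4 ^+ k) * H^-1) `^ th <=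
    ((2 ^+ k) ^+ 4)^-1 * (4 * 4 ^+ k) / (288 * C * (nr / rho%:R) ^+ 2 * 2 ^+ J).
  have f0 : 0 < (4 : R) * 4 ^+ k by rewrite mulr_gt0// exprn_gt0.
  have f1 : 1 <= (4 : R) * 4 ^+ k.
    have : 1 <= (4 : R) ^+ k by apply: exprn_ege1; rewrite ler1n.
    lra.
  move: (4 * 4 ^+ k) f0 f1 => f4 f0 f1.
  rewrite !powRM ?mulr_ge0 ?invr_ge0 ?(ltW f0) ?(ltW H0) ?(ltW Jk0)//.
  rewrite -[H^-1]powR_inv1 ?(ltW H0)// powRAC powR_inv1 ?powR_ge0// HV.
  rewrite ler_wpM2r ?invr_ge0 ?(ltW base0)//.
  rewrite ler_pM ?powR_ge0//; last first.
    exact: ler1_powR.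
  rewrite -[(2 ^+ J ^+ k)^-1]powR_inv1 ?(ltW Jk0)// powRAC powR_inv1 ?powR_ge0//.
  rewrite lef_pV2 ?posrE ?powR_gt0 ?exprn_gt0//.
  have -> : ((2 : R) ^+ k) ^+ 4 = 2 `^ (4 * k%:R).
    by rewrite -exprM -powR_mulrn// natrM mulrC.
  have -> : ((2 : R) ^+ J ^+ k) `^ th = 2 `^ (J%:R * th * k%:R).
    by rewrite -exprM -powR_mulrn// -powRrM natrM mulrAC.
  by rewrite ler_powR ?ler1n// ler_wpM2r.
have P2 : ((rho%:R : R) ^+ 2 / 8 / 2 ^+ k)^-1 + (8 * 2 ^+ k / rho%:R) ^+ 2 <=
    72 * (2 ^+ k) ^+ 2 / rho%:R ^+ 2.
  have -> : ((rho%:R : R) ^+ 2 / 8 / 2 ^+ k)^-1 + (8 * 2 ^+ k / rho%:R) ^+ 2 =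
     (8 * 2 ^+ k + 64 * (2 ^+ k) ^+ 2) / rho%:R ^+ 2.
    by field; rewrite !gt_eqF.
  by rewrite ler_wpM2r ?invr_ge0 ?sqr_ge0//; nra.
have P20 : 0 <= ((rho%:R : R) ^+ 2 / 8 / 2 ^+ k)^-1 + (8 * 2 ^+ k / rho%:R) ^+ 2.
  apply: addr_ge0; last exact: sqr_ge0.
  by rewrite invr_ge0 divr_ge0 ?(ltW z0)// divr_ge0 ?sqr_ge0.
apply: (@le_trans _ _ (sk * (C * nr ^+ 2 * (((2 ^+ k) ^+ 4)^-1 * (4 * 4 ^+ k) /
   (288 * C * (nr / rho%:R) ^+ 2 * 2 ^+ J))) * (72 * (2 ^+ k) ^+ 2 / rho%:R ^+ 2))).
  have Cn0 : 0 <= C * nr ^+ 2 by apply: mulr_ge0; [exact: ltW|exact: sqr_ge0].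
  apply: ler_pM => //.
    apply: mulr_ge0; first exact: ltW.
    by apply: mulr_ge0 => //; exact: powR_ge0.
  by rewrite ler_wpM2l ?(ltW sk0)// ler_wpM2l.
(* The powers of 2^k cancel, and 4 * 72 = 288 is the constant in [H]; only the factor 2^(-J) is
   left. *)
rewrite le_eqVlt; apply/orP; left; apply/eqP; rewrite /sk E4 [in RHS]exprS; field.
by rewrite !gt_eqF.
Qed.

Variables (u : R -> V -> R) (T sigma : R).
Hypotheses (cu : caloric u (T - rho%:R ^+ 2 / 4) T)
  (u0 : forall s a, T - rho%:R ^+ 2 / 4 <= s <= T -> 0 <= u s a) (sigma0 : 0 < sigma)
  (u_sigma : forall s, T - rho%:R ^+ 2 / 4 <= s <= T ->
     \sum_(a <- ball_seq adj y rho) u s a ^+ 2 * mu a <= sigma).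

(** Levels rise from 0 towards the square root of sigma H / N, starting times rise towards T, and
    radii shrink from rho towards rho / 2, all in increments proportional to 2^(-k). *)
Let level (k : nat) : R := Num.sqrt (sigma * H / N) * (1 - (2 ^+ k)^-1).
Let time (k : nat) : R := T - rho%:R ^+ 2 / 4 / 2 ^+ k.
Let radius (k : nat) : R := rho%:R / 2 * (1 + (2 ^+ k)^-1).
Let region (k : nat) : seq V :=
  [seq z <- ball_seq adj y rho | (dist y z)%:R <= radius k].

(** The condition on [k] keeps consecutive radii at least two edges apart, which leaves room for a
    cutoff and for one layer of neighbours. *)
Let iterate k : (k = 0 \/ 2 ^ (k + 2) <= rho)%N ->
  forall s, time k <= s <= T ->
  \sum_(a <- region k) excess (u s) (level k) a ^+ 2 * mu a <= sigma / 2 ^+ J ^+ k.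
Proof.
have mu0 a : 0 <= mu a := mu_ge0 Gadj Comega a.
elim: k => [|k IH] hk s hs.
  rewrite expr0 invr1 mulr1; apply: (le_trans _ (@u_sigma s _)); last first.
    by move: hs; rewrite /time expr0 invr1 mulr1.
  have level0 a : excess (u s) (level 0) a = u s a.
    rewrite /excess /level expr0 invr1 subrr mulr0 subr0 max_l// u0//.
    by move: hs; rewrite /time expr0 invr1 mulr1.
  under eq_bigr do rewrite level0.
  apply: ler_sum_sub_uniq.
  - by rewrite filter_uniq// ball_seq_uniq.
  - by move=> a; rewrite mem_filter => /andP[].
  - by move=> a _; rewrite mulr_ge0// sqr_ge0.
have {hk} hk : (2 ^ (k + 3) <= rho)%N.
  by case: hk => // ; rewrite addSnnS.
have hk' : (k = 0 \/ 2 ^ (k + 2) <= rho)%N.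
  by right; apply: leq_trans hk; rewrite leq_exp2l// leq_add2l.
have z0 : 0 < (2 : R) ^+ k by rewrite exprn_gt0.
have hkR : 8 * 2 ^+ k <= rho%:R :> R.
  by move: hk; rewrite -(ler_nat R) natrX exprD mulrC (_ : 2 ^+ 3 = 8)//; lra.
have zV1 : (2 ^+ k)^-1 <= 1 :> R by rewrite invf_le1// exprn_ege1// ler1n.
have zV0 : 0 < (2 ^+ k)^-1 :> R by rewrite invr_gt0.
have hkV : 8 <= rho%:R * (2 ^+ k)^-1 :> R by rewrite ler_pdivlMr.
have SV : (2 ^+ k.+1)^-1 = (2 ^+ k)^-1 / 2 :> R.
  by rewrite exprS invfM mulrC.
have trho : 0 < rho%:R ^+ 2 * (2 ^+ k)^-1 :> R.
  by rewrite mulr_gt0// exprn_gt0.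
pose l : R := 8 * 2 ^+ k / rho%:R.
have l0 : 0 <= l by rewrite divr_ge0 ?(ltW rho0)// mulr_ge0 ?(ltW z0).
(* The cutoff vanishes from distance [radius k - 1] on, so that neighbours of its support stay in
   [region k]. It descends over a width rho / (8 * 2^k), available because 8 * 2^k <= rho. *)
pose eta a := Num.max 0 (Num.min 1 ((radius k - 1 - (dist y a)%:R) * l)).
have regionP j a : (a \in region j) = ((dist y a)%:R <= radius j) && (dist y a <= rho)%N.
  by rewrite mem_filter mem_ball_seq.
have radius_le j : radius j <= rho%:R.
  have h1 : (2 ^+ j)^-1 <= 1 :> R by rewrite invf_le1 ?exprn_gt0// exprn_ege1// ler1n.
  rewrite /radius; move: rho0; nra.
have regionE j a : (a \in region j) = ((dist y a)%:R <= radius j).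
  rewrite regionP; case: leP => //= h; rewrite -(ler_nat R).
  exact: le_trans h (radius_le j).
have uniq_region j : uniq (region j) by rewrite filter_uniq// ball_seq_uniq.
have step := @de_giorgi_step B (C * nr ^+ 2) N th FK _ N0 th0 u (time k)
  (time k.+1) T (region k) (region k.+1) eta (l ^+ 2) (level k) (level k.+1)
  (sigma / 2 ^+ J ^+ k).
have theta0 : 0 < Num.sqrt (sigma * H / N).
  by rewrite sqrtr_gt0 divr_gt0// mulr_gt0.
apply: le_trans (decay k sigma0).
have -> : rho%:R ^+ 2 / 8 / 2 ^+ k = time k.+1 - time k.
  by rewrite /time SV; field; rewrite gt_eqF.
have -> : sigma * H / N / (4 * 4 ^+ k) = (level k.+1 - level k) ^+ 2.
  have -> : (4 : R) ^+ k = (2 ^+ k) ^+ 2.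
    by rewrite exprAC; congr (_ ^+ _); rewrite expr2; lra.
  rewrite -mulrBr exprMn sqr_sqrtr ?divr_ge0 ?mulr_ge0 ?(ltW sigma0) ?(ltW H0) ?(ltW N0)//.
  by rewrite SV; field; rewrite !gt_eqF.
apply: step => //.
- by rewrite mulr_gt0// exprn_gt0.
- move=> r a /andP[r1 r2]; apply: cu; rewrite r2 andbT; apply: le_trans r1.
  by rewrite /time; have := ltW trho; have := sqr_ge0 (rho%:R : R); nra.
- by rewrite /time SV; move: trho; lra.
- by rewrite /time SV; move: trho; lra.
- move=> a; rewrite !regionE => /le_trans; apply.
  by rewrite /radius SV; move: rho0; nra.
- by move=> a; rewrite le_max lexx/= ge_max ler01/= ge_min lexx.
- move=> a; rewrite regionE /radius SV => ha.
  have h1 : 1 <= (radius k - 1 - (dist y a)%:R) * l.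
    rewrite /l mulrA ler_pdivlMr// mul1r /radius.
    have : rho%:R * (2 ^+ k)^-1 * 2 ^+ k = rho%:R :> R by rewrite divfK// gt_eqF.
    set z := 2 ^+ k in z0 hkV ha *; set v := z^-1 in hkV ha *.
    have : rho%:R * v / 8 <= rho%:R / 2 * (1 + v) - 1 - (dist y a)%:R by lra.
    move: (_ - _ - _) => X hX E; have : rho%:R * v / 8 * z <= X * z by rewrite ler_wpM2r// ltW.
    by lra.
  by rewrite /eta min_l// max_r.
- move=> a ea.
  have ha : (dist y a)%:R < radius k - 1.
    rewrite ltNge; apply: contra_neqN ea => ha.
    have h1 : (radius k - 1 - (dist y a)%:R) * l <= 0.
      by rewrite mulr_le0_ge0//; lra.
    by rewrite /eta min_r ?max_l// (le_trans h1).
  have aW : a \in region k by rewrite regionE; lra.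
  split=> //; first by apply: yB; move: aW; rewrite regionP => /andP[].
  move=> b ab; rewrite regionE.
  have : ((dist y b)%:R : R) <= (dist y a).+1%:R by rewrite ler_nat gdist_adj.
  by rewrite -natr1; lra.
- move=> a b ab; apply: cutoff_lip => //; apply: gdist_adj => //.
  by rewrite (adj_sym Gadj).
- exact: sqr_ge0.
- by rewrite /level SV -subr_gt0 -mulrBr mulr_gt0//; lra.
- by rewrite divr_gt0// !exprn_gt0.
- exact: IH.
Qed.

(** The first term is the square of the limiting level. The second is the truncation remaining at
    the last admissible step, with the sum reduced to its term at [y]. *)
Lemma de_giorgi_mean_value :
  u T y ^+ 2 <= 2 * sigma * (H / N + (16 / rho%:R) ^+ J / mu y).
Proof.
(* Truncated subtraction gives [k = 0] when rho < 16, where no step can be counted on. In every case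
   rho <= 16 * 2^k, the origin of the 16 in the statement. *)
pose k := (trunc_log 2 rho - 3)%N.
have /andP[lo hi] := trunc_log_bounds (isT : (1 < 2)%N) rho1.
have hk : (k = 0 \/ 2 ^ (k + 2) <= rho)%N.
  have [h3|h3] := leqP (trunc_log 2 rho) 3.
    by left; apply/eqP; rewrite subn_eq0.
  right; apply: leq_trans lo; rewrite leq_exp2l// /k -(subnK (ltnW h3)) addnK.
  by rewrite leq_add2l.
have hrho : rho%:R <= 16 * 2 ^+ k :> R.
  have : (rho <= 2 ^ (4 + k))%N.
    by apply: (leq_trans (ltnW hi)); rewrite leq_exp2l// addSn ltnS -leq_subLR.
  by rewrite -(ler_nat R) natrX exprD (_ : 2 ^+ 4 = 16)//; lra.
have muy := mu_gt0 Gadj Comega y.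
have z0 : 0 < (2 : R) ^+ k by rewrite exprn_gt0.
have Tt : time k <= T <= T.
  by rewrite lexx andbT /time gerBl ?divr_ge0// ?sqr_ge0// ltW.
have := iterate hk Tt.
have yk : y \in region k.
  rewrite mem_filter mem_ball_seq// gdistxx// leq0n andbT /radius.
  by rewrite mulr_ge0 ?addr_ge0 ?invr_ge0 ?divr_ge0// ltW.
rewrite (bigD1_seq y)/= ?filter_uniq ?ball_seq_uniq// => h.
have {h} h1 : excess (u T) (level k) y ^+ 2 * mu y <= sigma / 2 ^+ J ^+ k.
  apply: le_trans h; rewrite lerDl sumr_ge0// => a _.
  by rewrite mulr_ge0 ?sqr_ge0// (mu_ge0 Gadj Comega).
have h2 : excess (u T) (level k) y ^+ 2 <= sigma * ((16 / rho%:R) ^+ J / mu y).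
  rewrite -ler_pdivlMr// in h1; apply: (le_trans h1); rewrite -mulrA ler_wpM2l ?(ltW sigma0)//.
  rewrite ler_wpM2r ?invr_ge0 ?(ltW muy)// exprAC -exprVn lerXn2r ?nnegrE ?invr_ge0 ?divr_ge0 ?(ltW z0) ?(ltW rho0)//.
  by rewrite ler_pdivlMr// mulrC ler_pdivrMr.
have h3 : level k ^+ 2 <= sigma * (H / N).
  have s0 : 0 <= sigma * H / N.
    by rewrite divr_ge0 ?mulr_ge0 ?(ltW sigma0) ?(ltW H0) ?(ltW N0).
  rewrite mulrA exprMn sqr_sqrtr// -[leRHS]mulr1 ler_wpM2l//.
  rewrite exprn_ile1// ?gerBl ?invr_ge0 ?(ltW z0)// subr_ge0 invf_le1//.
  by rewrite exprn_ege1// ler1n.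
have h4 : u T y <= excess (u T) (level k) y + level k.
  by rewrite -lerBlDr /excess le_max lexx.
have l0 : 0 <= level k.
  by rewrite mulr_ge0 ?sqrtr_ge0// subr_ge0 invf_le1// exprn_ege1// ler1n.
have : u T y ^+ 2 <= (excess (u T) (level k) y + level k) ^+ 2.
  have uT : 0 <= u T y.
    by apply: u0; rewrite lexx andbT gerBl divr_ge0// sqr_ge0.
  by rewrite lerXn2r ?nnegrE// addr_ge0// excess_ge0.
by move/sqr_le_of_parts; apply.
Qed.

End Iteration.
End MeanValue.

(** * The heat kernel as a Poisson mixture of random walk kernels *)

Section ExponentialGeneratingFunction.
Variable R : realType.
Implicit Types (c : nat -> R) (t : R).

(** With the factorials factored out, differentiation becomes a shift of the coefficients. *)
Definition egf c t : R := limn (pseries (fun k => c k / k`!%:R) t).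

Lemma egf_cvg c t : (forall k, `|c k| <= 1) ->
  cvgn (pseries (fun k => c k / k`!%:R) t).
Proof.
move=> c1; apply: normed_cvg; apply: (series_le_cvg (v_ := exp_coeff `|t|)).
- by move=> n /=.
- by move=> n; rewrite /exp_coeff/= divr_ge0// exprn_ge0.
- move=> n; rewrite /exp_coeff/= !normrM normrX normfV normr_nat.
  rewrite -mulrA mulrC -[leRHS]mulr1 ler_pM// ?mulr_ge0 ?invr_ge0 ?exprn_ge0//.
  by rewrite mulrC.
- exact: is_cvg_series_exp_coeff.
Qed.

Lemma egf_scale c a t : (forall k, `|c k| <= 1) ->
  egf (fun k => a * c k) t = a * egf c t.
Proof.
move=> c1; rewrite /egf; apply/cvg_lim => //.
rewrite (_ : pseries _ t = (fun n => a * pseries (fun k => c k / k`!%:R) t n)); last first.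
  apply/funext => n; rewrite /pseries /series/= mulr_sumr.
  by apply: eq_bigr => i _; rewrite !mulrA.
by apply: cvgM; [exact: cvg_cst|exact: egf_cvg].
Qed.

Lemma egf_sum (I : eqType) (r : seq I) (c : I -> nat -> R) (a : I -> R) t :
  (forall i k, `|c i k| <= 1) ->
  egf (fun k => \sum_(i <- r) a i * c i k) t = \sum_(i <- r) a i * egf (c i) t.
Proof.
move=> c1; rewrite /egf; apply/cvg_lim => //.
rewrite (_ : pseries _ t = (fun n => \sum_(i <- r) a i *
   pseries (fun k => c i k / k`!%:R) t n)); last first.
  apply/funext => n; rewrite /pseries /series/=.
  under [RHS]eq_bigr do rewrite mulr_sumr.
  rewrite exchange_big; apply: eq_bigr => k _ /=.
  by rewrite -mulrA mulr_suml; apply: eq_bigr => i _; rewrite -!mulrA.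
elim: r => [|i r IH].
  rewrite big_nil (_ : (fun n => _) = cst 0); first exact: cvg_cst.
  by apply/funext => n; rewrite big_nil.
rewrite big_cons (_ : (fun n => _) = (fun n => a i * pseries (fun k => c i k / k`!%:R) t n)
   \+ (fun n => \sum_(j <- r) a j * pseries (fun k => c j k / k`!%:R) t n)).
  by apply: cvgD => //; apply: cvgM; [exact: cvg_cst|exact: egf_cvg].
by apply/funext => n; rewrite big_cons.
Qed.

Lemma ler_egf c c' t : (forall k, `|c k| <= 1) -> (forall k, `|c' k| <= 1) ->
  0 <= t -> (forall k, c k <= c' k) -> egf c t <= egf c' t.
Proof.
move=> c1 c'1 t0 cc'; apply: ler_lim; [exact: egf_cvg|exact: egf_cvg|].
apply: nearW => n; apply: ler_sum => k _.
by rewrite ler_wpM2r ?exprn_ge0// ler_wpM2r ?invr_ge0.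
Qed.

Lemma egf1 t : egf (fun=> 1) t = expR t.
Proof.
rewrite /egf /expR; congr (limn (series _)).
by apply/funext => k; rewrite /exp_coeff/= mul1r mulrC.
Qed.

Lemma egf0 t : egf (fun=> 0) t = 0.
Proof.
have n1 (k : nat) : `|1 : R| <= 1 by rewrite normr1.
rewrite (_ : (fun=> 0) = (fun k : nat => 0 * (fun=> 1) k)).
  by rewrite (egf_scale _ _ n1) mul0r.
by apply/funext => k; rewrite mul0r.
Qed.

Lemma egf_at0 c : egf c 0 = c 0%N.
Proof.
rewrite /egf; apply: lim_near_cst => //; near=> n.
have n0 : (0 < n)%N by near: n; exact: nbhs_infty_gt.
rewrite /pseries /series/= big_ltn// big_nat big1 ?addr0.
  by rewrite expr0 fact0 invr1 !mulr1.
by move=> i /andP[i0 _]; rewrite expr0n gtn_eqF// mulr0.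
Unshelve. all: by end_near. Qed.

Lemma is_derive_egf c t : (forall k, `|c k| <= 1) ->
  is_derive t 1 (egf c) (egf (fun k => c k.+1) t).
Proof.
move=> c1.
have D (e : nat -> R) : pseries_diffs (fun k => e k / k`!%:R) =
    (fun k => e k.+1 / k`!%:R).
  apply/funext => k; rewrite /pseries_diffs factS natrM; field.
  by rewrite -(natrD _ 1) !pnatr_eq0 -lt0n fact_gt0.
have := @pseries_snd_diffs R (fun k => c k / k`!%:R) (`|t| + 1) t.
rewrite !D; apply.
- exact: egf_cvg.
- by apply: (egf_cvg (c := fun k => c k.+1)).
- by apply: (egf_cvg (c := fun k => c k.+2)).
- by rewrite [ltRHS]ger0_norm ?ltrDl// addr_ge0.
Qed.

End ExponentialGeneratingFunction.

Section PoissonKernel.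
Variables (V : choiceType) (adj : rel V) (R : realType) (omega : V -> V -> R).
Hypotheses (Gadj : infinite_graph adj) (Comega : conductances adj omega).
Local Notation mu := (mu_w adj omega).
Local Notation L := (generator adj omega).

Definition jump (x z : V) : R := omega x z / mu x.

Lemma jump_ge0 x z : 0 <= jump x z.
Proof. by rewrite divr_ge0 ?(omega_ge0 Comega) ?(mu_ge0 Gadj Comega). Qed.

Lemma mu_jump x z : mu x * jump x z = omega x z.
Proof. by rewrite mulrC divfK// gt_eqF// (mu_gt0 Gadj Comega). Qed.

Lemma sum_jump (W : seq V) x : uniq W -> (forall y, adj x y -> y \in W) ->
  \sum_(z <- W) jump x z = 1.
Proof.
move=> uW xW; rewrite -mulr_suml -(mu_sum Comega uW xW) divff//.
by rewrite gt_eqF// (mu_gt0 Gadj Comega).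
Qed.

Lemma jumpE (f : V -> R) (W : seq V) x : uniq W -> (forall y, adj x y -> y \in W) ->
  f x + L f x = \sum_(z <- W) jump x z * f z.
Proof.
move=> uW xW; rewrite (generator_sum Comega f uW xW) mulr_sumr.
rewrite -[X in X + _]mul1r -(sum_jump uW xW) mulr_suml -big_split.
by apply: eq_bigr => z _; rewrite /jump/=; ring.
Qed.

(* The [k]-step transition probability from [x] to [y]; note the order of the
   arguments. *)
Definition jumps (k : nat) (y x : V) : R :=
  iter k (fun f x => f x + L f x) (fun x => (x == y)%:R) x.

Arguments jumps : simpl never.

Lemma jumpsS k y x : jumps k.+1 y x = \sum_(z <- ball_seq adj x 1) jump x z * jumps k y z.
Proof.
rewrite /jumps iterS; apply: jumpE; first exact: ball_seq_uniq.
by move=> z xz; exact: adj_in_ball.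
Qed.

Lemma jumps_ge0 k y x : 0 <= jumps k y x.
Proof.
elim: k x => [|k IH] x; first by rewrite /jumps/= ler0n.
by rewrite jumpsS sumr_ge0// => z _; rewrite mulr_ge0// jump_ge0.
Qed.

Lemma sum_jumps_le1 (F : seq V) k x : uniq F -> \sum_(y <- F) jumps k y x <= 1.
Proof.
move=> uF; elim: k x => [|k IH] x.
  rewrite /jumps/=.
  have [xF|xF] := boolP (x \in F).
    rewrite (bigD1_seq x)//= eqxx big1 ?addr0// => y /negPf.
    by rewrite eq_sym => ->.
  rewrite big_seq big1// => y yF; case: eqP => // xy.
  by move: xF; rewrite xy yF.
under eq_bigr do rewrite jumpsS.
rewrite exchange_big/= -(@sum_jump (ball_seq adj x 1) x); first last.
- by move=> z xz; exact: adj_in_ball.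
- exact: ball_seq_uniq.
apply: ler_sum => z _; rewrite -mulr_sumr -[leRHS]mulr1.
by rewrite ler_wpM2l ?jump_ge0.
Qed.

Lemma jumps_norm k y x : `|jumps k y x| <= 1.
Proof.
rewrite ger0_norm ?jumps_ge0//.
by have := @sum_jumps_le1 [:: y] k x erefl; rewrite big_seq1.
Qed.

Lemma ball1P x z : z \notin ball_seq adj x 1 -> omega x z = 0 /\ omega z x = 0.
Proof.
move=> nz; have nxz : ~~ adj x z by apply: contra nz => /(adj_in_ball Gadj).
by rewrite (omega_sym Comega z x) (omega_eq0 Comega nxz).
Qed.

Lemma sum_ball1 (F : V -> R) (W : seq V) x : uniq W -> {subset ball_seq adj x 1 <= W} ->
  (forall z, omega x z = 0 -> F z = 0) ->
  \sum_(z <- ball_seq adj x 1) F z = \sum_(z <- W) F z.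
Proof.
move=> uW xW F0; apply: sum_uniq_supp => //; first exact: ball_seq_uniq.
move=> z Fz; have zB : z \in ball_seq adj x 1.
  by apply: contra_neqT Fz => /ball1P[oz _]; exact: F0.
by rewrite zB xW.
Qed.

(** Decomposition at the last step instead of the first, by exchanging sums; the induction for
    symmetry needs both. *)
Lemma jumpsSr k y x :
  jumps k.+1 y x = \sum_(z <- ball_seq adj y 1) jumps k z x * jump z y.
Proof.
elim: k x => [|k IH] x.
  rewrite jumpsS /jumps/=.
  pose W := undup (ball_seq adj x 1 ++ ball_seq adj y 1 ++ [:: x; y]).
  have uW : uniq W by exact: undup_uniq.
  rewrite (@sum_ball1 _ W x)//; first last.
  - by move=> z oz; rewrite /jump oz !mul0r.
  - by move=> z zB; rewrite mem_undup mem_cat zB.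
  rewrite (@sum_ball1 _ W y)//; first last.
  - by move=> z oz; rewrite /jump (omega_sym Comega) oz mul0r mulr0.
  - by move=> z zB; rewrite mem_undup !mem_cat zB orbT.
  have xW : x \in W by rewrite mem_undup !mem_cat !inE eqxx !orbT.
  have yW : y \in W by rewrite mem_undup !mem_cat !inE eqxx !orbT.
  rewrite (bigD1_seq y)//= eqxx mulr1 big1 ?addr0; last first.
    by move=> z /negPf ->; rewrite mulr0.
  rewrite (bigD1_seq x)//= eqxx mul1r big1 ?addr0// => z /negPf.
  by rewrite eq_sym => ->; rewrite mul0r.
rewrite jumpsS; under eq_bigr do rewrite IH mulr_sumr.
rewrite exchange_big/=; apply: eq_bigr => z _.
by rewrite jumpsS mulr_suml; apply: eq_bigr => w _; rewrite mulrA.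
Qed.

(** Detailed balance: one side is expanded at its first step, the other at its last. *)
Lemma jumps_sym k x y : mu x * jumps k y x = mu y * jumps k x y.
Proof.
elim: k x y => [|k IH] x y.
  by rewrite /jumps/= eq_sym; case: eqP => [->//|_]; rewrite !mulr0.
rewrite jumpsS jumpsSr !mulr_sumr; apply: eq_bigr => z _.
by rewrite mulrA mu_jump (omega_sym Comega) -(mu_jump z x) mulrAC IH mulrA.
Qed.

(** The kernel of e^(t L) = e^(-t) e^(t P), where P = 1 + L averages over one jump; the number of
    jumps by time t is Poisson with mean t. *)
Definition poisson_kernel (t : R) (x y : V) : R :=
  expR (- t) * egf (fun k => jumps k y x) t.

Local Notation p := poisson_kernel.

Lemma poisson_kernel_ge0 t x y : 0 <= t -> 0 <= p t x y.
Proof.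
move=> t0; rewrite mulr_ge0 ?expR_ge0// -(egf0 t); apply: ler_egf => //.
- by move=> k; rewrite normr0.
- by move=> k; exact: jumps_norm.
- by move=> k; exact: jumps_ge0.
Qed.

Lemma sum_poisson_kernel_le1 (F : seq V) t x : uniq F -> 0 <= t ->
  \sum_(y <- F) p t x y <= 1.
Proof.
move=> uF t0; rewrite -mulr_sumr expRN ler_pdivrMl ?expR_gt0// mulr1 -egf1.
rewrite (eq_bigr (fun y => 1 * egf (fun k => jumps k y x) t)); last first.
  by move=> y _; rewrite mul1r.
rewrite -egf_sum; last by move=> y k; exact: jumps_norm.
have sE k : \sum_(y <- F) 1 * jumps k y x = \sum_(y <- F) jumps k y x.
  by apply: eq_bigr => y _; rewrite mul1r.
apply: ler_egf => // k; rewrite ?normr1// sE; last exact: sum_jumps_le1.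
by rewrite ger0_norm ?sum_jumps_le1// sumr_ge0// => y _; exact: jumps_ge0.
Qed.

Lemma poisson_kernel_le1 t x y : 0 <= t -> p t x y <= 1.
Proof.
by move=> t0; have := @sum_poisson_kernel_le1 [:: y] t x erefl t0; rewrite big_seq1.
Qed.

Lemma poisson_kernel_sym t x y : mu x * p t x y = mu y * p t y x.
Proof.
have E a b : mu a * p t a b = expR (- t) * egf (fun k => mu a * jumps k b a) t.
  by rewrite mulrCA egf_scale// => k; exact: jumps_norm.
by rewrite !E; congr (_ * egf _ t); apply/funext => k; exact: jumps_sym.
Qed.

Lemma poisson_kernel0 x y : p 0 x y = (x == y)%:R.
Proof. by rewrite /p oppr0 expR0 mul1r egf_at0. Qed.

Lemma is_derive_poisson_kernel (t : R) x y :
  is_derive t 1 (fun t => p t x y) (L (fun x => p t x y) x).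
Proof.
have uB : uniq (ball_seq adj x 1) by exact: ball_seq_uniq.
have xB z : adj x z -> z \in ball_seq adj x 1 by exact: adj_in_ball.
have := is_derive_egf t (fun k => jumps_norm k y x) => ?.
apply: is_derive_eq.
rewrite -[RHS](addrK (p t x y)) [L _ _ + _]addrC (jumpE _ uB xB).
rewrite (_ : (fun k => jumps k.+1 y x) =
   (fun k => \sum_(z <- ball_seq adj x 1) jump x z * jumps k y z)); last first.
  by apply/funext => k; rewrite jumpsS.
rewrite egf_sum; last by move=> z k; exact: jumps_norm.
rewrite /GRing.scale/= mulr_sumr; congr (_ + _); last by rewrite /p; ring.
by apply: eq_bigr => z _; rewrite /p mulrCA.
Qed.

Lemma generator_norm_le (f : V -> R) M x : (forall z, `|f z| <= M) ->
  `|L f x| <= 2 * M.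
Proof.
move=> fM.
have uB : uniq (ball_seq adj x 1) by exact: ball_seq_uniq.
have xB z : adj x z -> z \in ball_seq adj x 1 by exact: adj_in_ball.
rewrite -[L f x](addKr (f x)) (jumpE _ uB xB) addrC.
apply: (le_trans (ler_normB _ _)); rewrite mulr2n mulrDl mul1r lerD//.
apply: (le_trans (ler_norm_sum _ _ _)); rewrite -[leRHS]mul1r -(sum_jump uB xB) mulr_suml.
by apply: ler_sum => z _; rewrite normrM (ger0_norm (jump_ge0 _ _)) ler_wpM2l ?jump_ge0.
Qed.

End PoissonKernel.

(** The arithmetic closing [heat_kernelE]: [P0], [P1] are transition probabilities of the walk at
    times t and t + h, [K0], [K1] those of the Poisson kernel. [S1] is the Chapman-Kolmogorov sum
    over a finite set, and [S2] the mass of that set at time h. *)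
Lemma increment_algebra (R : realType) (P1 P0 K1 K0 S1 S2 LP LK h e : R) :
  `|K1 - K0 - h * LK| <= h * (4 * h) -> `|S1 - P0 - h * LP| <= h * (e / 4) ->
  `|S2 - 1| <= h * (e / 4) -> 0 <= P1 - S1 -> P1 - S1 <= 1 - S2 ->
  h * (4 * h) <= h * (e / 2) ->
  `|P1 - K1 - (P0 - K0) - h * (LP - LK)| <= h * e.
Proof.
rewrite !ler_norml => /andP[? ?] /andP[? ?] /andP[? ?] ? ? ?.
by apply/andP; split; lra.
Qed.

(** * Identification of the heat kernel *)

Section BackwardUniqueness.
Variables (V : choiceType) (adj : rel V) (R : realType) (omega : V -> V -> R).
Hypotheses (Gadj : infinite_graph adj) (Comega : conductances adj omega).
Local Notation L := (generator adj omega).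

Variable u : R -> V -> R.
Hypotheses (u1 : forall t x, 0 <= t -> `|u t x| <= 1) (u0 : forall x, u 0 x = 0)
  (du : forall x e, 0 < e -> exists2 del : R, 0 < del & forall t h,
     0 <= t -> 0 < h <= del -> `|u (t + h) x - u t x - h * L (u t) x| <= h * e).

(* [L] has norm at most 2 on bounded functions, so on a time interval of length 1/4
   the supremum of [u] is at most half of itself. *)
Let halve (a M : R) : 0 <= a -> (forall x, u a x = 0) ->
  (forall s x, a <= s <= a + 4^-1 -> `|u s x| <= M) ->
  forall s x, a <= s <= a + 4^-1 -> `|u s x| <= M / 2.
Proof.
move=> a0 ua uM s x /andP[as_ s4].
have aI : a <= a <= a + 4^-1 by apply/andP; split; lra.
have M0 : 0 <= M by exact: le_trans (normr_ge0 _) (uM a x aI).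
apply/ler_addgt0Pr => e e0.
have [del del0 hdel] := du x e0.
(* Enough equal steps from [a] to [s] for the one-sided increment estimate to apply to each of
   them. *)
have [n n0 hn] : exists2 n : nat, (0 < n)%N & (s - a) / n%:R <= del.
  exists (Num.truncn ((s - a) / del)).+1 => //.
  rewrite ler_pdivrMr ?ltr0n// mulrC -ler_pdivrMr//.
  by rewrite ltW// truncnS_gt.
have nR : 0 < n%:R :> R by rewrite ltr0n.
have [sa|sa] := eqVneq s a.
  by rewrite sa ua normr0 addr_ge0 ?divr_ge0// ltW.
have sa0 : 0 < s - a by rewrite subr_gt0 lt_neqAle eq_sym sa.
set h := (s - a) / n%:R in hn.
have h0 : 0 < h by rewrite divr_gt0.
have hs : n%:R * h = s - a by rewrite mulrC divfK// gt_eqF.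
have key k : (k <= n)%N -> `|u (a + k%:R * h) x| <= k%:R * (h * (2 * M + e)).
  elim: k => [|k IH] kn; first by rewrite !mul0r addr0 ua normr0.
  have kh : k%:R * h <= s - a by rewrite -hs ler_wpM2r ?(ltW h0)// ler_nat ltnW.
  have kh0 : 0 <= k%:R * h by rewrite mulr_ge0// ltW.
  rewrite -natr1 [in X in u X]mulrDl mul1r addrA.
  have a1 : 0 <= a + k%:R * h by rewrite addr_ge0.
  have := hdel (a + k%:R * h) h a1; rewrite h0 hn => /(_ isT) hd.
  have Lu : `|L (u (a + k%:R * h)) x| <= 2 * M.
    apply: (generator_norm_le Gadj Comega) => z; apply: uM.
    by apply/andP; split; lra.
  have IHk := IH (ltnW kn).
  set U := u (_ + h) x in hd *; set U' := u _ x in hd IHk *; set LL := L _ x in hd Lu *.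
  have -> : U = U' + (U - U' - h * LL) + h * LL by ring.
  apply: (le_trans (ler_normD _ _)).
  have : `|h * LL| <= h * (2 * M) by rewrite normrM gtr0_norm// ler_wpM2l// ltW.
  have := ler_normD U' (U - U' - h * LL).
  rewrite mulrDl mul1r [h * (_ + _)]mulrDr; lra.
have := key n (leqnn n); rewrite hs addrC subrK => /le_trans; apply.
rewrite mulrA hs.
have : (s - a) * (2 * M + e) <= 4^-1 * (2 * M + e).
  by rewrite ler_wpM2r ?addr_ge0 ?mulr_ge0 ?(ltW e0)//; lra.
lra.
Qed.

Let vanish_step (a : R) : 0 <= a -> (forall x, u a x = 0) ->
  forall s x, a <= s <= a + 4^-1 -> u s x = 0.
Proof.
move=> a0 ua.
have all_k (k : nat) : forall s x, a <= s <= a + 4^-1 -> `|u s x| <= (2^-1) ^+ k.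
  elim: k => [|k IH] s x hs; first by rewrite expr0 u1//; case/andP: hs; lra.
  by rewrite exprSr; exact: (@halve a _ a0 ua IH s x hs).
move=> s x hs; apply/eqP; rewrite -normr_le0; apply/ler_addgt0Pr => e e0.
rewrite add0r.
have [k hk] : exists k : nat, (2^-1 : R) ^+ k <= e.
  exists (Num.truncn e^-1).+1; rewrite exprVn -[leRHS]invrK lef_pV2 ?posrE ?exprn_gt0 ?invr_gt0//.
  apply: (le_trans (ltW (truncnS_gt _))).
  by rewrite -natrX ler_nat ltnW// ltn_expl.
exact: le_trans (all_k k s x hs) hk.
Qed.

(** Increments are controlled only forward in time, but uniformly in [t]; this replaces
    differentiability in [t]. Vanishing is propagated along a grid of mesh 1/4. *)
Lemma backward_unique t x : 0 <= t -> u t x = 0.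
Proof.
move=> t0.
have grid (k : nat) : forall s x, 0 <= s <= k%:R / 4 -> u s x = 0.
  elim: k => [|k IH] s z /andP[s0 sk].
    have -> : s = 0 by apply: le_anti; rewrite s0 andbT -(mul0r 4^-1).
    exact: u0.
  have [sk'|sk'] := leP s (k%:R / 4); first by apply: IH; rewrite s0.
  have k0 : 0 <= (k%:R : R) / 4 by rewrite divr_ge0.
  apply: (@vanish_step (k%:R / 4)) => // [w|]; first by apply: IH; rewrite k0 lexx.
  by rewrite (ltW sk')/=; move: sk; rewrite -natr1; lra.
apply: (grid (Num.truncn (t * 4)).+1); rewrite t0/= ler_pdivlMr//.
by rewrite ltW// truncnS_gt.
Qed.

End BackwardUniqueness.

Section HeatKernel.
Variables (V : choiceType) (adj : rel V) (R : realType) (omega : V -> V -> R).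
Hypotheses (Gadj : infinite_graph adj) (Comega : conductances adj omega).
Local Notation mu := (mu_w adj omega).
Local Notation L := (generator adj omega).
Variables (dO : measure_display) (Omega : measurableType dO)
  (P : V -> probability Omega R) (Y : R -> Omega -> V).
Hypothesis walkY : constant_speed_walk adj omega P Y.

Let q (x : V) (A : set Omega) : R := fine (P x A).
Let p (t : R) (x y : V) : R := q x [set w | Y t w = y].

Let qE x A : measurable A -> (q x A)%:E = P x A.
Proof. by move=> mA; rewrite /q fineK// fin_num_measure. Qed.

Let mY (t : R) y : 0 <= t -> measurable [set w | Y t w = y].
Proof. exact: (csw_measurable walkY). Qed.

Let q_ge0 x A : 0 <= q x A.
Proof. by rewrite /q fine_ge0. Qed.

Let q_split x A B : measurable A -> measurable B ->
  q x A = q x (A `\` B) + q x (A `&` B).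
Proof.
move=> mA mB; apply: EFin_inj; rewrite EFinD !qE//.
- exact: measureDI.
- exact: measurableI.
- exact: measurableD.
Qed.

Let q_le x A B : measurable A -> measurable B -> A `<=` B -> q x A <= q x B.
Proof. by move=> mA mB AB; rewrite -lee_fin !qE// le_measure// inE. Qed.

Let qT x : q x setT = 1.
Proof. by apply: EFin_inj; rewrite qE// probability_setT. Qed.

Let mYn (t : R) (Z : seq V) : 0 <= t -> measurable [set w | Y t w \notin Z].
Proof.
move=> t0; elim: Z => [|z Z IH].
  by rewrite (_ : [set w | _] = setT)//; apply/seteqP; split.
rewrite (_ : [set w | _] = [set w | Y t w \notin Z] `\` [set w | Y t w = z]).
  by apply: measurableD => //; exact: mY.
apply/seteqP; split => w /=; rewrite inE negb_or.
  by move=> /andP[/eqP].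
by move=> [-> /eqP ->].
Qed.

Let q_partition x (t : R) (Z : seq V) A : 0 <= t -> uniq Z -> measurable A ->
  q x A = \sum_(z <- Z) q x (A `&` [set w | Y t w = z])
          + q x (A `&` [set w | Y t w \notin Z]).
Proof.
move=> t0 + mA; elim: Z => [|z Z IH] /=.
  by rewrite big_nil add0r => _; congr q; apply/seteqP; split => w //= [].
move=> /andP[zZ uZ]; rewrite big_cons (IH uZ) -addrA addrCA; congr (_ + _).
rewrite (q_split _ _ (mY z t0)); last by apply: measurableI => //; exact: mYn.
rewrite addrC; congr (_ + _); congr q; apply/seteqP; split => w /=.
- by move=> [[Aw nZ] /eqP nz]; rewrite inE negb_or nz.
- by move=> [Aw]; rewrite inE negb_or => /andP[/eqP nz nZ].
- by move=> [[Aw _] ->].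
- by move=> [Aw wz]; rewrite wz.
Qed.

Let p_le1 (t : R) x y : 0 <= t -> p t x y <= 1.
Proof. by move=> t0; rewrite -(qT x) q_le//; exact: mY. Qed.

(** The Markov property at time [h] with an empty list of further constraints on the past. *)
Let chapman_kolmogorov x y z (t h : R) : 0 <= t -> 0 <= h ->
  q x ([set w | Y (h + t) w = y] `&` [set w | Y h w = z]) = p h x z * p t z y.
Proof.
move=> t0 h0; apply: EFin_inj.
rewrite EFinM !qE; [|exact: mY|exact: mY|]; last first.
  by apply: measurableI; apply: mY => //; exact: addr_ge0.
have := @csw_markov _ _ _ _ _ _ _ _ walkY x z y h t [::] h0 t0 (fun c => _).
move=> /(_ (fun _ => ltac:(by []))) /= M.
have E : [set w | (forall c : R * V, c \in [::] -> Y c.1 w = c.2) /\ Y h w = z] =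
  [set w | Y h w = z] by apply/seteqP; split => w //= [].
by move: M; rewrite E setIC.
Qed.

(* Paths that at time [h] have left the finite set [Z] contribute at most their
   probability, so only finite sums over states occur. *)
Let p_increment x y (t h : R) (Z : seq V) : 0 <= t -> 0 <= h -> uniq Z ->
  0 <= p (t + h) x y - \sum_(z <- Z) p h x z * p t z y
    <= 1 - \sum_(z <- Z) p h x z.
Proof.
move=> t0 h0 uZ; rewrite [t + h]addrC /p.
have mA := mY y (addr_ge0 h0 t0).
rewrite (q_partition _ h0 uZ mA); rewrite (eq_bigr (fun z => p h x z * p t z y)) => [|z _]; last exact: chapman_kolmogorov.
rewrite addrAC subrr add0r q_ge0/=.
rewrite -(qT x) (q_partition _ h0 uZ measurableT).
have -> : \sum_(z <- Z) q x (setT `&` [set w | Y h w = z]) =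
    \sum_(z <- Z) q x [set w | Y h w = z].
  by apply: eq_bigr => z _; rewrite setTI.
rewrite addrAC subrr add0r q_le//.
- by apply: measurableI => //; exact: mYn.
- by apply: measurableI => //; exact: mYn.
- by move=> w [].
Qed.

Let p_generator x z (e : R) : 0 < e -> exists2 del : R, 0 < del & forall h : R,
  0 < h <= del ->
  `|p h x z - (x == z)%:R - h * L (fun x => (x == z)%:R) x| <= h * e.
Proof.
move=> e0.
have bf : exists M : R, forall x : V, `|(x == z)%:R : R| <= M.
  by exists 1 => w; rewrite normr_nat lern1 leq_b1.
have /cvgrPdist_le/(_ e e0) [del/= del0 hdel] := @csw_generator _ _ _ _ _ _ _ _ walkY (fun x => (x == z)%:R) bf x.
exists (del / 2); first by rewrite divr_gt0.
move=> h /andP[h0 hd].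
have := hdel h; rewrite /= sub0r normrN gtr0_norm// => /(_ _ h0) H.
have {}H := H (ltac:(lra)).
have E : fine 'E_(P x)[(fun x : V => (x == z)%:R : R) \o Y h] = p h x z.
  rewrite /p /q -(expectation_indic (P x) (mY z (ltW h0))); congr (fine 'E_(P x)[_]).
  apply/funext => w; rewrite /= indicE; congr (_%:R); congr nat_of_bool.
  by apply/eqP/idP => [h1|]; rewrite inE.
rewrite E distrC in H.
have -> : p h x z - (x == z)%:R - h * L (fun x => (x == z)%:R) x =
  h * ((p h x z - (x == z)%:R) / h - L (fun x => (x == z)%:R) x).
  by field; rewrite gt_eqF.
by rewrite normrM gtr0_norm// ler_wpM2l// ltW.
Qed.

Let p_generator_seq x (Z : seq V) (e : R) : 0 < e -> exists2 del : R, 0 < del & forall (h : R) z,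
  0 < h <= del -> z \in Z ->
  `|p h x z - (x == z)%:R - h * L (fun x => (x == z)%:R) x| <= h * e.
Proof.
move=> e0; elim: Z => [|z Z [d1 d10 h1]]; first by exists 1.
have [d2 d20 h2] := p_generator x z e0.
exists (Num.min d1 d2); first by rewrite lt_min d10.
move=> h z' /andP[h0]; rewrite le_min => /andP[hd1 hd2].
rewrite inE => /orP[/eqP ->|zZ]; first by apply: h2; rewrite h0.
by apply: h1 => //; rewrite h0.
Qed.

(** The law of the walk is differentiated one target state at a time; this recovers [L f] from the
    indicators. *)
Let generator_delta (f : V -> R) x :
  L f x = \sum_(z <- ball_seq adj x 1) L (fun x => (x == z)%:R) x * f z.
Proof.
have uB : uniq (ball_seq adj x 1) by exact: ball_seq_uniq.
have xB z : adj x z -> z \in ball_seq adj x 1 by exact: adj_in_ball.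
have xx : x \in ball_seq adj x 1 by rewrite mem_ball_seq// gdistxx.
have E (g : V -> R) : L g x = \sum_(z <- ball_seq adj x 1) jump adj omega x z * g z - g x.
  by rewrite -(jumpE Gadj Comega g uB xB) addrC addKr.
have D z : z \in ball_seq adj x 1 ->
    L (fun x => (x == z)%:R) x = jump adj omega x z - (x == z)%:R.
  move=> zB; rewrite E (bigD1_seq z)//= eqxx mulr1 big1 ?addr0// => w /negPf ->.
  by rewrite mulr0.
have -> : \sum_(z <- ball_seq adj x 1) L (fun x => (x == z)%:R) x * f z =
    \sum_(z <- ball_seq adj x 1) (jump adj omega x z * f z - (x == z)%:R * f z).
  by apply: eq_big_seq => z zB; rewrite D// mulrBl.
rewrite E.
rewrite sumrB; congr (_ - _); rewrite (bigD1_seq x)//= eqxx mul1r big1 ?addr0// => w.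
by rewrite eq_sym => /negPf ->; rewrite mul0r.
Qed.

(** The mean value theorem twice: [L] has norm at most 2 and the kernel is at most 1, so the second
    derivative is at most 4. The bound is uniform in [t], as [backward_unique] requires. *)
Let poisson_increment x y (t h : R) : 0 <= t -> 0 < h ->
  `|poisson_kernel adj omega (t + h) x y - poisson_kernel adj omega t x y
    - h * L (fun x => poisson_kernel adj omega t x y) x| <= h * (4 * h).
Proof.
move=> t0 h0; set k := poisson_kernel adj omega.
have dk (s : R) z : is_derive s 1 (fun s => k s z y) (L (fun x => k s x y) z).
  exact: is_derive_poisson_kernel.
have inc z (s : R) : t < s -> exists2 r, t <= r <= s & k s z y - k t z y = (s - t) * L (fun x => k r x y) z.
  move=> ts.
  have cont : {within `[t, s], continuous (fun s => k s z y)}.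
    by apply: derivable_within_continuous => r _; have [] := dk r z.
  have [r] := @MVT R (fun s => k s z y) (fun s => L (fun x => k s x y) z) t s ts
    (fun r _ => dk r z) cont.
  by rewrite in_itv/= => /andP[tr rs] ->; exists r; rewrite 1?mulrC// !ltW.
have kn (r : R) z : t <= r -> `|k r z y| <= 1.
  move=> tr; have r0 : 0 <= r by apply: le_trans tr.
  by rewrite ger0_norm ?poisson_kernel_le1// poisson_kernel_ge0.
have [r /andP[tr rth] ->] := inc x (t + h) (ltac:(lra)).
rewrite [t + h - t]addrAC subrr add0r -mulrBr normrM gtr0_norm// ler_wpM2l ?(ltW h0)//.
have LB (f g : V -> R) : L f x - L g x = L (fun z => f z - g z) x.
  rewrite (generator_delta f) (generator_delta g) (generator_delta (fun z => f z - g z)).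
  by rewrite -sumrB; apply: eq_bigr => z _; rewrite mulrBr.
rewrite LB (_ : 4 * h = 2 * (2 * h)); last by ring.
apply: (generator_norm_le Gadj Comega) => z.
have [->|rt] := eqVneq r t; first by rewrite subrr normr0; lra.
have tr' : t < r by rewrite lt_neqAle eq_sym rt.
have [r' /andP[tr'' _] ->] := inc z r tr'.
rewrite normrM gtr0_norm ?subr_gt0// mulrC ler_pM//; last lra.
  by rewrite subr_ge0.
have := @generator_norm_le _ _ _ _ Gadj Comega (fun x => k r' x y) 1 z (fun w => kn r' w tr'').
by rewrite mulr1.
Qed.

Let p0E x y : p 0 x y = (x == y)%:R.
Proof.
have p1 : p 0 x x = 1.
  by rewrite /p; apply: EFin_inj; rewrite qE ?(csw_start walkY)//; exact: mY.
case: eqVneq => [<-//|xy]; apply/eqP; rewrite eq_le q_ge0 andbT.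
have z0 : q x (setT `\` [set w | Y 0 w = x]) = 0.
  have := q_split x measurableT (mY x (lexx 0)); rewrite setTI qT -/(p 0 x x) p1.
  by move=> h; lra.
rewrite -[leRHS]z0; apply: q_le; [exact: mY|apply: measurableD => //; exact: mY|].
by move=> w /= wy; split => //; rewrite wy => /esym/eqP; apply/negP.
Qed.

(** The difference of the two kernels starts from 0 and solves the backward equation. Up to o(h), a
    walk from [z] is still in the ball of radius 1 at time [h], so finite sums suffice. *)
Lemma heat_kernelE t x y : 0 <= t ->
  heat_kernel adj omega P Y t x y = poisson_kernel adj omega t x y / mu y.
Proof.
move=> t0; rewrite /heat_kernel; congr (_ / _); apply/eqP; rewrite -subr_eq0; apply/eqP.
pose k := poisson_kernel adj omega.
apply: (@backward_unique V adj R omega Gadj Comega (fun t x => p t x y - k t x y)) => //.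
- move=> s z s0; have := p_le1 z y s0; have : 0 <= p s z y by exact: q_ge0.
  have := poisson_kernel_ge0 Gadj Comega z y s0.
  have := poisson_kernel_le1 Gadj Comega z y s0.
  by rewrite ler_norml -/k => *; apply/andP; split; lra.
- by move=> z; rewrite p0E /k poisson_kernel0 subrr.
move=> z e e0; set Z := ball_seq adj z 1.
have uZ : uniq Z by exact: ball_seq_uniq.
pose n : R := (size Z)%:R + 1.
have n0 : 0 < n by rewrite ltr_wpDl.
have e1 : 0 < e / (4 * n) by rewrite divr_gt0// mulr_gt0.
have [d d0 hd] := p_generator_seq z Z e1.
exists (Num.min d (e / 8)); first by rewrite lt_min d0 divr_gt0.
move=> s h s0 /andP[h0]; rewrite le_min => /andP[hhd h8].
have kB := poisson_increment z y s0 h0.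
pose err w := p h z w - (z == w)%:R - h * L (fun x => (x == w)%:R) z.
have errB w : w \in Z -> `|err w| <= h * (e / (4 * n)).
  by move=> wZ; apply: hd => //; rewrite h0.
have sumB (f : V -> R) : (forall w, `|f w| <= 1) ->
    `|\sum_(w <- Z) p h z w * f w - f z - h * L f z| <= h * (e / 4).
  move=> f1.
  have zZ : z \in Z by rewrite mem_ball_seq// gdistxx.
  have -> : \sum_(w <- Z) p h z w * f w - f z - h * L f z = \sum_(w <- Z) err w * f w.
    rewrite generator_delta mulr_sumr.
    have -> : f z = \sum_(w <- Z) (z == w)%:R * f w.
      rewrite (bigD1_seq z)//= eqxx mul1r big1 ?addr0// => w.
      by rewrite eq_sym => /negPf ->; rewrite mul0r.
    by rewrite -!sumrB; apply: eq_bigr => w _; rewrite /err; ring.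
  apply: (le_trans (ler_norm_sum _ _ _)).
  apply: (@le_trans _ _ (\sum_(w <- Z) h * (e / (4 * n)))).
    rewrite big_seq [leRHS]big_seq; apply: ler_sum => w wZ.
    by rewrite normrM -[leRHS]mulr1 ler_pM// errB.
  rewrite big_const_seq count_predT iter_addr_0.
  have -> : (h * (e / (4 * n))) *+ size Z = h * (e / 4) * ((size Z)%:R / n).
    by rewrite -mulr_natr; field; rewrite gt_eqF.
  rewrite ler_piMr ?mulr_ge0 ?divr_ge0 ?(ltW h0) ?(ltW e0)//.
  by rewrite ler_pdivrMr// mul1r lerDl.
have /andP[r0 r1] := p_increment z y s0 (ltW h0) uZ.
have c1 : forall w : V, `|1 : R| <= 1 by move=> w; rewrite normr1.
(* The constant function 1 measures the mass that has left [Z] by time [h]; the kernel at time [s]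
   gives the main term. *)
have := sumB (fun=> 1) c1.
have L1 : L (fun=> 1) z = 0.
  rewrite /generator fsbig1 ?mulr0// => w _; by rewrite subrr mulr0.
rewrite L1 mulr0 subr0; under eq_bigr do rewrite mulr1.
have := sumB (fun w => p s w y) (fun w => _).
have pn w : `|p s w y| <= 1 by rewrite ger0_norm ?p_le1// q_ge0.
move=> /(_ pn).
have LB (f g : V -> R) : L f z - L g z = L (fun x => f x - g x) z.
  rewrite (generator_delta f) (generator_delta g) (generator_delta (fun x => f x - g x)).
  by rewrite -sumrB; apply: eq_bigr => w _; rewrite mulrBr.
have hh : h * (4 * h) <= h * (e / 2).
  rewrite ler_wpM2l ?(ltW h0)// (_ : e / 2 = 4 * (e / 8)); last by field.
  by rewrite ler_wpM2l.
by rewrite -LB => B1 B2; exact: increment_algebra kB B1 B2 r0 r1 hh.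
Qed.

End HeatKernel.

(** * Davies-Gaffney estimate *)

Section DaviesGaffney.
Variables (V : choiceType) (adj : rel V) (R : realType) (omega : V -> V -> R).
Hypotheses (Gadj : infinite_graph adj) (Comega : conductances adj omega).
Local Notation mu := (mu_w adj omega).
Local Notation L := (generator adj omega).
Local Notation dist := (gdist adj).
Local Notation p := (poisson_kernel adj omega).

Definition evolve (F : seq V) (f : V -> R) (s : R) (z : V) : R :=
  \sum_(y <- F) p s z y * f y.

Lemma evolve_caloric F f t0 t1 : caloric adj omega (evolve F f) t0 t1.
Proof.
move=> s z _.
have -> : L (evolve F f s) z = \sum_(y <- F) L (fun x => p s x y) z * f y.
  have uB : uniq (ball_seq adj z 1) by exact: ball_seq_uniq.
  have zB w : adj z w -> w \in ball_seq adj z 1 by exact: adj_in_ball.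
  rewrite (generator_sum Comega _ uB zB).
  under [RHS]eq_bigr do rewrite (generator_sum Comega _ uB zB) -mulrA.
  rewrite -mulr_sumr; congr (_ * _); under [RHS]eq_bigr do rewrite mulr_suml.
  rewrite exchange_big/=; apply: eq_bigr => w _.
  rewrite /evolve -sumrB mulr_sumr; apply: eq_bigr => y _; ring.
apply: is_derive_seq_sum => y _.
have := is_derive_poisson_kernel Gadj Comega s z y => ?.
by apply: is_derive_eq; rewrite /GRing.scale/= mulr0 add0r mulrC.
Qed.

Variables (F : seq V) (f : V -> R).
Hypotheses (uF : uniq F) (f0 : forall y, 0 <= f y).
Local Notation u := (evolve F f).

Lemma evolve_ge0 s z : 0 <= s -> 0 <= u s z.
Proof.
move=> s0; apply: sumr_ge0 => y _; rewrite mulr_ge0//.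
exact: (poisson_kernel_ge0 Gadj Comega).
Qed.

(** Jensen's inequality for the sub-probability [p s z], proved by expanding a nonnegative variance,
    followed by symmetry with respect to [mu]. *)
Lemma evolve_l2_contraction (W : seq V) s : uniq W -> 0 <= s ->
  \sum_(z <- W) u s z ^+ 2 * mu z <= \sum_(y <- F) f y ^+ 2 * mu y.
Proof.
move=> uW s0.
have p0 z y : 0 <= p s z y by exact: (poisson_kernel_ge0 Gadj Comega).
have J z : u s z ^+ 2 <= \sum_(y <- F) p s z y * f y ^+ 2.
  have S1 : \sum_(y <- F) p s z y <= 1 by exact: (sum_poisson_kernel_le1 Gadj Comega).
  have : 0 <= \sum_(y <- F) p s z y * (f y - u s z) ^+ 2.
    by apply: sumr_ge0 => y _; rewrite mulr_ge0// sqr_ge0.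
  have -> : \sum_(y <- F) p s z y * (f y - u s z) ^+ 2 =
     \sum_(y <- F) p s z y * f y ^+ 2 - 2 * u s z * u s z
     + u s z ^+ 2 * \sum_(y <- F) p s z y.
    have -> : 2 * u s z * u s z = \sum_(y <- F) 2 * u s z * (p s z y * f y).
      by rewrite -mulr_sumr.
    rewrite [X in _ + X]mulr_sumr -sumrB -big_split.
    by apply: eq_bigr => y _ /=; ring.
  have := sqr_ge0 (u s z); nra.
apply: (@le_trans _ _ (\sum_(z <- W) \sum_(y <- F) f y ^+ 2 * mu y * p s y z)).
  apply: ler_sum => z _; rewrite mulrC.
  apply: (@le_trans _ _ (mu z * \sum_(y <- F) p s z y * f y ^+ 2)).
    by rewrite ler_wpM2l// (mu_ge0 Gadj Comega).
  rewrite mulr_sumr; apply: ler_sum => y _.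
  by rewrite mulrA (poisson_kernel_sym Gadj Comega) mulrC mulrA.
rewrite exchange_big/=; apply: ler_sum => y _.
rewrite -mulr_sumr -[leRHS]mulr1 ler_wpM2l//.
  by rewrite mulr_ge0 ?sqr_ge0 ?(mu_ge0 Gadj Comega).
exact: (sum_poisson_kernel_le1 Gadj Comega).
Qed.

Variables (x y : V) (rho : nat) (lam : R).
Hypotheses (Fx : forall z, z \in F -> (dist x z <= rho)%N) (lam0 : 0 < lam).

Let m : nat := (dist x y - 2 * rho)%N.
(** Davies's weight is [ee], the exponential of [lam * g]: [g] changes by at most one along edges,
    vanishes on the ball around [x] and equals [m] on the ball around [y]. The constant [c] is 2
    (cosh lam - 1). *)
Let g (z : V) : nat := minn (dist x z - rho) m.
Let c : R := expR lam + expR (- lam) - 2.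
Let ee (z : V) : R := expR (lam * (g z)%:R).
Let n2 : R := \sum_(y <- F) f y ^+ 2 * mu y.

Let c0 : 0 < c.
Proof.
have e1 : 1 < expR lam by rewrite expR_gt1.
have e2 : expR lam * expR (- lam) = 1 by rewrite -expRD subrr expR0.
have := expR_gt0 (- lam); rewrite /c; nra.
Qed.

(** An equality when [g] changes by one: (e^lam - 1)^2 = (e^lam + e^(-lam) - 2) e^lam. *)
Let ee_edge a b : adj a b -> (ee a - ee b) ^+ 2 <= c * (ee a * ee b).
Proof.
wlog gab : a b / (g a <= g b)%N.
  move=> h; have [gab|/ltnW gba] := leqP (g a) (g b); first exact: h.
  rewrite (adj_sym Gadj) => /(h _ _ gba).
  by rewrite -sqrrN opprB [ee b * _]mulrC.
move=> ab; have d1 := gdist_adj Gadj x ab.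
have : (g b <= (g a).+1)%N by rewrite /g; lia.
rewrite leq_eqVlt => /orP[/eqP gb|gb]; last first.
  have -> : ee b = ee a by rewrite /ee; congr (expR (_ * _%:R)); lia.
  by rewrite subrr expr0n/= !mulr_ge0 ?expR_ge0// ltW.
have -> : ee b = ee a * expR lam.
  by rewrite /ee gb -natr1 mulrDr mulr1 expRD.
rewrite -(subr_ge0) /c.
have e2 : expR lam * expR (- lam) = 1 by rewrite -expRD subrr expR0.
rewrite (_ : _ - _ = 0)//.
have -> : (expR lam + expR (- lam) - 2) * (ee a * (ee a * expR lam)) =
  ee a ^+ 2 * (expR lam ^+ 2 + expR lam * expR (- lam) - 2 * expR lam) by ring.
by rewrite e2; ring.
Qed.

Let EE : R := expR (lam * m%:R).

Let ee_le z : 0 < ee z <= EE.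
Proof. by rewrite expR_gt0 ler_expR ler_wpM2l ?(ltW lam0)// ler_nat geq_minr. Qed.

(* The spatial cutoff at scale [n] avoids differentiating infinite sums; its error is
   of order [1 / n] by the [L^2] contraction. *)
Section Cutoff.
Variable n : nat.
Hypothesis n1 : (0 < n)%N.
Let W := ball_seq adj x (2 * n).
Let eta (z : V) : R := Num.max 0 (Num.min 1 (((2 * n)%:R - (dist x z)%:R) * n%:R^-1)).
Let xi (z : V) : R := eta z * ee z.
Let G (s : R) : R := \sum_(a <- W) excess (u s) 0 a ^+ 2 * (xi a ^+ 2 * mu a).

Let nR : 0 < n%:R :> R. Proof. by rewrite ltr0n. Qed.
Let eta01 z : 0 <= eta z <= 1.
Proof. by rewrite le_max lexx/= ge_max ler01/= ge_min lexx. Qed.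

Let xiW a : xi a != 0 -> forall b, adj a b -> b \in W.
Proof.
move=> xa b ab.
have da : (dist x a < 2 * n)%N.
  rewrite ltnNge; apply: contra_neqN xa => ha.
  have h1 : ((2 * n)%:R - (dist x a)%:R) * n%:R^-1 <= 0 :> R.
    by rewrite mulr_le0_ge0 ?invr_ge0// subr_le0 ler_nat.
  by rewrite /xi /eta min_r ?max_l ?mul0r// (le_trans h1).
by rewrite mem_ball_seq// (leq_trans (gdist_adj Gadj x ab)).
Qed.

Let exE s a : 0 <= s -> excess (u s) 0 a = u s a.
Proof. by move=> s0; rewrite /excess subr0 max_l// evolve_ge0. Qed.

(** A Leibniz rule splits the square into the variation of the weight and that of the cutoff. The
    latter costs slope 1 / n times the maximum of the squared weight. *)
Let xi_edge a b : adj a b -> (xi a - xi b) ^+ 2 <= c * (xi a * xi b) + EE ^+ 2 / n%:R.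
Proof.
move=> ab.
have -> : (xi a - xi b) ^+ 2 = eta a * eta b * (ee a - ee b) ^+ 2
   + (eta a - eta b) * (eta a * ee a ^+ 2 - eta b * ee b ^+ 2).
  by rewrite /xi; ring.
have /andP[a0 a1] := eta01 a; have /andP[b0 b1] := eta01 b.
have /andP[ea0 ea1] := ee_le a; have /andP[eb0 eb1] := ee_le b.
apply: lerD.
  rewrite (_ : c * _ = eta a * eta b * (c * (ee a * ee b))); last by rewrite /xi; ring.
  by rewrite ler_wpM2l ?mulr_ge0// ee_edge.
apply: (le_trans (ler_norm _)); rewrite normrM mulrC ler_pM//.
  have ha : 0 <= eta a * ee a ^+ 2 <= EE ^+ 2.
    rewrite mulr_ge0 ?sqr_ge0//= -[leRHS]mul1r ler_pM ?sqr_ge0//.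
    by rewrite lerXn2r ?nnegrE ?expR_ge0.
  have hb : 0 <= eta b * ee b ^+ 2 <= EE ^+ 2.
    rewrite mulr_ge0 ?sqr_ge0//= -[leRHS]mul1r ler_pM ?sqr_ge0//.
    by rewrite lerXn2r ?nnegrE ?expR_ge0.
  move: ha hb => /andP[? ?] /andP[? ?].
  by rewrite ler_norml; apply/andP; split; lra.
have hc := @cutoff_lip R n%:R^-1 (2 * n)%:R (dist x a) (dist x b).
rewrite -(@ler_pXn2r _ 2%N) ?nnegrE ?invr_ge0// real_normK ?num_real//.
apply: hc; first by rewrite invr_ge0.
  by apply: gdist_adj => //; rewrite (adj_sym Gadj).
exact: gdist_adj.
Qed.

(** The energy is dropped from the Caccioppoli inequality. What remains is growth at rate [c] and a
    cutoff error that the contraction bounds. At level 0 truncation does nothing, since [u] is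
    nonnegative. *)
Let G_gronwall s : 0 < s ->
  G s <= expR (c * s) * (n2 + EE ^+ 2 * n2 / n%:R / c).
Proof.
move=> s0.
have mu0 a : 0 <= mu a := mu_ge0 Gadj Comega a.
have uW : uniq W by exact: ball_seq_uniq.
have n20 : 0 <= n2 by apply: sumr_ge0 => a _; rewrite mulr_ge0 ?sqr_ge0.
set be := EE ^+ 2 * n2 / n%:R.
have be0 : 0 <= be.
  by apply: divr_ge0; [apply: mulr_ge0 => //; exact: sqr_ge0|exact: ltW].
have dG r : 0 <= r <= s -> is_derive r 1 G
    (\sum_(a <- W) 2 * excess (u r) 0 a * L (u r) a * (xi a ^+ 2 * mu a)).
  by move=> hr; apply: (is_derive_weighted_excess _ _ _ (@evolve_caloric F f 0 s) hr).
have nc0 : - c != 0 by rewrite oppr_eq0 gt_eqF.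
have dGle r : 0 <= r <= s ->
    \sum_(a <- W) 2 * excess (u r) 0 a * L (u r) a * (xi a ^+ 2 * mu a)
    <= be - - c * G r.
  move=> /andP[r0 _]; apply: (le_trans (caccioppoli Gadj Comega uW xiW (u r) 0)).
  have ex0 a : 0 <= excess (u r) 0 a := excess_ge0 (u r) 0 a.
  have T : \sum_(a <- W) \sum_(b <- W)
      omega a b * (excess (u r) 0 a * excess (u r) 0 b * (xi a - xi b) ^+ 2)
    <= \sum_(a <- W) \sum_(b <- W)
      (c * (omega a b * ((excess (u r) 0 a * xi a) * (excess (u r) 0 b * xi b)))
       + EE ^+ 2 / n%:R * (omega a b * (excess (u r) 0 a * excess (u r) 0 b))).
    apply: ler_sum => a _; apply: ler_sum => b _.
    have [ab|nab] := boolP (adj a b); last first.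
      by rewrite (omega_eq0 Comega nab) !mul0r !mulr0 addr0.
    set X := excess _ _ _; set X' := excess _ _ _.
    have -> : c * (omega a b * ((X * xi a) * (X' * xi b)))
       + EE ^+ 2 / n%:R * (omega a b * (X * X')) =
      omega a b * (X * X' * (c * (xi a * xi b) + EE ^+ 2 / n%:R)) by ring.
    rewrite ler_wpM2l ?(omega_ge0 Comega)// ler_wpM2l ?xi_edge//.
    by rewrite mulr_ge0 ?ex0.
  have SE : \sum_(a <- W) \sum_(b <- W)
      (c * (omega a b * ((excess (u r) 0 a * xi a) * (excess (u r) 0 b * xi b)))
       + EE ^+ 2 / n%:R * (omega a b * (excess (u r) 0 a * excess (u r) 0 b))) =
     c * (\sum_(a <- W) \sum_(b <- W)
        omega a b * ((excess (u r) 0 a * xi a) * (excess (u r) 0 b * xi b)))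
     + EE ^+ 2 / n%:R * (\sum_(a <- W) \sum_(b <- W)
        omega a b * (excess (u r) 0 a * excess (u r) 0 b)).
    rewrite [c * _]mulr_sumr [EE ^+ 2 / n%:R * _]mulr_sumr -big_split.
    by apply: eq_bigr => a _; rewrite !mulr_sumr -big_split.
  rewrite -[leRHS]add0r; apply: lerD; first by rewrite oppr_le0 (energy_ge0 Comega).
  apply: (le_trans T); rewrite SE addrC mulNr opprK; apply: lerD.
    rewrite /be [leRHS]mulrAC ler_wpM2l ?divr_ge0 ?sqr_ge0//.
    apply: (le_trans (sum_omega_mul_le Gadj Comega uW ex0)).
    under eq_bigr do rewrite exE//.
    exact: evolve_l2_contraction.
  rewrite ler_wpM2l ?(ltW c0)//.
  have xe0 a : 0 <= excess (u r) 0 a * xi a.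
    rewrite mulr_ge0 ?ex0// /xi; have /andP[? _] := eta01 a.
    by rewrite mulr_ge0// ltW//; case/andP: (ee_le a).
  apply: (le_trans (sum_omega_mul_le Gadj Comega uW xe0)).
  rewrite le_eqVlt; apply/orP; left; apply/eqP.
  by apply: eq_bigr => a _; rewrite exprMn mulrA.
have := linear_gronwall (ltW s0) nc0 dG dGle.
rewrite opprK subr0 invrN mulrN opprK => H.
have u0E a : u 0 a = if a \in F then f a else 0.
  rewrite /evolve; under eq_bigr do rewrite poisson_kernel0.
  case: ifPn => aF.
    rewrite (bigD1_seq a)//= eqxx mul1r big1 ?addr0// => z /negPf.
    by rewrite eq_sym => ->; rewrite mul0r.
  rewrite big_seq big1// => z zF; case: eqP => [az|_]; last by rewrite mul0r.
  by move: aF; rewrite az zF.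
(* The weight [ee] is 1 on the ball that contains [F]. *)
have G0 : G 0 <= n2.
  apply: (@le_trans _ _ (\sum_(a <- W) u 0 a ^+ 2 * mu a)); last first.
    exact: evolve_l2_contraction.
  apply: ler_sum => a _; rewrite exE// mulrA ler_wpM2r// u0E.
  case: ifPn => aF; last by rewrite expr0n/= mul0r.
  have ga : ee a = 1.
    rewrite /ee /g (_ : (dist x a - rho)%N = 0%N) ?min0n ?mulr0 ?expR0//.
    by apply/eqP; rewrite subn_eq0 Fx.
  rewrite -[leRHS]mulr1 ler_wpM2l ?sqr_ge0// /xi ga mulr1.
  by have /andP[? ?] := eta01 a; rewrite exprn_ile1.
have bc : 0 <= be / c by rewrite divr_ge0// ltW.
apply: (@le_trans _ _ (G s + be / c)); first by rewrite lerDl.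
by apply: (le_trans H); rewrite ler_wpM2l ?expR_ge0// lerD2r.
Qed.

Lemma cutoff_bound s (By : seq V) : 0 < s -> uniq By ->
  (forall z, z \in By -> (dist y z <= rho)%N) -> (dist x y + rho <= n)%N ->
  EE ^+ 2 * \sum_(z <- By) u s z ^+ 2 * mu z
    <= expR (c * s) * (n2 + EE ^+ 2 * n2 / n%:R / c).
Proof.
move=> s0 uB yB hn; apply: le_trans (G_gronwall s0).
have mu0 a : 0 <= mu a := mu_ge0 Gadj Comega a.
rewrite mulr_sumr.
have BE z : z \in By -> (dist x z <= n)%N /\ xi z = EE.
  move=> /yB zy; have t1 := gdist_triangle Gadj y x z.
  have t2 := gdist_triangle Gadj z x y; rewrite (gdistC Gadj z y) in t2.
  have dxz : (dist x z <= n)%N by lia.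
  split => //; rewrite /xi (_ : ee z = EE); last first.
    rewrite /ee /EE /g; congr (expR (_ * _%:R)); apply/minn_idPr; rewrite /m; lia.
  suff -> : eta z = 1 by rewrite mul1r.
  have h1 : 1 <= ((2 * n)%:R - (dist x z)%:R) * n%:R^-1 :> R.
    rewrite ler_pdivlMr// mul1r lerBrDr natrM mulr_natl mulr2n lerD2l.
    by rewrite ler_nat.
  by rewrite /eta min_l// max_r.
apply: (@le_trans _ _ (\sum_(z <- By) excess (u s) 0 z ^+ 2 * (xi z ^+ 2 * mu z))).
  rewrite big_seq [leRHS]big_seq; apply: ler_sum => z zB.
  by have [_ ->] := BE z zB; rewrite exE ?(ltW s0)// mulrCA.
apply: ler_sum_sub_uniq => // [z /BE[dz _]|z _].
  by rewrite mem_ball_seq// (leq_trans dz)// mul2n -addnn leq_addr.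
by rewrite mulr_ge0 ?sqr_ge0// mulr_ge0 ?sqr_ge0.
Qed.

End Cutoff.

Lemma davies_gaffney s (By : seq V) : 0 < s -> uniq By ->
  (forall z, z \in By -> (dist y z <= rho)%N) ->
  \sum_(z <- By) u s z ^+ 2 * mu z <=
  expR ((expR lam + expR (- lam) - 2) * s - 2 * lam * (dist x y - 2 * rho)%:R)
   * \sum_(z <- F) f z ^+ 2 * mu z.
Proof.
move=> s0 uB yB; rewrite -/c -/n2 -/m.
have mu0 a : 0 <= mu a := mu_ge0 Gadj Comega a.
have n20 : 0 <= n2 by apply: sumr_ge0 => a _; rewrite mulr_ge0 ?sqr_ge0.
have EE0 : 0 < EE ^+ 2 by rewrite exprn_gt0// expR_gt0.
have -> : expR (c * s - 2 * lam * m%:R) = expR (c * s) / EE ^+ 2.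
  by rewrite expRD expRN /EE -expRM_natl mulrA.
rewrite mulrAC ler_pdivlMr// mulrC.
apply/ler_addgt0Pr => e e0.
pose K := expR (c * s) * (EE ^+ 2 * n2 / c).
have K0 : 0 <= K.
  rewrite mulr_ge0 ?expR_ge0// divr_ge0 ?(ltW c0)//.
  by apply: mulr_ge0 => //; exact: ltW.
pose n := maxn (dist x y + rho).+1 (Num.truncn (K / e)).+1.
have n0 : (0 < n)%N by rewrite /n leq_max.
have hn : (dist x y + rho <= n)%N by rewrite /n; lia.
apply: (le_trans (cutoff_bound n0 s0 uB yB hn)).
rewrite mulrDr lerD2l.
have -> : expR (c * s) * (EE ^+ 2 * n2 / n%:R / c) = K / n%:R.
  by rewrite /K; field; rewrite !gt_eqF// ltr0n.
rewrite ler_pdivrMr ?ltr0n// mulrC -ler_pdivrMr//.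
apply: (le_trans (ltW (truncnS_gt _))).
by rewrite ler_nat /n leq_maxr.
Qed.

End DaviesGaffney.

(** * Choice of the exponential weight *)

Section OptimizeExponent.
Variable R : realType.
Implicit Types (x lam t D : R).

(** Absorbs the factor (1 + D / rho)^J into an exponential. *)
Lemma exprn_le_fact_expR x (J : nat) : 0 <= x -> x ^+ J <= J`!%:R * expR x.
Proof.
case: J => [|J] x0; first by rewrite expr0 fact0 mul1r -expR0 ler_expR.
rewrite mulrC -ler_pdivrMr ?ltr0n ?fact_gt0//.
by apply: le_trans (expR_ge1Dxn J x0); rewrite lerDr.
Qed.

(** The left side is e^(-lam) (e^lam - 1)^2, and e^lam - 1 <= lam e^lam. *)
Lemma cosh_sub1_le lam : 0 <= lam ->
  expR lam + expR (- lam) - 2 <= lam ^+ 2 * expR lam.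
Proof.
move=> l0; have e2 : expR lam * expR (- lam) = 1 by rewrite -expRD subrr expR0.
have e0 := expR_gt0 lam; have e0' := expR_gt0 (- lam).
have e1 := expR_ge1Dx (- lam); have e1' : 1 <= expR lam by rewrite -expR0 ler_expR.
have e3 : expR lam + expR (- lam) - 2 = expR (- lam) * (expR lam - 1) ^+ 2.
  rewrite (_ : expR (- lam) * (expR lam - 1) ^+ 2 = (expR lam * expR (- lam)) * expR lam
    - 2 * (expR lam * expR (- lam)) + expR (- lam)); last by ring.
  by rewrite e2; ring.
have e4 : expR lam - 1 <= lam * expR lam.
  rewrite (_ : 1 = expR lam * expR (- lam))// -{1}[expR lam]mulr1 -mulrBr mulrC.
  by rewrite ler_wpM2r ?(ltW e0)//; lra.
rewrite e3; apply: (@le_trans _ _ (expR (- lam) * (lam * expR lam) ^+ 2)).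
  by rewrite ler_wpM2l ?(ltW e0')// lerXn2r ?nnegrE ?mulr_ge0 ?(ltW e0)//; lra.
rewrite le_eqVlt; apply/orP; left; apply/eqP.
rewrite (_ : expR (- lam) * (lam * expR lam) ^+ 2 =
  lam ^+ 2 * expR lam * (expR lam * expR (- lam))); last by ring.
by rewrite e2 mulr1.
Qed.

Lemma expR_le2 x : x <= 2^-1 -> expR x <= 2.
Proof.
move=> x2; have := expR_ge1Dx (- x); rewrite expRN => h.
have e0 := expR_gt0 x.
have : 2^-1 <= (expR x)^-1 by apply: le_trans h; lra.
by rewrite lef_pV2 ?posrE.
Qed.

(** This is cosh lam - 1, half the Davies-Gaffney rate: the two-point estimate takes a square
    root. *)
Definition kappa lam : R := (expR lam + expR (- lam) - 2) / 2.

Lemma kappa_le lam : 0 <= lam -> kappa lam <= lam ^+ 2 * expR lam / 2.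
Proof. by move=> l0; rewrite /kappa ler_wpM2r// cosh_sub1_le. Qed.

Section Bound.
Variables (J : nat) (t : R) (rho D : nat) (h B : R).
Hypotheses (t0 : 0 < t) (rho2 : (2 <= rho)%N) (rho_t : rho%:R ^+ 2 <= t)
  (t_rho : t <= 4 * rho%:R ^+ 2) (B0 : 0 <= B)
  (hB : forall lam, 0 < lam -> h <= B * (1 + D%:R / rho%:R) ^+ J
     * expR (kappa lam * t - lam * (D - 2 * rho)%:R)).

Let rho0 : 0 < rho%:R :> R. Proof. by rewrite ltr0n (leq_trans _ rho2). Qed.
Let z : R := D%:R / rho%:R.
Let z0 : 0 <= z. Proof. by rewrite divr_ge0// ltW. Qed.
Let DE : D%:R = z * rho%:R :> R. Proof. by rewrite /z divfK// gt_eqF. Qed.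

(** With lam = 1 / rho nothing has to decay: 1 + D / rho <= 5, and t <= 4 rho^2 gives kappa lam * t
    <= 2 e. *)
Lemma near_bound : (D < 4 * rho)%N -> h <= B * (5 ^+ J * expR (2 * expR 1)).
Proof.
move=> D4; have r1 : 0 < rho%:R^-1 :> R by rewrite invr_gt0.
have rle : rho%:R^-1 <= 1 :> R by rewrite invf_le1// ler1n (leq_trans _ rho2).
apply: (le_trans (hB r1)); rewrite -mulrA ler_wpM2l//.
have zle : z <= 4.
  by rewrite /z ler_pdivrMr// -natrM ler_nat ltnW.
rewrite ler_pM ?expR_ge0 ?exprn_ge0 ?addr_ge0//.
  by rewrite lerXn2r ?nnegrE ?addr_ge0//; move: zle; rewrite /z; lra.
rewrite ler_expR; apply: (@le_trans _ _ (kappa rho%:R^-1 * t)).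
  by rewrite gerBl mulr_ge0// ltW.
have e1 : expR rho%:R^-1 <= expR 1 :> R by rewrite ler_expR.
have k1 := kappa_le (ltW r1).
have e0 := expR_gt0 (1 : R).
have k2 : kappa rho%:R^-1 <= (rho%:R^-1 ^+ 2) * expR 1 / 2.
  apply: (le_trans k1); rewrite ler_wpM2r// ler_wpM2l// sqr_ge0//.
apply: (@le_trans _ _ ((rho%:R^-1 ^+ 2) * expR 1 / 2 * (4 * rho%:R ^+ 2))).
  apply: (@le_trans _ _ ((rho%:R^-1 ^+ 2) * expR 1 / 2 * t)).
    by rewrite ler_wpM2r// ltW.
  by rewrite ler_wpM2l// divr_ge0// mulr_ge0 ?sqr_ge0 ?(ltW e0).
rewrite le_eqVlt; apply/orP; left; apply/eqP; field.
by rewrite gt_eqF.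
Qed.

Let far_m : (4 * rho <= D)%N -> D%:R / 2 <= (D - 2 * rho)%:R :> R.
Proof.
move=> D4; rewrite natrB; last by apply: leq_trans D4; rewrite leq_mul2r orbT.
by move: D4; rewrite -(ler_nat R) !natrM; lra.
Qed.

(** Take lam = D / (8 t) and X = D^2 / t. The growth costs at most X / 64 and the distance gains at
    least X / 16. Of the net 3 X / 64 one third is kept; the rest, at least (D / rho)^2 / 128,
    absorbs the polynomial at the price of e^65. *)
Lemma far_bound_gauss : (4 * rho <= D)%N -> D%:R <= t ->
  h <= B * (J`!%:R * expR 65) * expR (- (D%:R ^+ 2 / (64 * t))).
Proof.
move=> D4 Dt; have D0 : 0 < D%:R :> R.
  by rewrite ltr0n (leq_trans _ D4)// muln_gt0/= (leq_trans _ rho2).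
pose lam := D%:R / (8 * t).
have l0 : 0 < lam by rewrite divr_gt0// mulr_gt0.
have l1 : lam <= 2^-1 by rewrite /lam ler_pdivrMr ?mulr_gt0//; lra.
apply: (le_trans (hB l0)).
rewrite -[leLHS]mulrA -[leRHS]mulrA; apply: (ler_wpM2l B0).
have lt : lam * t = D%:R / 8 by rewrite /lam; field; rewrite gt_eqF.
have lD : lam * D%:R = D%:R ^+ 2 / t / 8 by rewrite /lam; field; rewrite gt_eqF.
have kt : kappa lam * t <= lam * D%:R / 8.
  apply: (@le_trans _ _ (lam ^+ 2 * t)).
    rewrite ler_wpM2r ?(ltW t0)//; apply: (le_trans (kappa_le (ltW l0))).
    rewrite ler_pdivrMr// ler_wpM2l ?sqr_ge0//; exact: expR_le2.
  by rewrite expr2 -mulrA lt mulrA.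
have lm : lam * (D%:R / 2) <= lam * (D - 2 * rho)%:R.
  by rewrite ler_wpM2l ?(ltW l0)// far_m.
have X0 : z ^+ 2 / 4 <= D%:R ^+ 2 / t.
  have z2 : 0 <= z ^+ 2 / 4 by rewrite divr_ge0 ?sqr_ge0.
  have := ler_wpM2l z2 t_rho; rewrite ler_pdivlMr// => /le_trans; apply.
  by rewrite [in leRHS]DE le_eqVlt; apply/orP; left; apply/eqP; field.
have XE : D%:R ^+ 2 / (64 * t) = D%:R ^+ 2 / t / 64 by field; rewrite gt_eqF.
apply: (@le_trans _ _ (J`!%:R * expR (1 + z) * expR (- (3 * (D%:R ^+ 2 / t) / 64)))).
  rewrite ler_pM ?expR_ge0 ?exprn_ge0 ?addr_ge0//.
    by apply: exprn_le_fact_expR; rewrite addr_ge0.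
  by rewrite ler_expR; lra.
rewrite XE -[leLHS]mulrA -[leRHS]mulrA ler_wpM2l// -!expRD ler_expR.
have := sqr_ge0 (z / 16 - 8); nra.
Qed.

(** Take lam = M / 8. By [key] the growth costs at most half of the gain lam D / 2, leaving D M /
    32. The polynomial is rescaled by 128 so that absorbing it uses only part of this. *)
Lemma far_bound_poisson : (4 * rho <= D)%N -> t <= D%:R ->
  h <= B * (128 ^+ J * J`!%:R * expR 1) *
    expR (- (D%:R * Num.max 1 (ln (D%:R / t)) / 64)).
Proof.
move=> D4 tD; have D0 : 0 < D%:R :> R.
  by rewrite ltr0n (leq_trans _ D4)// muln_gt0/= (leq_trans _ rho2).
set M := Num.max _ _.
have Dt1 : 1 <= D%:R / t by rewrite ler_pdivlMr// mul1r.
have L0 : 0 <= ln (D%:R / t) by exact: ln_ge0.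
have M1 : 1 <= M by rewrite le_max lexx.
pose lam := M / 8.
have l0 : 0 < lam by rewrite divr_gt0//; lra.
apply: (le_trans (hB l0)).
rewrite -[leLHS]mulrA -[leRHS]mulrA; apply: (ler_wpM2l B0).
have key : M * expR (M / 8) <= 4 * (D%:R / t).
  have Dte : D%:R / t = expR (ln (D%:R / t)) by rewrite lnK// posrE divr_gt0.
  rewrite /M; have [h1|h1] := leP (ln (D%:R / t)) 1.
    have : expR (1 / 8) <= (2 : R) by apply: expR_le2; lra.
    by rewrite mul1r; lra.
  rewrite {3}Dte; set l := ln _ in h1 L0 *.
  have h2 : l / 2 <= expR (l / 2) by have := expR_ge1Dx (l / 2); lra.
  apply: (@le_trans _ _ (2 * expR (l / 2) * expR (l / 8))).
    by rewrite ler_wpM2r ?expR_ge0//; lra.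
  rewrite -mulrA -expRD.
  have : expR (l / 2 + l / 8) <= expR l by rewrite ler_expR; lra.
  have := expR_gt0 l; lra.
have kt : kappa lam * t <= lam * D%:R / 4.
  apply: (@le_trans _ _ (lam ^+ 2 * expR lam / 2 * t)).
    by rewrite ler_wpM2r ?(ltW t0)// kappa_le// ltW.
  have -> : lam ^+ 2 * expR lam / 2 * t = lam / 16 * (M * expR (M / 8)) * t.
    by rewrite /lam; field.
  have -> : lam * D%:R / 4 = lam / 16 * (4 * (D%:R / t)) * t.
    by field; rewrite gt_eqF.
  by rewrite ler_wpM2r ?(ltW t0)// ler_wpM2l// ltW// divr_gt0.
have lm : lam * (D%:R / 2) <= lam * (D - 2 * rho)%:R.
  by rewrite ler_wpM2l ?(ltW l0)// far_m.
have zD : z <= D%:R.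
  by rewrite /z ler_pdivrMr// ler_peMr ?(ltW D0)// ler1n (leq_trans _ rho2).
have DM : D%:R <= D%:R * M by rewrite ler_peMr// ltW.
have lDM : lam * D%:R = D%:R * M / 8 by rewrite /lam; field.
apply: (@le_trans _ _ (128 ^+ J * J`!%:R * expR ((1 + D%:R) / 128) * expR (- (D%:R * M / 32)))).
  rewrite ler_pM ?expR_ge0 ?exprn_ge0 ?addr_ge0//; last by rewrite ler_expR; lra.
  apply: (@le_trans _ _ ((1 + D%:R) ^+ J)).
    by rewrite lerXn2r ?nnegrE ?addr_ge0// lerD2l.
  have -> : (1 + D%:R : R) = 128 * ((1 + D%:R) / 128) by field.
  rewrite exprMn -mulrA ler_wpM2l ?exprn_ge0//.
  rewrite [128 * _]mulrC divfK//; apply: exprn_le_fact_expR.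
  by rewrite divr_ge0// addr_ge0.
rewrite -[leLHS]mulrA -[leRHS]mulrA ler_wpM2l ?mulr_ge0 ?exprn_ge0//.
by rewrite -!expRD ler_expR; lra.
Qed.

End Bound.
End OptimizeExponent.

(** * The two-point estimate *)

Section Integrability.
Variable R : realType.

(* An exponent [+oo] may be replaced by any finite one. *)
Definition exponent_below (p : \bar R) (r : R) : Prop := p = r%:E \/ p = +oo%E.

(** The strict inequality leaves a gap: one infinite exponent is replaced by a finite one whose
    inverse is half the gap, two infinite ones by 4 / a each. *)
Lemma finite_exponents (p q : \bar R) (a : R) : (1 < p)%E -> (1 < q)%E ->
  0 < a <= 1 -> (p^-1 + q^-1 < a%:E)%E ->
  exists p0 q0 : R, [/\ exponent_below p p0, exponent_below q q0, 1 < p0, 1 < q0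
    & p0^-1 + q0^-1 < a].
Proof.
have Vr (r : R) : 1 < r -> (r%:E^-1)%E = r^-1%:E.
  by move=> r1; rewrite inver gt_eqF// (lt_trans ltr01).
have key (r : R) : 1 < r -> r^-1 < a -> a <= 1 ->
    exists2 q0 : R, 1 < q0 & r^-1 + q0^-1 < a.
  move=> r1 ra a1; have rV : 0 < r^-1 by rewrite invr_gt0 (lt_trans ltr01).
  exists (2 / (a - r^-1)); last by rewrite invf_div; lra.
  by rewrite ltr_pdivlMr ?subr_gt0//; lra.
case: p => [p| |]; case: q => [q| |] // p1 q1 /andP[a0 a1].
- rewrite !Vr// -EFinD lte_fin => pq.
  by exists p, q; split=> //; left.
- rewrite Vr// invey adde0 lte_fin => pa.
  by have [q0 q01 pq0] := key p p1 pa a1; exists p, q0; split=> //; [left|right].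
- rewrite Vr// invey add0e lte_fin => qa.
  have [p0 p01 pq0] := key q q1 qa a1; exists p0, q.
  by rewrite addrC; split=> //; [right|left].
- move=> _; have r1 : 1 < 4 / a by rewrite ltr_pdivlMr//; lra.
  exists (4 / a), (4 / a); split=> //; [by right|by right|].
  by rewrite invf_div; lra.
Qed.

Variables (V : choiceType) (adj : rel V).
Hypothesis Gadj : infinite_graph adj.

Lemma avg_norm_sum (p : \bar R) (r : R) x n (f : V -> R) (M c : R) :
  exponent_below p r -> 1 < r -> (forall y, 0 <= f y) -> 0 <= M ->
  (size (ball_seq adj x n))%:R <= c ->
  avg_norm p (gball adj x n) f <= M ->
  \sum_(y <- ball_seq adj x n) f y `^ r <= c * M `^ r.
Proof.
move=> pr r1 f0 M0 hc; have r0 : 0 < r by apply: lt_trans r1.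
have card0 : 0 < (size (ball_seq adj x n))%:R :> R.
  rewrite ltr0n lt0n size_eq0; apply/eqP => b0.
  by have := mem_ball_seq Gadj x n x; rewrite b0 gdistxx.
case: pr => -> /=.
  rewrite card_ball_seq sum_ball_seq//; set S := \sum_(_ <- _) _ => h.
  have SE : S = \sum_(y <- ball_seq adj x n) f y `^ r.
    by apply: eq_bigr => y _; rewrite ger0_norm.
  have S0 : 0 <= S by apply: sumr_ge0 => y _; exact: powR_ge0.
  have : (size (ball_seq adj x n))%:R^-1 * S <= M `^ r.
    have -> : (size (ball_seq adj x n))%:R^-1 * S =
        (((size (ball_seq adj x n))%:R^-1 * S) `^ r^-1) `^ r.
      rewrite -powRrM mulVf ?gt_eqF// powRr1// mulr_ge0// invr_ge0 ltW//.
    by apply: ge0_ler_powR; rewrite ?nnegrE ?powR_ge0 ?(ltW r0).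
  rewrite ler_pdivrMl// -SE => /le_trans; apply.
  by rewrite ler_wpM2r ?powR_ge0.
move=> h; apply: (@le_trans _ _ (\sum_(y <- ball_seq adj x n) M `^ r)).
  rewrite big_seq [leRHS]big_seq; apply: ler_sum => y yB.
  apply: ge0_ler_powR; rewrite ?nnegrE ?(ltW r0)//; apply: le_trans h.
  rewrite -[f y]ger0_norm//.
  exact: (@Order.TotalTheory.le_bigmax_seq _ _ _ _ 0 y xpredT (fun y => `|f y|)).
rewrite big_const_seq count_predT iter_addr_0 -mulr_natl.
by rewrite ler_wpM2r ?powR_ge0.
Qed.

Lemma norm_threshold_le (p : \bar R) (f : V -> R) (N : V -> nat) (m : R) x n :
  ereal_sup (range (limsup_norm adj p f)) = m%:E ->
  norm_threshold adj p f N -> (N x <= n)%N ->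
  avg_norm p (gball adj x n) f <= 2 * m.
Proof.
move=> supm thr Nn; rewrite -lee_fin.
apply: (@le_trans _ _ (2%:E * limsup_norm adj p f x)%E).
  apply: le_trans (thr x); apply: ereal_sup_ubound.
  by exists n.
rewrite EFinM; apply: lee_wpmul2l; first by rewrite lee_fin.
by rewrite -supm; apply: ereal_sup_ubound; exists x.
Qed.

End Integrability.

(** * Mean value inequality in terms of the ratio of radii *)

Section NormalizedMeanValue.
Variables (R : realType) (V : choiceType) (adj : rel V) (omega : V -> V -> R).
Hypotheses (Gadj : infinite_graph adj) (Comega : conductances adj omega).
Local Notation mu := (mu_w adj omega).
Local Notation nu := (nu_w adj omega).
Local Notation dist := (gdist adj).

Definition mean_value_const (C th Kn : R) (J : nat) : R :=
  2 * ((288 * C * 2 ^+ J) `^ th^-1 + 16 ^+ J * (1 + Kn)).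

Lemma mean_value_const_gt0 C th Kn J : 0 < C -> 0 < Kn ->
  0 < mean_value_const C th Kn J.
Proof.
move=> C0 Kn0; have c288 : 0 < 288 :> R by rewrite ltr0n.
apply: mulr_gt0; first exact: ltr0n; apply: addr_gt0; last first.
  by apply: mulr_gt0; [exact: exprn_gt0|exact: addr_gt0].
by apply: powR_gt0; apply: mulr_gt0; [exact: mulr_gt0|exact: exprn_gt0].
Qed.

Variables (d q C th Kn : R) (J : nat) (x y : V) (n rho : nat).
Hypotheses (d2 : 2 <= d) (q1 : 1 < q) (C0 : 0 < C) (th0 : 0 < th) (th1 : th <= 1)
  (Kn0 : 0 < Kn) (J4 : 4 / th + 2 * d <= J%:R)
  (FK : faber_krahn_on adj omega (gball adj x n) (C * n%:R ^+ 2) (n%:R `^ d) th)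
  (nuq : \sum_(z <- ball_seq adj x n) nu z `^ q <= Kn * n%:R `^ d)
  (rho1 : (0 < rho)%N) (hn : (dist x y + rho <= n)%N).

(** All powers of n / rho are absorbed by J: the De Giorgi level contributes 2 / th, and the
    single-vertex term needs 2 d to compensate rho^d n^d. *)
Lemma normalized_mean_value (u : R -> V -> R) (T sigma : R) :
  caloric adj omega u (T - rho%:R ^+ 2 / 4) T ->
  (forall s a, T - rho%:R ^+ 2 / 4 <= s <= T -> 0 <= u s a) -> 0 < sigma ->
  (forall s, T - rho%:R ^+ 2 / 4 <= s <= T ->
     \sum_(a <- ball_seq adj y rho) u s a ^+ 2 * mu a <= sigma) ->
  u T y ^+ 2 <= mean_value_const C th Kn J * sigma * rho%:R `^ (- d)
    * (n%:R / rho%:R) ^+ J.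
Proof.
move=> cu u0 s0 us.
have d0 : 0 <= d by exact: le_trans d2.
have Jth : 4 <= J%:R * th.
  by rewrite -ler_pdivrMr//; apply: le_trans J4; rewrite lerDl mulr_ge0.
have n0 : (0 < n)%N by apply: leq_trans hn; rewrite addn_gt0 rho1 orbT.
have nR : 0 < n%:R :> R by rewrite ltr0n.
have rR : 0 < rho%:R :> R by rewrite ltr0n.
set N : R := n%:R `^ d; have N0 : 0 < N by exact: powR_gt0.
have yB z : (dist y z <= rho)%N -> gball adj x n z.
  move=> zy; change (dist x z <= n)%N; apply: leq_trans hn.
  by apply: leq_trans (gdist_triangle Gadj y x z) _; rewrite leq_add2l; exact: zy.
have := de_giorgi_mean_value Gadj Comega FK C0 N0 th0 th1 Jth rho1 nR yB cu u0 s0 us.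
move=> /le_trans; apply.
set r := n%:R / rho%:R.
have r1 : 1 <= r by rewrite ler_pdivlMr// mul1r ler_nat (leq_trans _ hn)// leq_addl.
have r0 : 0 < r by apply: lt_le_trans r1.
set rd := rho%:R `^ (- d).
have rd0 : 0 < rd by exact: powR_gt0.
have n1 : 1 <= n%:R :> R by rewrite ler1n.
have NrdE : N = r `^ d / rd.
  by rewrite /rd powRN invrK -powRM ?(ltW r0) ?(ltW rR)// /r divfK// gt_eqF.
have dJ : 2 * d <= J%:R.
  by apply: le_trans J4; rewrite lerDr divr_ge0// (ltW th0).
have T1 : (288 * C * r ^+ 2 * 2 ^+ J) `^ th^-1 / N <=
    (288 * C * 2 ^+ J) `^ th^-1 * rd * r ^+ J.
  have K0 : 0 <= 288 * C * 2 ^+ J.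
    have c288 : 0 <= 288 :> R by rewrite ler0n.
    by apply: mulr_ge0; [apply: mulr_ge0 => //; exact: ltW|exact: exprn_ge0].
  have -> : 288 * C * r ^+ 2 * 2 ^+ J = (288 * C * 2 ^+ J) * r ^+ 2 by ring.
  move: (288 * C * 2 ^+ J) K0 => K K0; rewrite (powRM _ K0 (sqr_ge0 r)).
  rewrite -!mulrA ler_wpM2l ?powR_ge0// mulrC.
  apply: ler_pM; [by rewrite invr_ge0 ltW|exact: powR_ge0| |].
    rewrite NrdE invfM invrK ler_piMl ?(ltW rd0)// invf_le1 ?powR_gt0//.
    by rewrite -(powRr0 r) ler_powR//; apply: le_trans d2.
  rewrite -powR_mulrn ?(ltW r0)// -powRrM -powR_mulrn ?(ltW r0)// ler_powR//.
  apply: le_trans J4; rewrite -[leLHS]addr0 lerD//.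
    by rewrite ler_wpM2r ?invr_ge0 ?(ltW th0)// ler_nat.
  by rewrite mulr_ge0//; apply: le_trans d2.
(* 1 / mu y <= nu y, and nu y is either at most 1 or at most its power [q], a single term of the sum
   over the ball. *)
have muV : (mu y)^-1 <= (1 + Kn) * N.
  have mu0 := mu_gt0 Gadj Comega y.
  apply: (@le_trans _ _ (nu y)).
    by rewrite -div1r ler_pdivrMr// mulrC (mu_nu_ge1 Gadj Comega).
  have nu0 := nu_ge0 Gadj Comega y.
  have nuN : nu y `^ q <= Kn * N.
    apply: le_trans nuq; rewrite (bigD1_seq y) ?ball_seq_uniq//=; last first.
      by rewrite mem_ball_seq// (leq_trans _ hn)// leq_addr.
    by rewrite lerDl sumr_ge0// => z _; exact: powR_ge0.
  have N1 : 1 <= N by rewrite -(powRr0 n%:R) ler_powR//; apply: le_trans d2.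
  rewrite mulrDl mul1r; have [nu1|/ltW nu1] := leP (nu y) 1.
    apply: (le_trans nu1); apply: (le_trans N1).
    by rewrite lerDl mulr_ge0 ?(ltW Kn0) ?(ltW N0).
  apply: (@le_trans _ _ (nu y `^ q)); first by apply: le1r_powR => //; exact: ltW.
  by apply: (le_trans nuN); rewrite lerDr ltW.
have T2 : (16 / rho%:R) ^+ J / mu y <= 16 ^+ J * (1 + Kn) * rd * r ^+ J.
  rewrite exprMn -!mulrA ler_wpM2l ?exprn_ge0//.
  apply: (@le_trans _ _ ((rho%:R^-1) ^+ J * ((1 + Kn) * N))).
    by rewrite ler_wpM2l ?exprn_ge0 ?invr_ge0.
  rewrite mulrCA ler_wpM2l ?addr_ge0 ?(ltW Kn0)//.
  have rdE : rd * rho%:R `^ d = 1 by rewrite /rd powRN mulVf// gt_eqF// powR_gt0.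
  have -> : r ^+ J = rho%:R^-1 ^+ J * n%:R ^+ J by rewrite /r exprMn mulrC.
  rewrite mulrCA ler_wpM2l ?exprn_ge0 ?invr_ge0//.
  rewrite -(ler_pM2l (powR_gt0 d rR)) mulrA [_ * rd]mulrC rdE mul1r.
  apply: (@le_trans _ _ (n%:R `^ d * N)).
    rewrite ler_wpM2r ?(ltW N0)//; apply: ge0_ler_powR; rewrite ?nnegrE//.
    by rewrite ler_nat (leq_trans _ hn)// leq_addl.
  rewrite -powRD ?(gt_eqF nR) ?implybT// -powR_mulrn// ler_powR//.
  by move: dJ; lra.
have := ler_wpM2l (_ : 0 <= 2 * sigma) (lerD T1 T2).
move=> /(_ (mulr_ge0 (ler0n _ 2) (ltW s0))) /le_trans; apply.
by rewrite /mean_value_const le_eqVlt; apply/orP; left; apply/eqP; ring.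
Qed.

End NormalizedMeanValue.

(** * Self-improving two-point estimate *)

Section TwoPointBound.
Variables (R : realType) (V : choiceType) (adj : rel V) (omega : V -> V -> R).
Hypotheses (Gadj : infinite_graph adj) (Comega : conductances adj omega).
Local Notation mu := (mu_w adj omega).
Local Notation nu := (nu_w adj omega).
Local Notation dist := (gdist adj).
Local Notation p := (poisson_kernel adj omega).

Variables (d q C th Kn : R) (J : nat) (x y : V) (rho : nat).
Hypotheses (d2 : 2 <= d) (q1 : 1 < q) (C0 : 0 < C) (th0 : 0 < th) (th1 : th <= 1)
  (Kn0 : 0 < Kn) (J4 : 4 / th + 2 * d <= J%:R) (rho1 : (0 < rho)%N)
  (FK : forall n, (rho <= n)%N ->
     faber_krahn_on adj omega (gball adj x n) (C * n%:R ^+ 2) (n%:R `^ d) th)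
  (nuq : forall n, (rho <= n)%N ->
     \sum_(z <- ball_seq adj x n) nu z `^ q <= Kn * n%:R `^ d).

Lemma two_point_bound (t lam : R) : rho%:R ^+ 2 <= t -> 0 < lam ->
  p t x y / mu y <= mean_value_const C th Kn J * rho%:R `^ (- d)
    * (1 + (dist x y)%:R / rho%:R) ^+ J
    * expR (kappa lam * t - lam * (dist x y - 2 * rho)%:R).
Proof.
move=> rt lam0.
have A0 := mean_value_const_gt0 th J C0 Kn0.
set A := mean_value_const _ _ _ _ in A0 *.
have rR : 0 < rho%:R :> R by rewrite ltr0n.
set rd := rho%:R `^ (- d); have rd0 : 0 < rd by exact: powR_gt0.
set r := 1 + _ / _.
have r1 : 1 <= r by rewrite lerDl divr_ge0// ltW.
have rJ1 : 1 <= r ^+ J by exact: exprn_ege1.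
set m : R := (dist x y - 2 * rho)%:R.
set X := expR (kappa lam * t - lam * m).
have X0 : 0 < X by exact: expR_gt0.
have rho20 : 0 < rho%:R ^+ 2 :> R by exact: exprn_gt0.
set tau : R := rho%:R ^+ 2 / 4.
have tau0 : 0 < tau by rewrite divr_gt0.
(* Both mean value inequalities go back in time by [tau]; together they stay above t / 2. *)
have tau4 : tau <= t / 4 by rewrite ler_wpM2r.
have c0 : 0 <= expR lam + expR (- lam) - 2.
  have e2 : expR lam * expR (- lam) = 1 by rewrite -expRD subrr expR0.
  have h1 := expR_gt0 lam; have h2 := expR_gt0 (- lam).
  have := sqr_ge0 (expR lam - expR (- lam)); nra.
have X2 : expR ((expR lam + expR (- lam) - 2) * t - 2 * lam * m) = X ^+ 2.
  by rewrite /X -expRM_natl; congr expR; rewrite /kappa; field.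
have mu0 z : 0 < mu z := mu_gt0 Gadj Comega z.
pose u := evolve adj omega [:: y] (fun=> (mu y)^-1).
have uE s z : u s z = p s z y / mu y by rewrite /u /evolve big_seq1.
have u0 s z : 0 <= s -> 0 <= u s z.
  by move=> s0; rewrite uE divr_ge0 ?(ltW (mu0 y))// (poisson_kernel_ge0 Gadj Comega).
pose S s := \sum_(z <- ball_seq adj x rho) u s z ^+ 2 * mu z.
have S0 s : 0 <= S s.
  by apply: sumr_ge0 => z _; rewrite mulr_ge0 ?sqr_ge0 ?(ltW (mu0 z)).
have uB : uniq (ball_seq adj x rho) by exact: ball_seq_uniq.
have rE : r = (dist x y + rho)%:R / rho%:R.
  by rewrite /r natrD; field; rewrite gt_eqF.
have bound0 : 0 < A * rd * r ^+ J * X ^+ 2.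
  apply: mulr_gt0; last exact: exprn_gt0.
  by apply: mulr_gt0; [exact: mulr_gt0|exact: lt_le_trans rJ1].
have key s : t - tau <= s <= t -> S s <= A * rd * r ^+ J * X ^+ 2.
  move=> /andP[ts st].
  have s0 : 0 < s by lra.
  have stau0 : 0 < s - tau by lra.
  (* The bound [sigma] in the mean value inequality must be positive; here it is [X ^+ 2 * S s]. *)
  have [Sz|Snz] := eqVneq (S s) 0.
    by rewrite Sz ltW.
  have Sp : 0 < S s by rewrite lt_neqAle eq_sym Snz S0.
  pose w := evolve adj omega (ball_seq adj x rho) (u s).
  have us0 z : 0 <= u s z by apply: u0; exact: ltW.
  have wE : w s y = S s.
    apply: eq_bigr => z _; rewrite uE.
    have -> : p s y z = mu z * p s z y / mu y.
      by rewrite (poisson_kernel_sym Gadj Comega) mulrC mulKf// gt_eqF.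
    by field; rewrite gt_eqF.
  have sig0 : 0 < X ^+ 2 * S s by rewrite mulr_gt0// exprn_gt0.
  have hw l : s - tau <= l <= s ->
      \sum_(z <- ball_seq adj y rho) w l z ^+ 2 * mu z <= X ^+ 2 * S s.
    move=> /andP[l1 l2]; have l0 : 0 < l by lra.
    have Fx z : z \in ball_seq adj x rho -> (dist x z <= rho)%N.
      by rewrite mem_ball_seq.
    have Fy z : z \in ball_seq adj y rho -> (dist y z <= rho)%N.
      by rewrite mem_ball_seq.
    apply: (le_trans (davies_gaffney Gadj Comega uB us0 Fx lam0 l0
      (ball_seq_uniq adj y rho) Fy)).
    rewrite -X2; apply: ler_wpM2r; first exact: S0.
    rewrite ler_expR; apply: lerB => //; apply: ler_wpM2l => //; lra.
  have hn : (rho <= dist x y + rho)%N by exact: leq_addl.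
  have := normalized_mean_value Gadj Comega d2 q1 C0 th0 th1 Kn0 J4 (FK hn) (nuq hn)
    rho1 (leqnn _) (@evolve_caloric V adj R omega Gadj Comega _ _ _ _) _ sig0 hw.
  rewrite -/A -/rd -rE -/w wE => H.
  have {}H : S s ^+ 2 <= A * (X ^+ 2 * S s) * rd * r ^+ J.
    apply: H => l z /andP[l1 _]; apply: (evolve_ge0 Gadj Comega) => //; lra.
  rewrite -(ler_pM2r Sp) -expr2; apply: (le_trans H).
  by rewrite le_eqVlt; apply/orP; left; apply/eqP; ring.
have xx : (dist x x + rho <= rho)%N by rewrite gdistxx.
have := normalized_mean_value Gadj Comega d2 q1 C0 th0 th1 Kn0 J4 (FK (leqnn _))
  (nuq (leqnn _)) rho1 xx (@evolve_caloric V adj R omega Gadj Comega _ _ _ _) _ bound0 key.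
rewrite -/A -/rd -/u divff ?gt_eqF// expr1n mulr1 => H.
have {}H : u t x ^+ 2 <= A * (A * rd * r ^+ J * X ^+ 2) * rd.
  apply: H => l z /andP[l1 _]; apply: u0; lra.
rewrite -uE -(@ler_pXn2r _ 2%N)//; first last.
- rewrite nnegrE; apply: mulr_ge0; last exact: ltW.
  by apply: mulr_ge0; [apply: mulr_ge0; exact: ltW|exact: le_trans rJ1].
- by rewrite nnegrE u0//; lra.
apply: (le_trans H).
(* The argument yields the power J / 2 of [r]; since 1 <= r it is enlarged to J. *)
have -> : A * (A * rd * r ^+ J * X ^+ 2) * rd = (A * rd * X) ^+ 2 * r ^+ J by ring.
have -> : (A * rd * r ^+ J * X) ^+ 2 = (A * rd * X) ^+ 2 * (r ^+ J) ^+ 2 by ring.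
by rewrite ler_wpM2l ?sqr_ge0// expr2 ler_peMr//; lra.
Qed.

End TwoPointBound.

(** * Both regimes with a common constant *)

Lemma ball_scale_le (R : realType) (d t : R) (rho : nat) : 0 <= d -> (0 < rho)%N ->
  0 < t -> t <= 4 * rho%:R ^+ 2 ->
  rho%:R `^ (- d) <= 2 `^ d * t `^ (- (d / 2)).
Proof.
move=> d0 rho0 t0 ht; have rR : 0 < rho%:R :> R by rewrite ltr0n.
have h : t `^ (d / 2) <= 2 `^ d * rho%:R `^ d.
  rewrite -powRM ?(ltW rR)//.
  have -> : (2 * rho%:R) `^ d = ((2 * rho%:R) ^+ 2) `^ (d / 2) :> R.
    by rewrite -powR_mulrn ?mulr_ge0 ?(ltW rR)// -powRrM; congr powR; field.
  apply: ge0_ler_powR; rewrite ?nnegrE ?sqr_ge0 ?(ltW t0)//.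
    by rewrite divr_ge0.
  by rewrite exprMn (_ : 2 ^+ 2 = 4)// expr2; lra.
rewrite !powRN ler_pdivlMr ?powR_gt0// mulrC ler_pdivrMr ?powR_gt0//.
Qed.

Section ReducedBound.
Variables (R : realType) (J : nat).

(** One summand for each of the three regimes; the extra [expR 1] in the first pays for an
    exponential e^(-e) with e <= 1. *)
Definition shape_const : R :=
  5 ^+ J * expR (2 * expR 1) * expR 1 + J`!%:R * expR 65 + 128 ^+ J * J`!%:R * expR 1.

Let s1 : 0 <= 5 ^+ J * expR (2 * expR 1) :> R.
Proof. by apply: mulr_ge0; [exact: exprn_ge0|exact: expR_ge0]. Qed.
Let s2 : 0 <= J`!%:R * expR 65 :> R.
Proof. by apply: mulr_ge0 => //; exact: expR_ge0. Qed.
Let s3 : 0 <= 128 ^+ J * J`!%:R * expR 1 :> R.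
Proof.
by apply: mulr_ge0; [apply: mulr_ge0 => //; exact: exprn_ge0|exact: expR_ge0].
Qed.

Lemma shape_const_gt0 : 0 < shape_const.
Proof.
apply: ltr_wpDr => //; apply: ltr_wpDr => //.
Qed.

Let near_le (e : R) : e <= 1 -> 5 ^+ J * expR (2 * expR 1) <= shape_const * expR (- e).
Proof.
move=> e1; have h : 1 <= expR 1 * expR (- e).
  by rewrite -expRD -[X in X <= _]expR0 ler_expR; lra.
apply: (@le_trans _ _ (5 ^+ J * expR (2 * expR 1) * (expR 1 * expR (- e)))).
  by rewrite ler_peMr.
rewrite mulrA ler_wpM2r ?expR_ge0// /shape_const -addrA lerDl.
exact: addr_ge0.
Qed.

Variables (t : R) (rho D : nat) (h B : R).
Hypotheses (t0 : 0 < t) (rho2 : (2 <= rho)%N) (rho_t : rho%:R ^+ 2 <= t)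
  (t_rho : t <= 4 * rho%:R ^+ 2) (B0 : 0 <= B)
  (hB : forall lam, 0 < lam -> h <= B * (1 + D%:R / rho%:R) ^+ J
     * expR (kappa lam * t - lam * (D - 2 * rho)%:R)).

Lemma gauss_bound : D%:R <= t ->
  h <= B * shape_const * expR (- (D%:R ^+ 2 / (64 * t))).
Proof.
move=> Dt; have [D4|D4] := leqP (4 * rho) D.
  apply: (le_trans (far_bound_gauss t0 rho2 t_rho B0 hB D4 Dt)).
  rewrite ler_wpM2r ?expR_ge0// ler_wpM2l// /shape_const.
  rewrite -[leLHS]add0r -[leLHS]addr0; apply: lerD => //; apply: lerD => //.
apply: (le_trans (near_bound t0 rho2 t_rho B0 hB D4)).
rewrite -mulrA ler_wpM2l//; apply: near_le.
rewrite ler_pdivrMr ?mulr_gt0// mul1r.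
have : D%:R <= 4 * rho%:R :> R by rewrite -natrM ler_nat ltnW.
move=> h1; have : D%:R ^+ 2 <= (4 * rho%:R) ^+ 2 :> R.
  by rewrite lerXn2r ?nnegrE ?mulr_ge0.
rewrite exprMn (_ : 4 ^+ 2 = 16) => [|]; last by rewrite expr2; ring.
by move: t0 rho_t; lra.
Qed.

(** If D < 4 rho, then rho^2 <= t <= D forces D <= 16, and 4 <= t bounds the logarithmic factor by
    4. The exponent is then at most 16 * 4 / 64 = 1, and [near_bound] suffices. *)
Lemma poisson_bound : t <= D%:R ->
  h <= B * shape_const * expR (- (D%:R * Num.max 1 (ln (D%:R / t)) / 64)).
Proof.
move=> tD; have D0 : 0 < D%:R :> R by exact: lt_le_trans tD.
have [D4|D4] := leqP (4 * rho) D.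
  apply: (le_trans (far_bound_poisson t0 rho2 B0 hB D4 tD)).
  rewrite ler_wpM2r ?expR_ge0// ler_wpM2l// /shape_const.
  rewrite lerDr; apply: addr_ge0 => //.
apply: (le_trans (near_bound t0 rho2 t_rho B0 hB D4)).
rewrite -mulrA ler_wpM2l//; apply: near_le.
have r2 : 2 <= rho%:R :> R by rewrite ler_nat.
have D4R : D%:R <= 4 * rho%:R :> R by rewrite -natrM ler_nat ltnW.
have D16 : D%:R <= 16 :> R.
  have : D%:R ^+ 2 <= 16 * D%:R :> R.
    apply: (@le_trans _ _ ((4 * rho%:R) ^+ 2)); first by rewrite lerXn2r ?nnegrE ?mulr_ge0.
    rewrite exprMn (_ : 4 ^+ 2 = 16) => [|]; last by rewrite expr2; ring.
    by move: rho_t; lra.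
  by rewrite expr2 ler_pM2r.
have t4 : 4 <= t.
  apply: le_trans rho_t; rewrite (_ : 4 = 2 ^+ 2); last by rewrite expr2; ring.
  by rewrite lerXn2r ?nnegrE.
have q4 : D%:R / t <= 4 by rewrite ler_pdivrMr//; lra.
have l4 : ln (D%:R / t) <= 4.
  have dt : 0 < D%:R / t by rewrite divr_gt0.
  have := expR_ge1Dx (ln (D%:R / t)); rewrite lnK ?posrE//; lra.
have M4 : Num.max 1 (ln (D%:R / t)) <= 4 by rewrite ge_max l4 andbT ler1n.
rewrite ler_pdivrMr// mul1r; apply: (@le_trans _ _ (16 * 4)).
  by rewrite ler_pM// ?le_max ?ler01.
by rewrite -natrM.
Qed.

End ReducedBound.

(** * Assembly of the constants *)

Theorem theorem1p6 (R : realType) (d d' Creg CS : R) (p q : \bar R)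
    (mubar nubar : R) :
  2 <= d -> d <= d' -> 0 < Creg -> 0 < CS ->
  (1 < p)%E -> (1 < q)%E -> (p^-1 + q^-1 < (2 / d')%:E)%E ->
  exists c1 c2 c3 c4 : R,
  [/\ 0 < c1, 0 < c2, 0 < c3 & 0 < c4] /\
  forall (V : choiceType) (adj : rel V) (N1 N2 : V -> nat)
         (omega : V -> V -> R) (N : V -> nat)
         (dO : measure_display) (Omega : measurableType dO)
         (P : V -> probability Omega R) (Y : R -> Omega -> V),
  infinite_graph adj ->
  volume_regular adj d Creg N1 ->
  local_sobolev adj d d' CS N2 ->
  conductances adj omega ->
  ereal_sup (range (limsup_norm adj p (mu_w adj omega))) = mubar%:E ->
  ereal_sup (range (limsup_norm adj q (nu_w adj omega))) = nubar%:E ->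
  norm_threshold adj p (mu_w adj omega) N ->
  norm_threshold adj q (nu_w adj omega) N ->
  constant_speed_walk adj omega P Y ->
  forall (t : R) (x : V), 0 < t ->
  (maxn (N x) (2 * maxn (N1 x) (N2 x)))%:R <= Num.sqrt t ->
  forall y : V,
  let D : R := (gdist adj x y)%:R in
  (D <= c1 * t ->
     heat_kernel adj omega P Y t x y
       <= c2 * t `^ (- (d / 2)) * expR (- c3 * D ^+ 2 / t)) /\
  (c1 * t <= D ->
     heat_kernel adj omega P Y t x y
       <= c2 * t `^ (- (d / 2)) * expR (- c4 * D * Num.max 1 (ln (D / t)))).
Proof.
move=> d2 dd' Creg0 CS0 p1 q1 pq.
have d'0 : 0 < d' by apply: lt_le_trans (le_trans d2 dd').
have d'2 : 2 <= d' by exact: le_trans dd'.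
have a01 : 0 < 2 / d' <= 1 by rewrite divr_gt0//= ler_pdivrMr// mul1r.
have [p0 [q0 [pp0 qq0 p01 q01 pq0]]] := finite_exponents p1 q1 a01 pq.
(* The absolute value and the added 1 make these bounds positive before any graph is given. *)
pose Mp := `|2 * mubar| + 1; pose Mq := `|2 * nubar| + 1.
have Mp0 : 0 < Mp by rewrite ltr_wpDl.
have Mq0 : 0 < Mq by rewrite ltr_wpDl.
pose Km := Creg * Mp `^ p0; pose Kn := Creg * Mq `^ q0.
have Km0 : 0 < Km by rewrite mulr_gt0// powR_gt0.
have Kn0 : 0 < Kn by rewrite mulr_gt0// powR_gt0.
have [C [C0 CE]] : exists C, 0 < C /\ C = fk_const d' CS p0 q0 Km Kn.
  by exists (fk_const d' CS p0 q0 Km Kn); split=> //; exact: fk_const_gt0.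
have [th [/andP[th0 th1] thE]] : exists th, 0 < th < 1 /\ th = fk_exponent d' p0 q0.
  by exists (fk_exponent d' p0 q0); split=> //; exact: fk_exponent_bounds.
have [J J4] : exists J : nat, 4 / th + 2 * d <= J%:R.
  by exists (Num.truncn (4 / th + 2 * d)).+1; rewrite ltW// truncnS_gt.
have A0 := mean_value_const_gt0 th J C0 Kn0.
set A := mean_value_const _ _ _ _ in A0 *.
have S0 := shape_const_gt0 R J; set S := shape_const _ _ in S0 *.
have d0 : 0 <= d by exact: le_trans d2.
(* The threshold is D = t, and 1/64 is the rate reached in both regimes; 2^d comes from sqrt t <= 2
   rho. *)
exists 1, (A * 2 `^ d * S), 64^-1, 64^-1; split.
  have c0 : 0 < 64^-1 :> R by rewrite invr_gt0 ltr0n.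
  split; [exact: ltr01| |exact: c0|exact: c0].
  by apply: mulr_gt0 => //; apply: mulr_gt0 => //; exact: powR_gt0.
move=> V adj N1 N2 omega N dO Omega P Y Gadj vol sob Comega supmu supnu thrmu thrnu walkY.
move=> t x t0 hN y D.
pose rho := Num.truncn (Num.sqrt t).
have /andP[rho_le lt_rho] : rho%:R <= Num.sqrt t < rho.+1%:R.
  by apply: truncn_itv; exact: sqrtr_ge0.
have max_rho : (maxn (N x) (2 * maxn (N1 x) (N2 x)) <= rho)%N.
  by rewrite -ltnS -(ltr_nat R); exact: le_lt_trans hN lt_rho.
have card1 n : 0 < card_set R (gball adj x n).
  rewrite card_ball_seq ltr0n lt0n size_eq0; apply/eqP => b0.
  by have := mem_ball_seq Gadj x n x; rewrite b0 gdistxx.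
(* At radius 0 the volume bound would read |B(x, 0)| <= 0. Hence N1 x >= 1, and the factor 2 in the
   hypothesis on t gives rho >= 2. *)
have N1x : (0 < N1 x)%N.
  rewrite lt0n; apply/eqP => N10; have := vol x 0%N; rewrite N10 => /(_ isT)/andP[_].
  rewrite powR0 ?mulr0; last by rewrite gt_eqF//; apply: lt_le_trans d2.
  by rewrite leNgt card1.
move: max_rho; rewrite geq_max => /andP[Nrho max_rho].
have N1rho : (N1 x <= rho)%N.
  by apply: leq_trans max_rho; rewrite mul2n -addnn (leq_trans (leq_maxl _ (N2 x)))// leq_addr.
have N2rho : (N2 x <= rho)%N.
  by apply: leq_trans max_rho; rewrite mul2n -addnn (leq_trans (leq_maxr (N1 x) _))// leq_addr.
have rho2 : (2 <= rho)%N.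
  by apply: leq_trans max_rho; rewrite -[X in (X <= _)%N]muln1 leq_mul2l/= leq_max N1x.
have rho1 : (0 < rho)%N by apply: leq_trans rho2.
have tE : t = Num.sqrt t ^+ 2 by rewrite sqr_sqrtr// ltW.
have rho_t : rho%:R ^+ 2 <= t by rewrite tE lerXn2r ?nnegrE ?sqrtr_ge0.
have t_rho : t <= 4 * rho%:R ^+ 2.
  have h : Num.sqrt t <= 2 * rho%:R.
    by apply: (le_trans (ltW lt_rho)); rewrite -natrM ler_nat mul2n -addnn -addn1 leq_add2l.
  rewrite tE; apply: (@le_trans _ _ ((2 * rho%:R) ^+ 2)).
    by rewrite lerXn2r ?nnegrE ?sqrtr_ge0 ?mulr_ge0.
  by rewrite exprMn (_ : 2 ^+ 2 = 4)// expr2; ring.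
have card_le n : (rho <= n)%N -> (size (ball_seq adj x n))%:R <= Creg * n%:R `^ d.
  move=> rn; have := vol x n (leq_trans N1rho rn).
  by rewrite card_ball_seq => /andP[].
have mup n : (rho <= n)%N ->
    \sum_(z <- ball_seq adj x n) mu_w adj omega z `^ p0 <= Km * n%:R `^ d.
  move=> rn; rewrite /Km mulrAC.
  apply: (avg_norm_sum Gadj pp0 p01 (mu_ge0 Gadj Comega) (ltW Mp0) (card_le n rn)).
  apply: (le_trans (norm_threshold_le supmu thrmu (leq_trans Nrho rn))).
  by rewrite /Mp (le_trans (ler_norm _))// lerDl.
have nuq n : (rho <= n)%N ->
    \sum_(z <- ball_seq adj x n) nu_w adj omega z `^ q0 <= Kn * n%:R `^ d.
  move=> rn; rewrite /Kn mulrAC.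
  apply: (avg_norm_sum Gadj qq0 q01 (nu_ge0 Gadj Comega) (ltW Mq0) (card_le n rn)).
  apply: (le_trans (norm_threshold_le supnu thrnu (leq_trans Nrho rn))).
  by rewrite /Mq (le_trans (ler_norm _))// lerDl.
have FK n : (rho <= n)%N ->
    faber_krahn_on adj omega (gball adj x n) (C * n%:R ^+ 2) (n%:R `^ d) th.
  move=> rn W f uW f0 fW; rewrite CE thE.
  exact: (faber_krahn Gadj Comega d'2 CS0 p01 q01 pq0 (ltW Km0) (ltW Kn0)
    (leq_trans rho1 rn) (sob x n (leq_trans N2rho rn)) (mup n rn) (nuq n rn) uW f0 fW).
pose B := A * rho%:R `^ (- d).
have B0 : 0 <= B by rewrite mulr_ge0 ?powR_ge0 ?(ltW A0).
have hB lam : 0 < lam -> heat_kernel adj omega P Y t x y <=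
    B * (1 + (gdist adj x y)%:R / rho%:R) ^+ J
      * expR (kappa lam * t - lam * (gdist adj x y - 2 * rho)%:R).
  move=> lam0; rewrite (heat_kernelE Gadj Comega walkY)//; last exact: ltW.
  exact: (two_point_bound Gadj Comega y d2 q01 C0 th0 (ltW th1) Kn0 J4 rho1 FK nuq rho_t lam0).
have BS : B * S <= A * 2 `^ d * S * t `^ (- (d / 2)).
  rewrite /B [leRHS]mulrAC ler_wpM2r ?(ltW S0)// -[leRHS]mulrA ler_wpM2l ?(ltW A0)//.
  exact: ball_scale_le.
split.
  rewrite mul1r => Dt; apply: (le_trans (gauss_bound t0 rho2 rho_t t_rho B0 hB Dt)).
  have -> : - 64^-1 * D ^+ 2 / t = - (D ^+ 2 / (64 * t)) by field; rewrite gt_eqF.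
  by rewrite ler_wpM2r ?expR_ge0.
rewrite mul1r => tD; apply: (le_trans (poisson_bound t0 rho2 rho_t t_rho B0 hB tD)).
have -> : - 64^-1 * D * Num.max 1 (ln (D / t)) = - (D * Num.max 1 (ln (D / t)) / 64).
  by field.
by rewrite ler_wpM2r ?expR_ge0.
Qed.
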